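(* Write $\mathbb{W}(M)$ for the Weyl graph of type $M$. The following hold. (1) Let $M$ be one of: $A_n$ with $n\geqslant 8$; $B_n$ or $C_n$ with $n=3$ or $n\geqslant 5$; $D_n$ with $n\geqslant 9$; $E_7$. If $\Gamma$ is a connected graph (a connected bichromatic graph if $M$ is $B_n$ or $C_n$) that is locally like $\mathbb{W}(M)$, then $\Gamma\cong\mathbb{W}(M)$ (as bichromatic graphs if $M$ is $B_n$ or $C_n$). (2) Let $M$ be one of $A_6$, $A_7$, $D_7$, $D_8$, $E_6$, $E_8$. If $\Gamma$ is a graph that is locally like $\mathbb{W}(M)$ and $|\Gamma|=|\mathbb{W}(M)|$, then $\Gamma\cong\mathbb{W}(M)$. (3) Up to isomorphism of bichromatic graphs, $\mathbb{W}(F_4)$ and its twisted copy $\mathbb{W}(F_4)'$ are the only bichromatic graphs with exactly $24$ vertices that are locally like $\mathbb{W}(F_4)$.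
   Context: All graphs are simple and undirected; $|\Gamma|$ is the number of vertices of $\Gamma$. For a vertex $x$ of a graph $\Gamma$, $x^\perp$ denotes the set of neighbors of $x$; the induced subgraph on $x^\perp$ is the local graph at $x$. A graph $\Gamma$ is locally homogeneous if all its local graphs are isomorphic to one graph, denoted $\Delta(\Gamma)$ (the local graph of $\Gamma$). For locally homogeneous graphs $\Gamma,\Lambda$, $\Lambda$ is locally like $\Gamma$ if $\Delta(\Lambda)\cong\Delta(\Gamma)$. A bichromatic graph is a graph in which each vertex is designated either short or long (adjacent vertices may have the same type); morphisms and isomorphisms of bichromatic graphs preserve the type, and induced subgraphs inherit it. A bichromatic graph $\Gamma$ is locally homogeneous if the local graphs at short vertices are all isomorphic (as bichromatic graphs) to one bichromatic graph $\Delta_s(\Gamma)$ and the local graphs at long vertices are all isomorphic to one bichromatic graph $\Delta_\ell(\Gamma)$. For bichromatic locally homogeneous graphs $\Gamma,\Lambda$, $\Lambda$ is locally like $\Gamma$ if $\Delta_s(\Lambda)\cong\Delta_s(\Gamma)$ and $\Delta_\ell(\Lambda)\cong\Delta_\ell(\Gamma)$ as bichromatic graphs. Weyl graphs: let $\Phi$ be an irreducible crystallographic root system with Dynkin diagram $M$, and let $W(M)$ be its Weyl group, generated by the reflections through the roots of $\Phi$. The Weyl graph $\mathbb{W}(M)$ is the graph whose vertices are the reflections of $W(M)$, two distinct reflections being adjacent if and only if they commute. If $M$ is simply laced ($A_n$, $D_n$, $E_n$), $\mathbb{W}(M)$ is regarded as an ordinary graph; it is locally homogeneous. If $M$ is not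 simply laced, $\mathbb{W}(M)$ is regarded as a bichromatic graph in which reflections in short roots are the short vertices and reflections in long roots are the long vertices; it is locally homogeneous as a bichromatic graph. Explicitly, $\mathbb{W}(B_n)$ has vertices $y_{i,j}$, $1\leqslant i,j\leqslant n$, where the $y_{i,i}$ are short and the $y_{i,j}$ with $i\neq j$ are long, and distinct vertices $y_{i,j},y_{k,l}$ are adjacent if and only if $\{i,j\}\cap\{k,l\}=\emptyset$ or $(k,l)=(j,i)$; $\mathbb{W}(C_n)$ is obtained from $\mathbb{W}(B_n)$ by exchanging short and long. $\mathbb{W}(F_4)$ has $24$ vertices, with $\Delta_s(\mathbb{W}(F_4))\cong\mathbb{W}(B_3)$ and $\Delta_\ell(\mathbb{W}(F_4))\cong\mathbb{W}(C_3)$. Twisted copy: in any bichromatic graph $\Gamma$ locally like $\mathbb{W}(F_4)$, the induced subgraph on the short vertices, and likewise on the long vertices, is a disjoint union of $4$-cliques (complete graphs on $4$ vertices, with no edges between different ones). A short such $4$-clique $X$ and a long such $4$-clique $Y$ are strongly connected if every vertex of $X$ has a neighbor in $Y$ and every vertex of $Y$ has a neighbor in $X$. In this case one can write $X=\{x_1,x_2,x_3,x_4\}$ and $Y=\{y_1,y_2,y_3,y_4\}$ such that the adjacencies between $X$ and $Y$ are exactly: each of $x_1,x_2$ is adjacent to each of $y_1,y_2$, and each of $x_3,x_4$ is adjacent to each of $y_3,y_4$. Replacing these adjacencies by: each of $x_1,x_2$ is adjacent to each of $y_3,y_4$, and each of $x_3,x_4$ is adjacent to each of $y_1,y_2$ (all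 other adjacencies unchanged) gives a bichromatic graph, again locally like $\mathbb{W}(F_4)$, called a twisted copy of $\Gamma$. For $\Gamma=\mathbb{W}(F_4)$ all twisted copies are isomorphic, and the resulting graph is denoted $\mathbb{W}(F_4)'$. *)

(* Defs.v *)
From mathcomp Require Import all_boot all_order all_algebra.
From Stdlib Require Import Relation_Operators.

Set Implicit Arguments.
Unset Strict Implicit.
Unset Printing Implicit Defensive.

Import Order.TTheory GRing.Theory Num.Theory.
Local Open Scope ring_scope.

(* Vertex sets are arbitrary types, so graphs may be infinite. *)
Record graph := Graph {
  vertex :> Type;
  adj : vertex -> vertex -> Prop;
  adj_sym : forall x y, adj x y -> adj y x;
  adj_irr : forall x, ~ adj x x }.

(* The long vertices are the vertices that are not short. *)
Record bigraph := Bigraph {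
  ugraph :> graph;
  short : ugraph -> Prop }.

Definition graph_iso (G H : graph) : Prop :=
  exists f : G -> H, bijective f /\ forall x y, adj x y <-> adj (f x) (f y).

Definition bigraph_iso (G H : bigraph) : Prop :=
  exists f : G -> H,
    [/\ bijective f,
        forall x y, adj x y <-> adj (f x) (f y)
      & forall x, short x <-> short (f x)].

Definition induced (G : graph) (P : G -> Prop) : graph :=
  @Graph {x : G | P x} (fun u v => adj (sval u) (sval v))
    (fun u v => @adj_sym G (sval u) (sval v)) (fun u => @adj_irr G (sval u)).

Definition induced_bi (G : bigraph) (P : G -> Prop) : bigraph :=
  @Bigraph (@induced G P) (fun u => short (sval u)).

Definition local_graph (G : graph) (x : G) : graph := @induced G (adj x).

Definition local_bigraph (G : bigraph) (x : G) : bigraph :=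
  @induced_bi G (adj x).

(* G is locally homogeneous, with Delta(G) = D. *)
Definition has_local_graph (G D : graph) : Prop :=
  forall x : G, graph_iso (local_graph x) D.

Definition locally_like (L G : graph) : Prop :=
  exists DL DG : graph,
    [/\ has_local_graph L DL, has_local_graph G DG & graph_iso DL DG].

(* G is locally homogeneous, with Delta_s(G) = Ds and Delta_l(G) = Dl. *)
Definition has_local_bigraphs (G Ds Dl : bigraph) : Prop :=
  (forall x : G, short x -> bigraph_iso (local_bigraph x) Ds) /\
  (forall x : G, ~ short x -> bigraph_iso (local_bigraph x) Dl).

Definition bi_locally_like (L G : bigraph) : Prop :=
  exists Ls Ll Gs Gl : bigraph,
    [/\ has_local_bigraphs L Ls Ll, has_local_bigraphs G Gs Gl,
        bigraph_iso Ls Gs & bigraph_iso Ll Gl].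

(* A connected graph is nonempty: the empty graph is vacuously locally like
   every graph. *)
Definition connected (G : graph) : Prop :=
  inhabited G /\ forall x y : G, clos_refl_trans G (@adj G) x y.

Definition same_card (T U : Type) : Prop := exists f : T -> U, bijective f.

Definition dot n (u v : 'rV[rat]_n) : rat := \sum_i u 0 i * v 0 i.

(* Matrices act on row vectors from the right:
   v *m refl a = v - (2 (v,a) / (a,a)) a. *)
Definition refl n (a : 'rV[rat]_n) : 'M[rat]_n :=
  1%:M - (2 / dot a a) *: (a^T *m a).

Definition e n (i : 'I_n) : 'rV[rat]_n := delta_mx 0 i.

(* Bourbaki's realizations of the root systems. The roots of A_n, E_6 and E_7
   do not span the ambient space; this does not affect which reflections
   commute. *)
Definition rootsA n (a : 'rV[rat]_n.+1) : Prop :=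
  exists i j : 'I_n.+1, i <> j /\ a = e i - e j.

Definition rootsD n (a : 'rV[rat]_n) : Prop :=
  exists (i j : 'I_n) (s t : bool),
    i <> j /\ a = (-1) ^+ s *: e i + (-1) ^+ t *: e j.

Definition rootsB n (a : 'rV[rat]_n) : Prop :=
  rootsD a \/ exists (i : 'I_n) (s : bool), a = (-1) ^+ s *: e i.

Definition rootsC n (a : 'rV[rat]_n) : Prop :=
  rootsD a \/ exists (i : 'I_n) (s : bool), a = (-1) ^+ s *: (2 *: e i).

(* The vector with entries -1/2 at the indices in S and 1/2 elsewhere. *)
Definition half_vec n (S : {set 'I_n}) : 'rV[rat]_n :=
  \row_i ((-1) ^+ (i \in S) / 2).

Definition rootsE8 (a : 'rV[rat]_8) : Prop :=
  rootsD a \/ exists S : {set 'I_8}, ~~ odd #|S| /\ a = half_vec S.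

Definition rootsE7 (a : 'rV[rat]_8) : Prop :=
  rootsE8 a /\ dot a (e (inord 6) + e (inord 7)) = 0.

Definition rootsE6 (a : 'rV[rat]_8) : Prop :=
  rootsE7 a /\ dot a (e (inord 5) + e (inord 7)) = 0.

Definition rootsF4 (a : 'rV[rat]_4) : Prop :=
  rootsB a \/ exists S : {set 'I_4}, a = half_vec S.

Inductive dynkin :=
  A_ of nat | B_ of nat | C_ of nat | D_ of nat | E_6 | E_7 | E_8 | F_4.

Definition ambient_dim (M : dynkin) : nat :=
  match M with
  | A_ n => n.+1
  | B_ n | C_ n | D_ n => n
  | E_6 | E_7 | E_8 => 8
  | F_4 => 4
  end.

Definition roots (M : dynkin) : 'rV[rat]_(ambient_dim M) -> Prop :=
  match M return 'rV[rat]_(ambient_dim M) -> Prop with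
  | A_ n => @rootsA n
  | B_ n => @rootsB n
  | C_ n => @rootsC n
  | D_ n => @rootsD n
  | E_6 => rootsE6
  | E_7 => rootsE7
  | E_8 => rootsE8
  | F_4 => rootsF4
  end.

Section WeylGraph.
Variables (n : nat) (Phi : 'rV[rat]_n -> Prop).

(* The reflections of the Weyl group are the reflections through the roots. *)
Definition reflection : Type := {g : 'M[rat]_n | exists2 a, Phi a & g = refl a}.

Definition refl_adj (r t : reflection) : Prop :=
  sval r <> sval t /\ sval r *m sval t = sval t *m sval r.

Lemma refl_adj_sym r t : refl_adj r t -> refl_adj t r.
Proof. by case=> neq comm; split=> // /esym. Qed.

Lemma refl_adj_irr r : ~ refl_adj r r.
Proof. by case. Qed.

Definition weyl_graph_of : graph := Graph refl_adj_sym refl_adj_irr.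

Definition short_root (a : 'rV[rat]_n) : Prop :=
  Phi a /\ exists2 b, Phi b & dot a a < dot b b.

Definition weyl_bigraph_of : bigraph :=
  @Bigraph weyl_graph_of
    (fun r => exists2 a, short_root a & sval r = refl a).

End WeylGraph.

Definition weyl_graph (M : dynkin) : graph := weyl_graph_of (@roots M).
Definition weyl_bigraph (M : dynkin) : bigraph := weyl_bigraph_of (@roots M).

(* x enumerates a short (c = true) or long (c = false) 4-clique that is a
   connected component of the induced subgraph on the vertices of that type. *)
Definition mono_clique (G : bigraph) (c : bool) (x : 'I_4 -> G) : Prop :=
  let has_type v := if c then short v else ~ short v in
  [/\ injective x,
      forall i, has_type (x i),
      forall i j, i <> j -> adj (x i) (x j)
    & forall i v, has_type v -> adj (x i) v -> exists j, v = x j].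

Definition strongly_connected (G : graph) (x y : 'I_4 -> G) : Prop :=
  (forall i, exists j, adj (x i) (y j)) /\
  (forall j, exists i, adj (x i) (y j)).

(* Indices 0, 1, 2, 3 stand for the subscripts 1, 2, 3, 4. *)
Record twist_data (G : bigraph) := TwistData {
  tw_x : 'I_4 -> G;
  tw_y : 'I_4 -> G;
  tw_short : mono_clique true tw_x;
  tw_long : mono_clique false tw_y;
  tw_strong : strongly_connected tw_x tw_y;
  tw_adj : forall i j : 'I_4,
    adj (tw_x i) (tw_y j) <-> (i < 2)%N = (j < 2)%N }.

Section Twist.
Variables (G : bigraph) (d : twist_data G).

Definition xy_pair (i j : 'I_4) (u v : G) : Prop :=
  (u = tw_x d i /\ v = tw_y d j) \/ (u = tw_y d j /\ v = tw_x d i).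

Definition twist_adj (u v : G) : Prop :=
  (exists i j : 'I_4, xy_pair i j u v /\ (i < 2)%N <> (j < 2)%N) \/
  (adj u v /\ ~ exists i j : 'I_4, xy_pair i j u v).

Lemma xy_pair_sym i j u v : xy_pair i j u v -> xy_pair i j v u.
Proof. by case=> -[-> ->]; [right | left]. Qed.

Lemma twist_adj_sym u v : twist_adj u v -> twist_adj v u.
Proof.
case=> [[i [j [uv ij]]] | [uv nxy]]; [left | right].
  by exists i, j; split=> //; apply: xy_pair_sym.
split; first exact: adj_sym.
by case=> i [j vu]; apply: nxy; exists i, j; apply: xy_pair_sym.
Qed.

Lemma twist_adj_irr u : ~ twist_adj u u.
Proof.
have [_ xs _ _] := tw_short d; have [_ yl _ _] := tw_long d.
case=> [[i [j [uu _]]] | [uu _]]; last exact: adj_irr uu.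
by case: uu => -[-> xy]; apply: (yl j); [rewrite -xy | rewrite xy]; apply: xs.
Qed.

Definition twist : bigraph :=
  @Bigraph (Graph twist_adj_sym twist_adj_irr) (@short G).

End Twist.

(* Main.v *)
Require Import Defs.
From mathcomp Require Import all_boot all_order all_algebra.
From mathcomp Require Import all_fingroup boolp zify ring lra.

Set Implicit Arguments.
Unset Strict Implicit.
Unset Printing Implicit Defensive.

Import Order.TTheory GRing.Theory Num.Theory.

(** Let W be the Weyl graph and G a graph that is locally like it. Put the
    non-adjacency relation of a graph into a matrix over the field with two
    elements. In the simply laced types, if the reflections in the roots a and b
    do not commute, then the row of the reflection in a + b or a - b is the sum of
    the rows of the two; the same therefore holds inside every local graph of G.
    Two facts turn this into an isomorphism.

    - Sums glue ([cotriangular_of_local]): if the set M(x,y) of common neighbours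
      of two non-adjacent vertices x and y is determined by the part of it near
      one of its members, then the sum of x and y found near one common neighbour
      is the sum in all of G.
    - Sums generate ([iso_of_generators], [cotriangular_iso]): the rows of x, of y
      and of the neighbours of x span the rows of G, and a vertex is determined by
      its row. So G is determined by the local graph at x together with the subset
      M(x,y) of it.

    It remains to show that M(x,y), as a subset of the local graph, is one of those
    that occur in W. In type A with n at least 8 the local graph is the Kneser
    graph of the pairs from at least seven points, M(x,y) consists of the pairs
    that avoid one point, and connectedness gives diameter two ([kneser_mu]). For
    A6, A7, E6 and E8 the local structure leaves few candidates, found by
    computation ([line_words], [matching_words]); the edges between the neighbours
    of x and the other vertices are counted in two ways, and since the order of G
    is that of W, the average size of M(x,y) is extremal among the candidates
    ([mu_extremal]). For E6 the average is the smallest nonzero size, and a separate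
    count shows that M(x,y) is not empty ([mu_neq0]).

    In type D every vertex has a twin, with which it shares its other neighbours;
    the quotient by twins is locally like the Weyl graph of type A of rank one less
    ([D_iso_of_A]). In type E7 the local graph is a generalized quadrangle with
    doubled points, G is the collinearity graph of a polar space with three points
    on a line, and the sums are those of adjacent vertices ([third_row_sum],
    [polar_iso]).

    In types B and C the reflections in the coordinate axes form a clique. The
    corresponding clique of G dominates G, and each remaining vertex is
    adjacent to all but two members of it; this labels it by an unordered pair,
    and the charts at the members of the clique distinguish the two vertices with
    the same label ([clique_bchart]).

    In type F4 the 24 vertices form three short and three long cliques of four
    points. Each clique can be labelled by the plane over the field with two
    elements so that a short and a long clique are joined by an affine equation
    whose linear part is fixed ([f4_chart]). Only the nine constant terms are free;
    translating the planes changes them, but keeps their sum ([charted_std]). A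
    twist complements one of them, so exactly two graphs arise ([twist_chart]). *)

(** * Rows of the non-adjacency matrix *)

Definition relgraph (V : eqType) (E : rel V) (Es : symmetric E)
    (Ei : irreflexive E) : graph :=
  @Graph V (fun x y => E x y) (fun x y xy => etrans (Es y x) xy)
    (fun x xx => notF (etrans (esym (Ei x)) xx)).

Definition nadj (V : eqType) (E : rel V) (x y : V) : bool :=
  (x != y) && ~~ E x y.

(** Over the field with two elements, the row of [s] in the non-adjacency
    matrix is the sum of the rows of [a] and [b]. *)
Definition row_sum (V : eqType) (E : rel V) (s a b : V) : Prop :=
  forall w, nadj E s w = nadj E a w (+) nadj E b w.

Definition reduced (V : eqType) (E : rel V) : Prop :=
  forall v w, (forall t, nadj E v t = nadj E w t) -> v = w.

Definition sum_closed (V : eqType) (E : rel V) (eps : bool) : Prop :=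
  forall a b, a != b -> nadj E a b = eps -> exists s, row_sum E s a b.

Inductive generated (V : eqType) (E : rel V) (eps : bool) (S : V -> Prop) :
    V -> Prop :=
| GenBase s of S s : generated E eps S s
| GenSum a b s of generated E eps S a & generated E eps S b & a != b
    & nadj E a b = eps & row_sum E s a b : generated E eps S s.

Section Rows.

Variables (V : eqType) (E : rel V).
Hypotheses (Es : symmetric E) (Ei : irreflexive E).

Lemma nadjC x y : nadj E x y = nadj E y x.
Proof. by rewrite /nadj eq_sym Es. Qed.

Lemma nadjxx x : nadj E x x = false.
Proof. by rewrite /nadj eqxx. Qed.

Lemma adj_nadj x y : E x y = (x != y) && ~~ nadj E x y.
Proof.
by rewrite /nadj; case: eqVneq => [->|_]; rewrite ?Ei //= negbK.
Qed.

Lemma adj_neq x y : E x y -> x != y.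
Proof. by rewrite adj_nadj => /andP[]. Qed.

Lemma adjF_nadj x y : x != y -> nadj E x y = ~~ E x y.
Proof. by rewrite /nadj => ->. Qed.

Lemma adj_nadjF x y : E x y -> nadj E x y = false.
Proof. by rewrite /nadj => ->; rewrite andbF. Qed.

Lemma nadj_adjF x y : nadj E x y -> E x y = false.
Proof. by case/andP=> _ /negbTE. Qed.

Lemma nadj_neq x y : nadj E x y -> x != y.
Proof. by case/andP. Qed.

End Rows.

Section Transfer.

Variables (V V' : eqType) (E : rel V) (E' : rel V').
Hypotheses (Es : symmetric E) (Es' : symmetric E').
Hypotheses (redE : reduced E) (redE' : reduced E').
Variables (eps : bool) (R0 : V -> V' -> Prop).
Hypotheses (scE : sum_closed E eps) (scE' : sum_closed E' eps).
Hypothesis match0 : forall a a' b b',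
  R0 a a' -> R0 b b' -> nadj E a b = nadj E' a' b'.

(** The extension of [R0] to the vertices that arise from matching sums. *)
Inductive matched : V -> V' -> Prop :=
| MatchBase a a' of R0 a a' : matched a a'
| MatchSum a a' b b' s s' of matched a a' & matched b b'
    & row_sum E s a b & row_sum E' s' a' b' : matched s s'.

Lemma matched_nadj a a' b b' :
  matched a a' -> matched b b' -> nadj E a b = nadj E' a' b'.
Proof.
move=> Ra; elim: Ra b b' => {a a'} [a a' Ra|a a' c c' s s' _ IHa _ IHc sE sE'].
  move=> b b'; elim=> {b b'} [b b'|b b' c c' s s' _ IHb _ IHc sE sE'].
    exact: match0.
  by rewrite (nadjC Es) (nadjC Es') sE sE' !(nadjC Es _ a) !(nadjC Es' _ a') IHb IHc.
by move=> b b' Rb; rewrite sE sE' (IHa _ _ Rb) (IHc _ _ Rb).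
Qed.

Hypothesis genE : forall v, generated E eps (fun a => exists a', R0 a a') v.

Lemma matched_total v : exists v', matched v v'.
Proof.
elim: (genE v) => {v} [s [s' Rs]|a b s _ [a' Ra] _ [b' Rb] ab eab sE].
  by exists s'; constructor.
have [eab' | ab'] := eqVneq a' b'.
  (* rows of a and b agree on every vertex that has a partner *)
  have eqr : forall t, nadj E a t = nadj E b t.
    move=> t; elim: (genE t) => {t} [t [t' Rt]|c d t _ IHc _ IHd _ _ sE'].
      have Rt0 := MatchBase Rt.
      by rewrite (matched_nadj Ra Rt0) (matched_nadj Rb Rt0) eab'.
    by rewrite !(nadjC Es _ t) !sE' !(nadjC Es _ a) !(nadjC Es _ b) IHc IHd.
  by move: ab; rewrite (redE eqr) eqxx.
have [s' sE'] : exists s', row_sum E' s' a' b'.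
  by apply: scE' => //; rewrite -(matched_nadj Ra Rb).
by exists s'; exact: MatchSum Ra Rb sE sE'.
Qed.

End Transfer.

Lemma matched_sym (V V' : eqType) (E : rel V) (E' : rel V')
    (R0 : V -> V' -> Prop) v v' :
  matched E E' R0 v v' -> matched E' E (fun a' a => R0 a a') v' v.
Proof.
elim=> [a a' Ra|a a' b b' s s' _ Ra _ Rb sE sE']; first by constructor.
exact: MatchSum Ra Rb sE' sE.
Qed.

(** In a reduced graph a vertex is determined by its row, and a row in the span
    of the generators is determined by the adjacencies between generators; so
    matched generators extend to an isomorphism. *)
Lemma iso_of_generators (V V' : eqType) (E : rel V) (E' : rel V')
    (Es : symmetric E) (Ei : irreflexive E)
    (Es' : symmetric E') (Ei' : irreflexive E')
    (eps : bool) (R0 : V -> V' -> Prop) :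
  reduced E -> reduced E' -> sum_closed E eps -> sum_closed E' eps ->
  (forall a a' b b', R0 a a' -> R0 b b' -> nadj E a b = nadj E' a' b') ->
  (forall v, generated E eps (fun a => exists a', R0 a a') v) ->
  (forall v, generated E' eps (fun a' => exists a, R0 a a') v) ->
  graph_iso (relgraph Es Ei) (relgraph Es' Ei').
Proof.
move=> redE redE' scE scE' m0 genE genE'.
have tot : forall v, exists v', matched E E' R0 v v'.
  exact: (@matched_total _ _ _ _ Es Es' redE eps).
have m0' a' a b' b : R0 a a' -> R0 b b' -> nadj E' a' b' = nadj E a b.
  by move=> Ra Rb; rewrite (m0 _ _ _ _ Ra Rb).
have tot' : forall v', exists v, matched E E' R0 v v'.
  move=> v'; have [v /matched_sym] := @matched_total _ _ _ _ Es' Es redE' eps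
    (fun a' a => R0 a a') scE (fun a' a b' b => @m0' a' a b' b) genE' v'.
  by exists v.
have mE := @matched_nadj _ _ E E' Es Es' R0 m0.
have [f fP] := choice tot; have [g gP] := choice tot'.
have fK : cancel f g.
  move=> v; apply: redE => t; have [t' Rt] := tot t.
  by rewrite (mE _ _ _ _ (gP (f v)) Rt) (mE _ _ _ _ (fP v) Rt).
have gK : cancel g f.
  move=> v; apply: redE' => t; have [t' Rt] := tot' t.
  by rewrite -(mE _ _ _ _ (fP (g v)) Rt) (mE _ _ _ _ (gP v) Rt).
exists f; split; first by exists g.
move=> x y /=; rewrite (adj_nadj Ei) (adj_nadj Ei') (mE _ _ _ _ (fP x) (fP y)).
by rewrite (can_eq fK).
Qed.

(** * Cotriangular graphs *)

Section Cotriangular.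

Variables (V : eqType) (E : rel V).
Hypotheses (Es : symmetric E) (Ei : irreflexive E).

Definition no_cone : Prop :=
  forall z v, E z v -> exists2 t, E z t & nadj E v t.

Definition locally_reduced : Prop :=
  forall z v w, E z v -> E z w ->
  (forall t, E z t -> nadj E v t = nadj E w t) -> v = w.

Definition local_sum (z s a b : V) : Prop :=
  forall w, E z w -> nadj E s w = nadj E a w (+) nadj E b w.

Definition locally_cotriangular : Prop :=
  forall z x y, E z x -> E z y -> nadj E x y ->
  exists2 s, E z s & local_sum z s x y.

(** Near [z], only [y] and the sum of [x] and [y] have the same common neighbours
    with [x] as [y] has. *)
Definition locally_rigid : Prop :=
  forall z x y y', E z x -> E z y -> E z y' -> nadj E x y -> nadj E x y' ->
  (forall w, E z w -> E x w -> E y w = E y' w) ->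
  y' = y \/ local_sum z y' x y.

(** Among the vertices not adjacent to [x], the set of common neighbours with [x]
    is determined by its part near any one member [z]. *)
Definition mu_determined : Prop :=
  forall x y s z, nadj E x y -> nadj E x s -> E x z -> E z y -> E z s ->
  (forall w, E x w -> E z w -> E y w = E s w) ->
  forall w, E x w -> E y w = E s w.

Definition mu_meet : Prop :=
  forall x y w, nadj E x y -> nadj E x w ->
  exists z, [/\ E x z, E z y & E z w].

Lemma reduced_of_no_cone : no_cone -> reduced E.
Proof.
move=> nc v w rvw; have [//|vw] := eqVneq v w.
have Evw : E v w by rewrite (adj_nadj Ei) vw /= rvw nadjxx.
have [t vt wt] := nc v w Evw.
by rewrite -rvw adj_nadjF in wt.
Qed.

(** Write M(x,y) for the common neighbours of [x] and [y]. The sum [s] of [x]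
    and [y] is found inside the neighbourhood of one [z] in M(x,y); then
    M(x,s) = M(x,y), since these sets agree near [z]. A vertex [w] not adjacent
    to [x] has a common neighbour [z'] with [x] and [y], and the sum of [x] and
    [y] found near [z'] is again [s], so the row identity holds at [w]. *)
Lemma cotriangular_of_local :
  locally_reduced -> locally_cotriangular -> locally_rigid ->
  mu_determined -> mu_meet -> sum_closed E true.
Proof.
move=> lr lc rig det meet.
have sumM z x y s : E z x -> E z y -> nadj E x y -> E z s -> local_sum z s x y ->
    nadj E x s /\ forall w, E x w -> E y w = E s w.
  move=> zx zy xy zs sE.
  have xs : nadj E x s by rewrite nadjC // sE // nadjxx nadjC.
  split=> //; apply: (det _ _ _ z) => //; first by rewrite Es.
  move=> w xw zw; have := sE w zw; rewrite (adj_nadjF xw) addFb.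
  have neq v : nadj E x v -> v != w.
    by move=> xv; apply: contraTneq xw => <-; rewrite (nadj_adjF xv).
  by rewrite !adjF_nadj ?neq // => /negb_inj.
move=> x y nxy xy.
have [z [xz zy _]] := meet x y y xy xy.
have zx : E z x by rewrite Es.
have [s zs sE] := lc z x y zx zy xy.
have [xs Mxs] := sumM _ _ _ _ zx zy xy zs sE.
exists s => w; have [<-|nxw] := eqVneq x w.
  by rewrite nadjxx nadjC // xs nadjC // xy.
have [xw|] := boolP (E x w).
  have neq v : nadj E x v -> v != w.
    by move=> xv; apply: contraTneq xw => <-; rewrite (nadj_adjF xv).
  by rewrite (adj_nadjF xw) addFb !adjF_nadj ?neq // Mxs.
move=> xw; have {}xw : nadj E x w by rewrite /nadj nxw.
have [z' [xz' z'y z'w]] := meet x y w xy xw.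
have z'x : E z' x by rewrite Es.
have [s' z's' s'E] := lc z' x y z'x z'y xy.
have [xs' Mxs'] := sumM _ _ _ _ z'x z'y xy z's' s'E.
have zs' : E z s' by rewrite Es -Mxs' // Es.
have [eqy|lsum] := rig z x y s' zx zy zs' xy xs' (fun w _ xw => Mxs' w xw).
  have := s'E y z'y; rewrite eqy xy nadjxx => //.
have <- : s' = s.
  by apply: (lr z) => // t zt; rewrite sE // lsum.
exact: s'E.
Qed.

(** Every vertex outside these generators is the sum of two of them, or the
    sum of [x] and such a vertex. *)
Lemma cotriangular_generated x y :
  reduced E -> sum_closed E true -> nadj E x y ->
  forall v, generated E true (fun a => [\/ a = x, a = y | E x a]) v.
Proof.
move=> red sc xy.
pose S a := [\/ a = x, a = y | E x a].
have far v : nadj E x v -> nadj E y v -> generated E true S v.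
  move=> xv yv; have [t tE] := sc y v (nadj_neq yv) yv.
  have xt : nadj E x t = false by rewrite nadjC // tE nadjC // xy nadjC // xv.
  apply: (@GenSum _ _ _ _ y t).
  - by apply: GenBase; apply: Or32.
  - apply: GenBase; have [->|ntx] := eqVneq t x; first exact: Or31.
    by apply: Or33; rewrite (adj_nadj Ei) eq_sym ntx xt.
  - by apply: contraFneq xt => <-.
  - by rewrite nadjC // tE nadjxx nadjC.
  - by move=> w; rewrite tE addKb.
move=> v; have [->|nvx] := eqVneq v x; first by apply: GenBase; apply: Or31.
have [xv|] := boolP (E x v); first by apply: GenBase; apply: Or33.
move=> xv; have {}xv : nadj E x v by rewrite /nadj eq_sym nvx.
have [->|nvy] := eqVneq v y; first by apply: GenBase; apply: Or32.
case yv: (nadj E y v); first exact: far.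
have [t tE] := sc x v (nadj_neq xv) xv.
have xt : nadj E x t by rewrite nadjC // tE nadjxx nadjC.
apply: (@GenSum _ _ _ _ x t) => //.
- by apply: GenBase; apply: Or31.
- by apply: far => //; rewrite nadjC // tE xy nadjC // yv.
- exact: nadj_neq xt.
- by move=> w; rewrite tE addKb.
Qed.

End Cotriangular.

(** Generators [x], [y] and the neighbours of [x], the latter indexed through
    [p] by a common index set on both sides. *)
Lemma cotriangular_iso (V V' : eqType) (E : rel V) (E' : rel V')
    (Es : symmetric E) (Ei : irreflexive E)
    (Es' : symmetric E') (Ei' : irreflexive E')
    (I : Type) (Dom : I -> Prop) (p : I -> V) (p' : I -> V') x y x' y' :
  reduced E -> reduced E' -> sum_closed E true -> sum_closed E' true ->
  nadj E x y -> nadj E' x' y' ->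
  (forall i, Dom i -> E x (p i)) -> (forall i, Dom i -> E' x' (p' i)) ->
  (forall z, E x z -> exists2 i, Dom i & z = p i) ->
  (forall z, E' x' z -> exists2 i, Dom i & z = p' i) ->
  (forall i j, Dom i -> Dom j -> nadj E (p i) (p j) = nadj E' (p' i) (p' j)) ->
  (forall i, Dom i -> E y (p i) = E' y' (p' i)) ->
  graph_iso (relgraph Es Ei) (relgraph Es' Ei').
Proof.
move=> red red' sc sc' xy xy' px px' ps ps' pE yE.
pose R0 a a' := [\/ a = x /\ a' = x', a = y /\ a' = y'
  | exists2 i, Dom i & a = p i /\ a' = p' i].
have nyp i : Dom i -> nadj E y (p i) = nadj E' y' (p' i).
  move=> Di; rewrite !adjF_nadj ?yE //.
    by apply: contraTneq (px' i Di) => <-; rewrite (nadj_adjF xy').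
  by apply: contraTneq (px i Di) => <-; rewrite (nadj_adjF xy).
apply: (@iso_of_generators _ _ _ _ Es Ei Es' Ei' true R0) => //.
- move=> a a' b b'.
  case=> [[-> ->]|[-> ->]|[i Di [-> ->]]] [[-> ->]|[-> ->]|[j Dj [-> ->]]].
  + by rewrite !nadjxx.
  + by rewrite xy xy'.
  + by rewrite !adj_nadjF ?px ?px'.
  + by rewrite nadjC // xy nadjC // xy'.
  + by rewrite !nadjxx.
  + exact: nyp.
  + by rewrite nadjC // [RHS]nadjC // !adj_nadjF ?px ?px'.
  + by rewrite nadjC // [RHS]nadjC // nyp.
  + exact: pE.
- move=> v; elim: (cotriangular_generated Es Ei red sc xy v) => {v}.
    move=> s Ss; apply: GenBase; case: Ss => [->|->|/ps[i Di ->]].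
    + by exists x'; apply: Or31.
    + by exists y'; apply: Or32.
    + by exists (p' i); apply: Or33; exists i.
  by move=> a b s _ ga _ gb ab eab sE; exact: GenSum ga gb ab eab sE.
- move=> v; elim: (cotriangular_generated Es' Ei' red' sc' xy' v) => {v}.
    move=> s Ss; apply: GenBase; case: Ss => [->|->|/ps'[i Di ->]].
    + by exists x; apply: Or31.
    + by exists y; apply: Or32.
    + by exists (p i); apply: Or33; exists i.
  by move=> a b s _ ga _ gb ab eab sE; exact: GenSum ga gb ab eab sE.
Qed.

(** * Isomorphisms and local charts *)

Lemma graph_iso_refl G : graph_iso G G.
Proof. by exists id; split=> //; exists id. Qed.

Lemma graph_iso_sym G H : graph_iso G H -> graph_iso H G.
Proof.
case=> f [[g fK gK] fE]; exists g; split; first by exists f.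
by move=> x y; rewrite fE !gK.
Qed.

Lemma graph_iso_trans G H K : graph_iso G H -> graph_iso H K -> graph_iso G K.
Proof.
case=> f [bf fE] [g [bg gE]]; exists (g \o f); split; first exact: bij_comp.
by move=> x y; rewrite fE gE.
Qed.

Lemma bigraph_iso_sym G H : bigraph_iso G H -> bigraph_iso H G.
Proof.
case=> f [[g fK gK] fE fs]; exists g; split; first by exists f.
  by move=> x y; rewrite fE !gK.
by move=> x; rewrite fs gK.
Qed.

Lemma bigraph_iso_trans G H K :
  bigraph_iso G H -> bigraph_iso H K -> bigraph_iso G K.
Proof.
case=> f [bf fE fs] [g [bg gE gs]]; exists (g \o f); split.
- exact: bij_comp.
- by move=> x y; rewrite fE gE.
- by move=> x; rewrite fs gs.
Qed.

Lemma sval_inj (T : Type) (P : T -> Prop) (u v : {x | P x}) :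
  sval u = sval v -> u = v.
Proof.
case: u v => [u Pu] [v Pv] /= uv; subst v.
by rewrite (Prop_irrelevance Pu Pv).
Qed.

Lemma local_graph_iso (G H : graph) (f : G -> H) :
  bijective f -> (forall x y, adj x y <-> adj (f x) (f y)) ->
  forall x, graph_iso (local_graph x) (local_graph (f x)).
Proof.
case=> g fK gK fE x.
pose f1 (u : local_graph x) : local_graph (f x) :=
  exist _ (f (sval u)) (proj1 (fE _ _) (svalP u)).
have gP (u : local_graph (f x)) : adj x (g (sval u)).
  by apply/fE; rewrite gK; exact: svalP u.
pose g1 (u : local_graph (f x)) : local_graph x := exist _ (g (sval u)) (gP u).
exists f1; split; last by move=> u v; rewrite /= fE.
by exists g1 => u; apply: sval_inj; rewrite /= ?fK ?gK.
Qed.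

Definition same_local (L G : graph) : Prop :=
  forall (x : L) (y : G), graph_iso (local_graph x) (local_graph y).

Lemma locally_like_local (L G : graph) : locally_like L G -> same_local L G.
Proof.
case=> DL [DG [hL hG i]] x y.
by apply: graph_iso_trans (hL x) (graph_iso_trans i (graph_iso_sym (hG y))).
Qed.

Lemma bi_locally_like_local (L G : bigraph) :
  bi_locally_like L G ->
  forall (x : L) (y : G), (short x <-> short y) ->
  bigraph_iso (local_bigraph x) (local_bigraph y).
Proof.
case=> Ls [Ll [Gs [Gl [[Lsh Llo] [Gsh Glo] iS iL]]]] x y xy.
have [sx|nsx] := EM (short x).
  apply: bigraph_iso_trans (Lsh x sx) (bigraph_iso_trans iS _).
  by apply: bigraph_iso_sym; apply/Gsh/xy.
apply: bigraph_iso_trans (Llo x nsx) (bigraph_iso_trans iL _).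
by apply: bigraph_iso_sym; apply/Glo; rewrite -xy.
Qed.

(** [p] identifies the graph ([D], [F]) with the local graph at [x]. *)
Definition local_chart (V : eqType) (E : rel V) (x : V) (I : eqType)
    (D : pred I) (F : rel I) (p : I -> V) : Prop :=
  [/\ forall i, D i -> E x (p i),
      forall z, E x z -> exists2 i, D i & z = p i,
      forall i j, D i -> D j -> p i = p j -> i = j
    & forall i j, D i -> D j -> E (p i) (p j) = F i j].

Lemma chart_of_iso (V V' : eqType) (E : rel V) (E' : rel V')
    (Es : symmetric E) (Ei : irreflexive E)
    (Es' : symmetric E') (Ei' : irreflexive E')
    (x : relgraph Es Ei) (y : relgraph Es' Ei') :
  graph_iso (local_graph x) (local_graph y) ->
  exists p, local_chart E x (E' y) E' p.
Proof.
case/graph_iso_sym=> f [[g fK gK] fE].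
pose p (d : V') : V := match pselect (E' y d) with
  | left yd => sval (f (exist (fun d : V' => E' y d) d yd)) | right _ => x end.
have pE d (yd : E' y d) : p d = sval (f (exist (fun d : V' => E' y d) d yd)).
  rewrite /p; case: pselect => // yd'; congr (sval (f _)).
  exact: sval_inj.
exists p; split=> [d yd|z xz|d d' yd yd'|d d' yd yd'].
- by rewrite (pE d yd); exact: svalP (f _).
- pose u : local_graph x := exist (fun d : V => E x d) z xz.
  exists (sval (g u)); first exact: (svalP (g u)).
  rewrite (pE _ (svalP (g u))) -[z]/(sval u) -[in LHS](gK u).
  by congr (sval (f _)); apply: sval_inj.
- rewrite (pE d yd) (pE d' yd') => /sval_inj /(can_inj fK).
  by case.
- rewrite (pE d yd) (pE d' yd').
  have := fE (exist (fun d : V' => E' y d) d yd)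
             (exist (fun d : V' => E' y d) d' yd').
  by move=> /= [h1 h2]; apply/idP/idP.
Qed.

Lemma chart_nadj (V I : eqType) (E : rel V) x (D : pred I) (F : rel I) p :
  local_chart E x D F p ->
  forall i j, D i -> D j -> nadj E (p i) (p j) = nadj F i j.
Proof.
case=> _ _ inj pE i j Di Dj; rewrite /nadj pE //; congr (~~ _ && _).
by apply/eqP/eqP => [/inj->|->].
Qed.

Lemma chart_comp (V I J : eqType) (E : rel V) x (D : pred I) (F : rel I) p
    (D' : pred J) (F' : rel J) (q : J -> I) :
  local_chart E x D F p ->
  (forall j, D' j -> D (q j)) ->
  (forall i, D i -> exists2 j, D' j & i = q j) ->
  (forall i j, D' i -> D' j -> q i = q j -> i = j) ->
  (forall i j, D' i -> D' j -> F (q i) (q j) = F' i j) ->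
  local_chart E x D' F' (p \o q).
Proof.
case=> pD pS pI pE qD qS qI qE; split=> [j /qD/pD//|z /pS[i /qS[j Dj ->] ->]||].
- by exists j.
- by move=> i j Di Dj /pI h; apply: qI => //; apply: h; apply: qD.
- by move=> i j Di Dj; rewrite /= pE ?qE //; apply: qD.
Qed.

Section Classic.

Variable G : graph.

Definition adjb (x y : {classic G}) : bool := `[< @adj G x y >].

Lemma adjb_sym : symmetric adjb.
Proof. by move=> x y; apply/asboolP/asboolP; exact: adj_sym. Qed.

Lemma adjb_irr : irreflexive adjb.
Proof. by move=> x; apply/asboolP; exact: adj_irr. Qed.

Lemma classic_iso : graph_iso G (relgraph adjb_sym adjb_irr).
Proof.
exists id; split; first by exists id.
by move=> x y; split=> /asboolP.
Qed.

End Classic.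

Lemma finite_iso (G : graph) (T : finType) : same_card G T ->
  exists (E : rel T) (Es : symmetric E) (Ei : irreflexive E),
  graph_iso G (relgraph Es Ei).
Proof.
case=> f [g fK gK]; pose E (x y : T) := `[< @adj G (g x) (g y) >].
have Es : symmetric E by move=> x y; apply/asboolP/asboolP; exact: adj_sym.
have Ei : irreflexive E by move=> x; apply/asboolP; exact: adj_irr.
exists E, Es, Ei, f; split; first by exists g.
by move=> x y; split=> [xy|/asboolP]; rewrite ?fK //; apply/asboolP; rewrite !fK.
Qed.

Lemma iso_local (G G' H H' : graph) :
  graph_iso G G' -> graph_iso H H' -> same_local G H -> same_local G' H'.
Proof.
case/graph_iso_sym=> f [bf fE] /graph_iso_sym[g [bg gE]] loc x y.
apply: graph_iso_trans (local_graph_iso bf fE x) _.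
apply: graph_iso_trans (loc _ (g y)) _.
exact/graph_iso_sym/local_graph_iso.
Qed.

Lemma graph_iso_rel (G H : graph) (R : G -> H -> Prop) :
  (forall x, exists y, R x y) -> (forall y, exists x, R x y) ->
  (forall x x' y y', R x y -> R x' y' -> (x = x' <-> y = y')) ->
  (forall x x' y y', R x y -> R x' y' -> (adj x x' <-> adj y y')) ->
  graph_iso G H.
Proof.
move=> /choice[f fP] /choice[g gP] inj RE; exists f; split.
  exists g => [x|y].
    by apply/(inj _ _ _ _ (gP (f x)) (fP x)).
  by apply/(inj _ _ _ _ (fP (g y)) (gP y)).
by move=> x y; exact: RE.
Qed.

Lemma bigraph_iso_rel (G H : bigraph) (R : G -> H -> Prop) :
  (forall x, exists y, R x y) -> (forall y, exists x, R x y) ->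
  (forall x x' y y', R x y -> R x' y' -> (x = x' <-> y = y')) ->
  (forall x x' y y', R x y -> R x' y' -> (adj x x' <-> adj y y')) ->
  (forall x y, R x y -> (short x <-> short y)) ->
  bigraph_iso G H.
Proof.
move=> /choice[f fP] /choice[g gP] inj RE Rs; exists f; split.
- exists g => [x|y].
    by apply/(inj _ _ _ _ (gP (f x)) (fP x)).
  by apply/(inj _ _ _ _ (fP (g y)) (gP y)).
- by move=> x y; exact: RE.
- by move=> x; exact: Rs.
Qed.

(** Connectedness in the form in which it is used: a nonempty set of vertices
    closed under adjacency is everything. *)
Lemma connected_ind (G : graph) (P : G -> Prop) x0 :
  connected G -> P x0 -> (forall x y, P x -> adj x y -> P y) -> forall x, P x.
Proof.
case=> _ conn P0 step x; elim: (conn x0 x) P0 => {x0 x} //.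
  by move=> x y xy Px; exact: step xy.
by move=> x y z _ IH1 _ IH2 /IH1/IH2.
Qed.

Lemma connected_iso (G H : graph) : graph_iso G H -> connected G -> connected H.
Proof.
case=> f [[g fK gK] fE] cG; have [[x0] _] := cG; split; first exact: inhabits (f x0).
move=> x y; rewrite -(gK y).
apply: (connected_ind (P := fun z => _ x (f z)) (x0 := g x)) => //.
  by rewrite gK; exact: Relation_Operators.rt_refl.
move=> u v xu uv; apply: Relation_Operators.rt_trans xu _.
by apply: Relation_Operators.rt_step; apply/fE.
Qed.

(** * Commuting reflections *)

Section Reflections.

Local Open Scope ring_scope.

Variable n : nat.
Implicit Types a b u v : 'rV[rat]_n.

Lemma dotE u v : (u *m v^T) 0 0 = dot u v.
Proof. by rewrite mxE; apply: eq_bigr => i _; rewrite mxE. Qed.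

Lemma dotC u v : dot u v = dot v u.
Proof. by apply: eq_bigr => i _; rewrite mulrC. Qed.

Lemma dotDl u v w : dot (u + v) w = dot u w + dot v w.
Proof. by rewrite -!dotE mulmxDl mxE. Qed.

Lemma dotZl c u v : dot (c *: u) v = c * dot u v.
Proof. by rewrite -!dotE -scalemxAl mxE. Qed.

Lemma dotNl u v : dot (- u) v = - dot u v.
Proof. by rewrite -scaleN1r dotZl mulN1r. Qed.

Lemma dotDr u v w : dot w (u + v) = dot w u + dot w v.
Proof. by rewrite dotC dotDl !(dotC w). Qed.

Lemma dotZr c u v : dot u (c *: v) = c * dot u v.
Proof. by rewrite dotC dotZl dotC. Qed.

Lemma dotNr u v : dot u (- v) = - dot u v.
Proof. by rewrite dotC dotNl dotC. Qed.

Lemma dot_e (i j : 'I_n) : dot (e i) (e j) = (i == j)%:R.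
Proof.
rewrite /dot /e (bigD1 i) //= big1 => [|k ki]; rewrite !mxE !eqxx ?addr0 ?mul1r //.
by rewrite (negbTE ki) mul0r.
Qed.

Lemma dot_eq0 u : (dot u u == 0) = (u == 0).
Proof.
apply/eqP/eqP => [u0|->]; last by rewrite -(scale0r 0) dotZl mul0r.
apply/rowP => i; rewrite mxE; apply/eqP; rewrite -sqrf_eq0 expr2.
by rewrite (psumr_eq0P _ u0) // => j _; rewrite -expr2 sqr_ge0.
Qed.

Lemma mul_refl u a : u *m refl a = u - (2 * dot u a / dot a a) *: a.
Proof.
rewrite /refl mulmxBr mulmx1 -scalemxAr mulmxA; congr (_ - _).
have -> : u *m a^T = (dot u a)%:M.
  by apply/matrixP => i j; rewrite !ord1 dotE !mxE.
by rewrite mul_scalar_mx scalerA; congr (_ *: _); ring.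
Qed.

Lemma refl_fix a b : a != 0 -> refl a = refl b -> a = (dot a b / dot b b) *: b.
Proof.
rewrite -dot_eq0 => a0 /(congr1 (mulmx a)); rewrite !mul_refl.
rewrite -mulrA divff // mulr1 => /(congr1 (fun v => 2^-1 *: (a - v))).
rewrite !opprB !(addrC a (_ - a)) !subrK !scalerA mulVf // scale1r => {1}->.
by congr (_ *: _); rewrite -mulrA mulKf.
Qed.

Lemma refl_eq_dot a b : a != 0 -> refl a = refl b ->
  dot a b ^+ 2 = dot a a * dot b b.
Proof.
move=> a0 /(refl_fix a0); move: (_ / _) => c ->; rewrite !dotZl !dotZr.
by ring.
Qed.

Lemma reflZ c a : c != 0 -> refl (c *: a) = refl a.
Proof.
move=> c0; have aT : (c *: a)^T = c *: a^T by rewrite linearZ.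
rewrite /refl dotZl dotZr aT -scalemxAl -scalemxAr !scalerA.
congr (_ - _ *: _).
have [->|a0] := eqVneq (dot a a) 0; first by rewrite !mulr0 invr0 mulr0 !mul0r.
by field; rewrite c0 a0.
Qed.

Lemma reflN a : refl (- a) = refl a.
Proof. by rewrite -scaleN1r reflZ // oppr_eq0 oner_eq0. Qed.

(** Two distinct reflections commute exactly when their roots are orthogonal:
    the commutator is a multiple of [a^T *m b - b^T *m a] by [dot a b]. *)
Lemma refl_adjP a b : a != 0 -> b != 0 ->
  (refl a <> refl b /\ refl a *m refl b = refl b *m refl a) <-> dot a b = 0.
Proof.
move=> a0 b0.
have da : dot a a != 0 by rewrite dot_eq0.
have db : dot b b != 0 by rewrite dot_eq0.
split=> [[nab /(congr1 (mulmx a))]|ab].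
  rewrite !mulmxA !mul_refl => h.
  have [//|dab] := eqVneq (dot a b) 0; case: nab.
  have {h} : (4 * dot a b / dot b b) *: b
      = (4 * dot a b ^+ 2 / (dot a a * dot b b)) *: a.
    apply/rowP => i; apply: subr0_eq.
    have /(congr1 (fun v : 'rV_n => v 0 i)) := h; move/eqP; rewrite -subr_eq0.
    rewrite !dotDl !dotNl !dotZl (dotC b a) !mxE => /eqP hi.
    by rewrite -[RHS]hi; field; rewrite da db.
  move=> /(congr1 (fun v => (dot b b / (4 * dot a b)) *: v)); rewrite !scalerA.
  have -> : dot b b / (4 * dot a b) * (4 * dot a b / dot b b) = 1.
    by field; rewrite dab db.
  rewrite scale1r => eb; rewrite eb reflZ //.
  apply: contraNneq b0 => c0; by rewrite eb c0 scale0r.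
split.
  move=> /(refl_fix a0) ea; move: a0; rewrite ea ab mul0r scale0r eqxx //.
have ba : dot b a = 0 by rewrite dotC.
have abT : a *m b^T = 0.
  by apply/matrixP => i j; rewrite !ord1 dotE ab mxE.
have baT : b *m a^T = 0.
  by apply/matrixP => i j; rewrite !ord1 dotE ba mxE.
rewrite /refl !mulmxBl !mulmxBr !mul1mx !mulmx1 -!scalemxAl -!scalemxAr.
rewrite !mulmxA -(mulmxA a^T a) -(mulmxA b^T b) abT baT !mulmx0 !mul0mx.
by rewrite !scaler0 !subr0 -!addrA; congr (_ + _); rewrite addrC.
Qed.

End Reflections.

Section WeylIndex.

Local Open Scope ring_scope.

Variables (n : nat) (Phi : 'rV[rat]_n -> Prop).

Lemma refl_index (I : Type) (D : I -> Prop) (vec : I -> 'rV[rat]_n) i0 :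
  D i0 -> (forall i, D i -> Phi (vec i)) ->
  exists r : I -> reflection Phi, forall i, D i -> sval (r i) = refl (vec i).
Proof.
move=> D0 DP; pose r i : reflection Phi := match pselect (D i) with
  | left Di => exist _ (refl (vec i)) (ex_intro2 _ _ _ (DP i Di) erefl)
  | right _ => exist _ (refl (vec i0)) (ex_intro2 _ _ _ (DP i0 D0) erefl) end.
by exists r => i Di; rewrite /r; case: pselect.
Qed.

Lemma weyl_adjb (u v : {classic reflection Phi}) a b :
  sval u = refl a -> sval v = refl b -> a != 0 -> b != 0 ->
  adjb (G := weyl_graph_of Phi) u v = (dot a b == 0).
Proof.
move=> ua vb a0 b0; apply/asboolP/eqP => /=; rewrite /refl_adj ua vb.
  by move/(refl_adjP a0 b0).
by move/(refl_adjP a0 b0).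
Qed.

Lemma weyl_graph_index (T : eqType) (E : rel T) (Es : symmetric E)
    (Ei : irreflexive E) (vec : T -> 'rV[rat]_n) (t0 : T) :
  (forall t, Phi (vec t)) ->
  (forall a, Phi a -> exists t c, c != 0 /\ a = c *: vec t) ->
  (forall t, vec t != 0) ->
  (forall t t', dot (vec t) (vec t') ^+ 2 =
     dot (vec t) (vec t) * dot (vec t') (vec t') -> t = t') ->
  (forall t t', E t t' = (dot (vec t) (vec t') == 0)) ->
  exists f : relgraph Es Ei -> weyl_graph_of Phi,
    [/\ bijective f, forall x y, adj x y <-> adj (f x) (f y)
      & forall t, sval (f t) = refl (vec t)].
Proof.
move=> vP vS v0 vI vE.
have [r rE] := @refl_index T (fun=> True) vec t0 I (fun t _ => vP t).
have {}rE t : sval (r t) = refl (vec t) by apply: rE.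
have rI : injective r.
  move=> t t' rtt'; apply: vI; apply: refl_eq_dot => //.
  by rewrite -!rE rtt'.
have rS u : exists t, r t = u.
  have [a Pa ua] := svalP u; have [t [c [c0 ac]]] := vS a Pa.
  by exists t; apply: sval_inj; rewrite rE ua ac reflZ.
have [g gP] := choice rS.
exists r; split=> //.
  by exists g => [t|u]; [apply: rI; rewrite gP | rewrite gP].
move=> x y /=; rewrite vE -(weyl_adjb (rE x) (rE y)) //.
by split=> [/asboolP//|xy]; apply/asboolP.
Qed.

End WeylIndex.

(** * Root systems as lists of integer vectors *)

Section RootLists.

Local Open Scope ring_scope.

(** Roots are coded by the doubles of their coordinates, which are integers. *)
Definition vecl n (s : seq int) : 'rV[rat]_n := \row_i ((s`_i)%:~R / 2).

Fixpoint dotl (s t : seq int) : int :=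
  match s, t with
  | x :: s', y :: t' => x * y + dotl s' t'
  | _, _ => 0
  end.

Lemma dot_vecl n s t : size s = n -> size t = n ->
  dot (vecl n s) (vecl n t) = (dotl s t)%:~R / 4.
Proof.
have -> : dot (vecl n s) (vecl n t) = \sum_(i < n) ((s`_i * t`_i)%:~R / 4).
  by apply: eq_bigr => i _; rewrite !mxE rmorphM /=; field.
elim: n s t => [|n IHn] [|x s] [|y t] //=; first by rewrite big_ord0 mul0r.
move=> [sz] [tz]; rewrite big_ord_recl /= IHn // rmorphD rmorphM /=.
by rewrite mulrDl rmorphM.
Qed.

Definition adjl (RL : seq (seq int)) (i j : nat) : bool :=
  dotl (nth [::] RL i) (nth [::] RL j) == 0.

Lemma dotlC s t : dotl s t = dotl t s.
Proof. by elim: s t => [|x s IHs] [|y t] //=; rewrite mulrC IHs. Qed.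

(** The listed vectors have length [n], are nonzero and pairwise not
    parallel. *)
Definition root_list_ok n (RL : seq (seq int)) : bool :=
  all (fun s => size s == n) RL &&
  all (fun i => let s := nth [::] RL i in let ss := dotl s s in
    all (fun j => let t := nth [::] RL j in let st := dotl s t in
    (st * st == ss * dotl t t) == (i == j))
    (iota 0 (size RL))) (iota 0 (size RL)) &&
  all (fun s => dotl s s != 0) RL.

Lemma root_list_iso n (Phi : 'rV[rat]_n -> Prop) (RL : seq (seq int)) N :
  root_list_ok n RL -> size RL = N.+1 ->
  (forall s, s \in RL -> Phi (vecl n s)) ->
  (forall a, Phi a -> exists2 s, s \in RL & exists2 c, c != 0 & a = c *: vecl n s) ->
  exists (E : rel 'I_N.+1) (Es : symmetric E) (Ei : irreflexive E),
   (forall i j, E i j = adjl RL i j) /\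
   exists f : relgraph Es Ei -> weyl_graph_of Phi,
    [/\ bijective f, forall x y, adj x y <-> adj (f x) (f y)
      & forall t, sval (f t) = refl (vecl n (nth [::] RL t))].
Proof.
move=> /andP[/andP[/allP sz /allP inj] /allP nz] sRL P1 P2.
pose v (i : 'I_N.+1) := nth [::] RL i.
have vRL i : v i \in RL by apply: mem_nth; rewrite sRL.
have {}sz i : size (v i) = n by apply/eqP/sz.
pose E (i j : 'I_N.+1) := adjl RL i j.
have Es : symmetric E by move=> i j; rewrite /E /adjl dotlC.
have Ei : irreflexive E by move=> i; apply/negbTE/nz/vRL.
exists E, Es, Ei; split=> //.
have dE i j : dot (vecl n (v i)) (vecl n (v j)) = (dotl (v i) (v j))%:~R / 4.
  by rewrite dot_vecl.
apply: (@weyl_graph_index _ _ _ _ _ _ (fun i => vecl n (v i)) ord0).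
- by move=> t; apply: P1.
- move=> a /P2[s /(nthP [::])[i]]; rewrite sRL => ilt <- [c c0 ->].
  by exists (Ordinal ilt), c.
- by move=> t; rewrite -dot_eq0 dE mulf_neq0 // intr_eq0; apply: nz.
- move=> i j; rewrite !dE => h; apply/val_inj/eqP.
  have iin (k : 'I_N.+1) : val k \in iota 0 (size RL) by rewrite mem_iota sRL /=.
  have /eqP <- := allP (inj _ (iin i)) _ (iin j); apply/eqP.
  apply: (@intr_inj rat); rewrite !rmorphM /=.
  apply: (@mulIf _ (4^-1 * 4^-1)) => //.
  by rewrite -/(v i) -/(v j); move: h; rewrite expr2 => h; rewrite !mulrA in h *; lra.
- by move=> i j; rewrite dE mulf_eq0 intr_eq0 invr_eq0 /= orbF.
Qed.

(** The code of [e i + e j], or of [e i - e j] if [b]. *)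
Definition codeD n i j (b : bool) : seq int :=
  mkseq (fun k => if k == i then 2 else if k == j then (-1) ^+ b * 2 else 0) n.

Definition pairsl n : seq (nat * nat) :=
  [seq ij <- [seq (i, j) | i <- iota 0 n, j <- iota 0 n] | (ij.1 < ij.2)%N].

Definition rootlA n := [seq codeD n ij.1 ij.2 true | ij <- pairsl n].

Definition rootlD n :=
  [seq codeD n ij.1 ij.2 b | ij <- pairsl n, b <- [:: false; true]].

Fixpoint words n : seq bitseq :=
  if n is n'.+1 then map (cons false) (words n') ++ map (cons true) (words n')
  else [:: [::]].

Definition code_half (w : bitseq) : seq int := [seq (-1) ^+ b | b : bool <- w].

Definition rootlE8 :=
  rootlD 8 ++ [seq code_half (false :: w) | w <- words 7 & ~~ odd (count id w)].

Definition orth_list (v : seq int) (RL : seq (seq int)) : seq (seq int) :=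
  [seq s <- RL | dotl s v == 0].

Definition rootlE7 := orth_list [:: 0; 0; 0; 0; 0; 0; 2; 2] rootlE8.
Definition rootlE6 := orth_list [:: 0; 0; 0; 0; 0; 2; 0; 2] rootlE7.

Definition codeB n i : seq int := mkseq (fun k => if k == i then 2 else 0) n.

Definition rootlF4 := [seq codeB 4 i | i <- iota 0 4] ++ rootlD 4 ++
  [seq code_half (false :: w) | w <- words 3].

(** ** The lists represent the root systems *)

Definition represents n (RL : seq (seq int)) (Phi : 'rV[rat]_n -> Prop) : Prop :=
  (forall s, s \in RL -> Phi (vecl n s)) /\
  (forall a, Phi a ->
     exists2 s, s \in RL & exists2 c, c != 0 & a = c *: vecl n s).

Lemma vecl_codeD n (i j : 'I_n) b : i != j ->
  vecl n (codeD n i j b) = e i + (-1) ^+ b *: e j.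
Proof.
move=> ij; apply/rowP => k; rewrite !mxE eqxx /= nth_mkseq //.
rewrite !(eq_sym k) !val_eqE.
have [<-|_] := eqVneq i k.
  by rewrite eq_sym (negbTE ij) mulr0 addr0 /= divff.
have [_|_] := eqVneq j k; last by rewrite mulr0 addr0 mul0r.
by rewrite rmorphM rmorphXn /= rmorphN1 -mulrA divff // add0r.
Qed.

Lemma mem_pairsl n (i j : 'I_n) : (i < j)%N -> (val i, val j) \in pairsl n.
Proof.
move=> ij; have jn := ltn_ord j; rewrite mem_filter ij /=; apply/allpairsP.
by exists (val i, val j); rewrite !mem_iota /= !add0n jn (ltn_trans ij jn).
Qed.

Lemma pairslP n x : x \in pairsl n ->
  exists i j : 'I_n, (i < j)%N /\ x = (val i, val j).
Proof.
rewrite mem_filter => /andP[lt_x /allpairsP[[i j] [/= iN jN x_ij]]].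
move: lt_x iN jN; rewrite x_ij !mem_iota /= !add0n => ij iN jN.
by exists (Ordinal iN), (Ordinal jN).
Qed.

Lemma signr_neq0 (b : bool) : (-1) ^+ b != 0 :> rat.
Proof. by rewrite signr_eq0. Qed.

Lemma rootlA_represents n : represents (rootlA n.+1) (@rootsA n).
Proof.
split=> [s /mapP[x /pairslP[i [j [ij ->]]] ->] | a [i [j [ij ->]]]].
  have nij : i != j by rewrite neq_ltn ij.
  exists i, j; split; first exact/eqP.
  by rewrite vecl_codeD //= expr1 scaleN1r.
have memA (k l : 'I_n.+1) : (k < l)%N -> codeD n.+1 k l true \in rootlA n.+1.
  by move=> kl; apply/mapP; exists (val k, val l) => //; exact: mem_pairsl.
have [ltij|ltji|/val_inj/ij[]] := ltngtP i j.
  exists (codeD n.+1 i j true); first exact: memA.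
  exists 1; first exact: oner_neq0.
  by rewrite scale1r vecl_codeD ?expr1 ?scaleN1r // neq_ltn ltij.
exists (codeD n.+1 j i true); first exact: memA.
exists (-1); first by rewrite oppr_eq0 oner_neq0.
by rewrite vecl_codeD ?expr1 ?scaleN1r ?opprB // neq_ltn ltji.
Qed.

Lemma rootlD_represents n : represents (rootlD n) (@rootsD n).
Proof.
split=> [s /allpairsP[[x b] [/= /pairslP[i [j [ij ->]]] _ ->]] |].
  have nij : i != j by rewrite neq_ltn ij.
  exists i, j, false, b; split; first exact/eqP.
  by rewrite vecl_codeD //= expr0 scale1r.
have memD (k l : 'I_n) b : (k < l)%N -> codeD n k l b \in rootlD n.
  move=> kl; apply/allpairsP; exists ((val k, val l), b) => /=.
  by split=> //; [exact: mem_pairsl | case: b].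
have main (i j : 'I_n) (s t : bool) : (i < j)%N ->
    exists2 l, l \in rootlD n & exists2 c, c != 0 &
      (-1) ^+ s *: e i + (-1) ^+ t *: e j = c *: vecl n l.
  move=> ij; exists (codeD n i j (s (+) t)); first exact: memD.
  exists ((-1) ^+ s); first exact: signr_neq0.
  rewrite vecl_codeD ?neq_ltn ?ij // scalerDr scalerA -signr_addb addbA addbb.
  by [].
move=> a [i [j [s [t [ij ->]]]]].
have [ltij|ltji|/val_inj/ij[]] := ltngtP i j.
  exact: main.
by rewrite addrC; exact: main.
Qed.

Lemma mem_words n w : (w \in words n) = (size w == n).
Proof.
elim: n w => [|n IHn] w; first by case: w.
rewrite /= mem_cat; case: w => [|b w] /=.
  by apply/negbTE/negP => /orP[] /mapP[].
rewrite eqSS -IHn; apply/orP/idP => [[] /mapP[v vn [_ ->]] //|wn].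
by case: b; [right | left]; apply: map_f.
Qed.

Definition word_set n (w : bitseq) : {set 'I_n} := [set i : 'I_n | nth false w i].

Lemma vecl_half n w : size w = n -> vecl n (code_half w) = half_vec (word_set n w).
Proof.
move=> sw; apply/rowP => i; rewrite !mxE inE.
rewrite (nth_map false) ?sw //.
by rewrite rmorphXn /= rmorphN1.
Qed.

Lemma word_setK n (S : {set 'I_n}) :
  word_set n [seq i \in S | i <- enum 'I_n] = S.
Proof.
apply/setP => i; rewrite inE (nth_map i) ?size_enum_ord //.
by rewrite nth_ord_enum.
Qed.

Lemma card_word_set n w : size w = n -> #|word_set n w| = count id w.
Proof.
move=> sw; rewrite cardE /enum_mem -enumT size_filter.
rewrite (eq_count (a2 := preim (fun i : 'I_n => nth false w i) id)); last first.
  by move=> i; rewrite /= inE.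
rewrite -count_map; congr (count _ _).
rewrite (map_comp (nth false w) val) val_enum_ord -[RHS](mkseq_nth false).
by rewrite sw.
Qed.

Lemma half_vecC n (S : {set 'I_n}) : half_vec (~: S) = - half_vec S.
Proof.
apply/rowP => i; rewrite !mxE inE; by case: (i \in S); rewrite /= expr0 expr1 ?mulNr ?mul1r ?opprK.
Qed.

Lemma half_vec_word n (S : {set 'I_n.+1}) :
  exists2 w, size w = n & exists2 c : rat, c != 0 &
    half_vec S = c *: vecl n.+1 (code_half (false :: w)) /\
    (count id w = #|S| \/ count id w = #|~: S|).
Proof.
have aux (U : {set 'I_n.+1}) : ord0 \notin U ->
    exists2 w, size w = n & half_vec U = vecl n.+1 (code_half (false :: w)) /\
    count id w = #|U|.
  move=> U0; exists (behead [seq i \in U | i <- enum 'I_n.+1]).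
    by rewrite size_behead size_map size_enum_ord.
  set v := map _ _; have sv : size v = n.+1 by rewrite size_map size_enum_ord.
  have vE : false :: behead v = v.
    by rewrite /v enum_ordSl /= (negbTE U0).
  rewrite vE vecl_half // word_setK; split=> //.
  rewrite -[U in RHS]word_setK card_word_set // -/v -[v in RHS]vE /=.
  by [].
have [S0|S0] := boolP (ord0 \in S); last first.
  have [w sw [-> cw]] := aux S S0; exists w => //; exists 1; first exact: oner_neq0.
  by rewrite scale1r; split=> //; left.
have [|w sw [hE cw]] := aux (~: S); first by rewrite inE negbK.
exists w => //; exists (-1); first by rewrite oppr_eq0 oner_neq0.
by rewrite scaleN1r -hE half_vecC opprK; split=> //; right.
Qed.

Lemma rootlE8_represents : represents rootlE8 rootsE8.
Proof.
have [D1 D2] := rootlD_represents 8; split=> [s|a].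
  rewrite mem_cat => /orP[/D1|/mapP[w]]; first by left.
  rewrite mem_filter mem_words => /andP[ow /eqP sw] ->; right.
  exists (word_set 8 (false :: w)); rewrite vecl_half ?card_word_set //= ?sw //.
case=> [/D2[s sD h]|[S [oS ->]]]; first by exists s; rewrite // mem_cat sD.
have [w sw [c c0 [-> cw]]] := half_vec_word S.
exists (code_half (false :: w)); last by exists c.
rewrite mem_cat; apply/orP; right; apply/mapP; exists w => //; rewrite mem_filter mem_words sw.
rewrite eqxx andbT; case: cw => -> //.
have := cardsC S; rewrite card_ord => /(congr1 odd); rewrite oddD.
by move/negbTE: oS => -> /= ->.
Qed.

Lemma size_mem_list n (RL : seq (seq int)) s : all (fun s => size s == n) RL -> s \in RL -> size s = n.
Proof. by move=> /allP h /h/eqP. Qed.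

Lemma orth_list_represents n (v : seq int) RL (Phi : 'rV[rat]_n -> Prop) :
  all (fun s => size s == n) RL -> size v = n -> represents RL Phi ->
  represents (orth_list v RL) (fun a => Phi a /\ dot a (vecl n v) = 0).
Proof.
move=> sz sv [R1 R2]; split=> [s|a [/R2[s sRL [c c0 ->]]]].
  rewrite mem_filter => /andP[/eqP s0 sRL]; split; first exact: R1.
  by rewrite (dot_vecl (size_mem_list sz sRL) sv) s0 mul0r.
rewrite dotZl (dot_vecl (size_mem_list sz sRL) sv) => /eqP.
rewrite mulf_eq0 (negbTE c0) /= mulf_eq0 intr_eq0 invr_eq0 orbF => sv0.
by exists s; [rewrite mem_filter; apply/andP; split | exists c].
Qed.

Lemma represents_ext n RL (Phi Psi : 'rV[rat]_n -> Prop) :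
  (forall a, Phi a <-> Psi a) -> represents RL Phi -> represents RL Psi.
Proof. by move=> PP [h1 h2]; split=> [s /h1/PP|a /PP/h2]. Qed.

Lemma vecl_two n (i j : 'I_n) : i != j ->
  e i + e j = vecl n (codeD n i j false).
Proof. by move=> ij; rewrite vecl_codeD // scale1r. Qed.

Lemma rootlE7_represents : represents rootlE7 rootsE7.
Proof.
apply: represents_ext (orth_list_represents _ _ rootlE8_represents).
- by move=> a; rewrite /rootsE7 vecl_two -?val_eqE /= !inordK.
- by vm_compute.
- by [].
Qed.

Lemma rootlE6_represents : represents rootlE6 rootsE6.
Proof.
apply: represents_ext (orth_list_represents _ _ rootlE7_represents).
- by move=> a; rewrite /rootsE6 vecl_two -?val_eqE /= !inordK.
- by vm_compute.
- by [].
Qed.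

Lemma vecl_codeB n (i : 'I_n) : vecl n (codeB n i) = e i.
Proof.
apply/rowP => k; rewrite !mxE eqxx /= nth_mkseq // val_eqE.
by case: (k == i); rewrite /= ?mul0r // divff.
Qed.

Lemma mem_rootlF4 s : (s \in rootlF4) = [|| s \in [seq codeB 4 i | i <- iota 0 4],
  s \in rootlD 4 | s \in [seq code_half (false :: w) | w <- words 3]].
Proof. by rewrite mem_cat; congr (_ || _); exact: mem_cat. Qed.

Lemma rootlF4_represents : represents rootlF4 rootsF4.
Proof.
have [D1 D2] := rootlD_represents 4.
split=> [s|a].
  rewrite mem_rootlF4 => /or3P[/mapP[i]|/D1|/mapP[w]].
  - rewrite mem_iota => /andP[_ i4] ->; left; right; exists (Ordinal i4), false.
    by rewrite scale1r -vecl_codeB.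
  - by left; left.
  - rewrite mem_words => /eqP sw ->; right; exists (word_set 4 (false :: w)).
    by rewrite vecl_half //= sw.
case=> [[/D2[s sD h]|[i [b ->]]]|[S ->]].
- by exists s; rewrite // mem_rootlF4 sD orbT.
- exists (codeB 4 i); last by exists ((-1) ^+ b); rewrite ?signr_neq0 ?vecl_codeB.
  by rewrite mem_rootlF4; apply/orP; left; apply/mapP; exists (val i) => //; rewrite mem_iota /=.
have [w sw [c c0 [-> _]]] := half_vec_word S.
exists (code_half (false :: w)); last by exists c.
by rewrite mem_rootlF4; apply/or3P/Or33/mapP; exists w => //; rewrite mem_words sw.
Qed.

End RootLists.

(** * Graphs that are locally a given finite graph *)

(** Quantifiers over [0 <= i < n] that stop early under call by value. *)
Fixpoint alln n (P : nat -> bool) : bool :=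
  if n is m.+1 then if P m then alln m P else false else true.

Fixpoint hasn n (P : nat -> bool) : bool :=
  if n is m.+1 then if P m then true else hasn m P else false.

Lemma allnP n (P : nat -> bool) : reflect (forall i, i < n -> P i) (alln n P).
Proof.
elim: n => [|n IHn] /=; first by constructor.
case Pn: (P n); last by constructor => /(_ n (ltnSn n)); rewrite Pn.
apply: (iffP IHn) => h i; last by move=> ilt; apply: h; rewrite ltnS ltnW.
by rewrite ltnS leq_eqVlt => /predU1P[->//|/h].
Qed.

Lemma hasnP n (P : nat -> bool) : reflect (exists2 i, i < n & P i) (hasn n P).
Proof.
elim: n => [|n IHn] /=; first by constructor; case.
case Pn: (P n); first by constructor; exists n.
apply: (iffP IHn) => [[i ilt Pi]|[i]]; first by exists i; rewrite // ltnS ltnW.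
by rewrite ltnS leq_eqVlt => /predU1P[->|ilt Pi]; [rewrite Pn | exists i].
Qed.

Fixpoint all3b (P : bool -> bool -> bool -> bool) (s t u : bitseq) : bool :=
  match s, t, u with
  | a :: s', b :: t', c :: u' => if P a b c then all3b P s' t' u' else false
  | _, _, _ => true
  end.

Lemma all3bP (P : bool -> bool -> bool -> bool) f g h n :
  reflect (forall i, i < n -> P (f i) (g i) (h i))
          (all3b P (mkseq f n) (mkseq g n) (mkseq h n)).
Proof.
have -> : all3b P (mkseq f n) (mkseq g n) (mkseq h n)
    = all (fun i => P (f i) (g i) (h i)) (iota 0 n).
  rewrite /mkseq; elim: (iota 0 n) => //= i s ->.
  by case: (P _ _ _).
by apply: (iffP allP) => h0 i; move: (h0 i); rewrite mem_iota add0n.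
Qed.

Section Tables.

Variables (d : nat) (L : seq (seq bool)).

Definition tadj (i j : nat) : bool := nth false (nth [::] L i) j.

Notation tn := (nadj tadj).

Definition nrows : seq bitseq := mkseq (fun i => mkseq (tn i) d) d.

Definition row_sumb (R : seq bitseq) s a b : bool :=
  all3b (fun u v w => u == v (+) w) (nth [::] R s) (nth [::] R a) (nth [::] R b).

Definition table_ok_rows (R : seq bitseq) : bool := [&&
  (* no vertex is adjacent to all others *)
  alln d (fun v => has id (nth [::] R v)),
  (* distinct vertices have distinct rows *)
  alln d (fun v => let rv := nth [::] R v in
    alln d (fun w => if v == w then true else
      let rw := nth [::] R w in ~~ all3b (fun u v _ => u == v) rv rw rv)) &
  (* sums of non-adjacent vertices exist, and they are determined by what they
     share with either summand *)
  alln d (fun x => let rx := nth [::] R x in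
    alln d (fun y => if nth false rx y then
      let ry := nth [::] R y in hasn d (fun s => row_sumb R s x y) &&
      alln d (fun y' => if y == y' then true else if nth false rx y' then
        if all3b (fun u v w => if u then true else v == w) rx ry (nth [::] R y')
        then row_sumb R y' x y else true else true) else true))].

Definition table_ok : bool := let R := nrows in table_ok_rows R.

Definition tchart (V : eqType) (E : rel V) (x : V) (p : nat -> V) : Prop :=
  local_chart E x (fun i => i < d) tadj p.

(** The neighbours of [y] in the local graph charted by [p]. *)
Definition mu_word (V : eqType) (E : rel V) (p : nat -> V) (y : V) : bitseq :=
  mkseq (fun i => E y (p i)) d.

Definition mu_family_ok (F : seq bitseq) : bool :=
  let R := nrows in
  all (fun h => all (fun h' => ~~ all3b (fun u v _ => ~~ (u && v)) h h' h) F) F &&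
  all (fun h => all (fun h' => alln d (fun i =>
    if nth false h i && nth false h' i then
      if all3b (fun u v w => if u then true else v == w) (nth [::] R i) h h'
      then h == h' else true
    else true)) F) F.

Lemma nth_nrows i : i < d -> nth [::] nrows i = mkseq (tn i) d.
Proof. exact: nth_mkseq. Qed.

Lemma row_sumbP s a b : s < d -> a < d -> b < d ->
  reflect (forall w, w < d -> tn s w = tn a w (+) tn b w) (row_sumb nrows s a b).
Proof.
move=> sd ad bd; rewrite /row_sumb !nth_nrows //.
by apply: (iffP (all3bP _ _ _ _ _)) => h w /h/eqP.
Qed.

Section Local.

Variables (V : eqType) (E : rel V).
Hypotheses (Es : symmetric E) (Ei : irreflexive E).
Hypothesis charts : forall x, exists p, tchart E x p.

Lemma chart_row_sum x p s a b : tchart E x p -> s < d -> a < d -> b < d ->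
  row_sumb nrows s a b -> local_sum E x (p s) (p a) (p b).
Proof.
move=> cp sd ad bd /row_sumbP h w xw; have [_ ps _ _] := cp.
by have [i id ->] := ps w xw; rewrite !(chart_nadj cp) // h.
Qed.

Hypothesis Lok : table_ok.

Lemma table_no_cone : no_cone E.
Proof.
have /and3P[/allnP h _ _] := Lok; move=> z v zv; have [p cp] := charts z.
have [pd ps _ _] := cp; have [i id ->] := ps v zv.
move: (h i id); rewrite nth_nrows // => /hasP[_ /mapP[j + ->] ij].
rewrite mem_iota /= => jd; exists (p j); first exact: pd.
by rewrite (chart_nadj cp).
Qed.

Lemma table_locally_reduced : locally_reduced E.
Proof.
have /and3P[_ /allnP h _] := Lok; move=> z v w zv zw vw.
have [p cp] := charts z; have [pd ps _ _] := cp.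
have [i id vi] := ps v zv; have [j jd wj] := ps w zw.
move: (h i id) => /allnP/(_ j jd).
case: eqVneq => [ij _|_]; first by rewrite vi wj ij.
rewrite !nth_nrows // => /negP[]; apply/all3bP => t td; apply/eqP.
by move: (vw (p t) (pd t td)); rewrite vi wj !(chart_nadj cp).
Qed.

Lemma table_locally_cotriangular : locally_cotriangular E.
Proof.
have /and3P[_ _ /allnP h] := Lok; move=> z x y zx zy xy.
have [p cp] := charts z; have [pd ps _ _] := cp.
have [i id xi] := ps x zx; have [j jd yj] := ps y zy; subst x y.
move: xy; rewrite (chart_nadj cp) // => ij.
move: (h i id) => /allnP/(_ j jd); rewrite !nth_nrows // nth_mkseq // ij.
move=> /andP[/hasnP[s sd sE] _].
by exists (p s); [exact: pd | exact: chart_row_sum].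
Qed.

Lemma table_locally_rigid : locally_rigid E.
Proof.
have /and3P[_ _ /allnP h] := Lok; move=> z x y y' zx zy zy' xy xy' agr.
have [p cp] := charts z; have [pd ps _ pE] := cp.
have [i id xi] := ps x zx; have [j jd yj] := ps y zy.
have [k kd yk] := ps y' zy'; subst x y y'.
rewrite (chart_nadj cp) // in xy; rewrite (chart_nadj cp) // in xy'.
move: (h i id) => /allnP/(_ j jd); rewrite !nth_nrows // nth_mkseq // xy.
move=> /andP[_ /allnP/(_ k kd)]; case: eqVneq => [->|_]; first by left.
rewrite !nth_nrows // nth_mkseq // xy'.
case: ifP => [_ rs|/negP[]]; first by right; exact: chart_row_sum.
apply/all3bP => w wd; case iw: (tn i w) => //.
have [<-|niw] := eqVneq i w.
  rewrite -!(chart_nadj cp) // !(nadjC Es _ (p i)) !(chart_nadj cp) //.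
  by rewrite xy xy'.
have Eiw : E (p i) (p w).
  by rewrite pE //; move: iw; rewrite /nadj niw /= => /negbFE.
have neq m : m < d -> tn i m -> p m != p w.
  move=> md im; apply: contraTneq Eiw => <-; rewrite pE //.
  by rewrite (nadj_adjF im).
by rewrite -!(chart_nadj cp) // !adjF_nadj ?neq // agr //; exact: pd.
Qed.

Variable F : seq bitseq.
Hypothesis Fok : mu_family_ok F.
Hypothesis muF : forall x y p, nadj E x y -> tchart E x p -> mu_word E p y \in F.

Lemma table_mu_meet : mu_meet E.
Proof.
have /andP[/allP h _] := Fok; move=> x y w xy xw; have [p cp] := charts x.
move: (h _ (muF xy cp)) => /allP/(_ _ (muF xw cp)).
have [/hasP[i]|/hasPn none] := boolP (has (fun i => E y (p i) && E w (p i)) (iota 0 d)); last first.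
  case/negP; apply/all3bP => i id; apply: none.
  by rewrite mem_iota add0n.
rewrite mem_iota add0n => /= id /andP[yi wi] _; exists (p i); split.
- by have [pd _ _ _] := cp; exact: pd.
- by rewrite Es.
- by rewrite Es.
Qed.

Lemma table_mu_determined : mu_determined E.
Proof.
have /andP[_ /allP h] := Fok; move=> x y s z xy xs xz zy zs agr w xw.
have [p cp] := charts x; have [pd ps _ pE] := cp.
move: (h _ (muF xy cp)) => /allP/(_ _ (muF xs cp)) /allnP.
have [i id zi] := ps z xz; subst z => /(_ i id).
rewrite nth_nrows // !nth_mkseq // !(Es _ (p i)) zy zs /=.
case: ifP => [_ /eqP|/negP[]].
  have [j jd ->] := ps w xw.
  by move/(congr1 (fun h => nth false h j)); rewrite !nth_mkseq.
apply/all3bP => j jd; case ij: (tn i j) => //.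
have [<-|nij] := eqVneq i j; first by rewrite !(Es _ (p i)) zy zs.
apply/eqP/agr; first exact: pd.
by rewrite pE //; move: ij; rewrite /nadj nij /= => /negbFE.
Qed.

Lemma table_cotriangular : reduced E /\ sum_closed E true.
Proof.
split; first exact: reduced_of_no_cone Ei table_no_cone.
apply: cotriangular_of_local => //.
- exact: table_locally_reduced.
- exact: table_locally_cotriangular.
- exact: table_locally_rigid.
- exact: table_mu_determined.
- exact: table_mu_meet.
Qed.

End Local.

(** The common neighbours of a non-adjacent pair on one side are, as a subset of
    the local graph, matched by those of a pair on the other side. *)
Lemma table_iso (V V' : eqType) (E : rel V) (E' : rel V')
    (Es : symmetric E) (Ei : irreflexive E)
    (Es' : symmetric E') (Ei' : irreflexive E') F x' p' :
  table_ok -> mu_family_ok F ->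
  (forall x, exists p, tchart E x p) -> (forall x, exists p, tchart E' x p) ->
  (forall x y p, nadj E x y -> tchart E x p -> mu_word E p y \in F) ->
  (forall x y p, nadj E' x y -> tchart E' x p -> mu_word E' p y \in F) ->
  tchart E' x' p' ->
  (forall h, h \in F -> exists2 y', nadj E' x' y' & mu_word E' p' y' = h) ->
  (exists x y, nadj E x y) ->
  graph_iso (relgraph Es Ei) (relgraph Es' Ei').
Proof.
move=> Lok Fok ch ch' muF muF' cp' real [x [y xy]].
have [red sc] := table_cotriangular Es Ei ch Lok Fok muF.
have [red' sc'] := table_cotriangular Es' Ei' ch' Lok Fok muF'.
have [p cp] := ch x; have [y' xy' yE] := real _ (muF _ _ _ xy cp).
have [pd ps _ _] := cp; have [pd' ps' _ _] := cp'.
apply: (cotriangular_iso Es Ei Es' Ei' red red' sc sc' xy xy' pd pd') => //.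
- by move=> i j id jd; rewrite (chart_nadj cp) // (chart_nadj cp').
- move=> i id; have := congr1 (fun h => nth false h i) yE.
  by rewrite !nth_mkseq.
Qed.

(** ** Lines *)

(** A check that, in the charted graph, a common neighbour [k] of adjacent [i]
    and [j] that is adjacent to all others is their sum. *)
Definition lines_ok : bool := let R := nrows in
  alln d (fun i => alln d (fun j => if tadj i j then alln d (fun k =>
    if tadj i k then if tadj j k then
      if all3b (fun u v w => if u then true else if v then true else ~~ w)
           (nth [::] R i) (nth [::] R j) (nth [::] R k)
      then row_sumb R k i j else true else true else true) else true)).

Definition tline R i j k : bool :=
  if tadj i j then if tadj i k then if tadj j k then row_sumb R k i j
  else false else false else false.

Lemma tlineP R i j k :
  tline R i j k = [&& tadj i j, tadj i k, tadj j k & row_sumb R k i j].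
Proof. by rewrite /tline; do 3!case: (tadj _ _). Qed.

(** If y is adjacent to x's neighbour z but not to x, and a, a' complete a line
    with z, then in the neighbourhood of z the triple x, a, a' is also a line,
    because both lines are recognised by the common neighbours of x, z and a. So
    exactly one of a and a' is adjacent to y. *)
Lemma mu_line1 (V : eqType) (E : rel V) (Es : symmetric E)
    (Ei : irreflexive E) x y p i j k :
  (forall x, exists p, tchart E x p) -> lines_ok ->
  nadj E x y -> tchart E x p -> i < d -> j < d -> k < d ->
  tline nrows i j k -> E y (p i) -> E y (p k) = ~~ E y (p j).
Proof.
move=> ch /allnP lok xy cp id jd kd.
rewrite tlineP => /and4P[ij ik jk /row_sumbP ksum] yi.
have [pd ps pI pE] := cp; have [q cq] := ch (p i); have [qd qs qI qE] := cq.
have px m : m < d -> E (p m) x by move=> md; rewrite Es pd.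
have [a ad xa] := qs x (px i id).
have [b bd jb] := qs (p j) ltac:(by rewrite pE).
have [c cd kc] := qs (p k) ltac:(by rewrite pE).
have [l ld yl] := qs y ltac:(by rewrite Es).
have ab : tadj a b by rewrite -qE // -xa -jb pd.
have ac : tadj a c by rewrite -qE // -xa -kc pd.
have bc : tadj b c by rewrite -qE // -jb -kc pE.
have csum : row_sumb nrows c a b.
  move: (lok a ad) => /allnP/(_ b bd); rewrite ab => /allnP/(_ c cd).
  rewrite ac bc !nth_nrows //; case: ifP => // /negP[]; apply/all3bP => m md.
  case ma : (tn a m) => //; case mb : (tn b m) => //=.
  rewrite -(chart_nadj cq) //.
  have [<-|nam] := eqVneq a m; first by rewrite adj_nadjF // Es qE.
  have [<-|nbm] := eqVneq b m; first by rewrite adj_nadjF // Es qE.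
  have xm : E x (q m).
    by rewrite xa qE //; move: ma; rewrite /nadj nam /= => /negbFE.
  have [m' m'd qm] := ps _ xm.
  have jm' : tn j m' = false.
    by rewrite -(chart_nadj cp) // -qm jb (chart_nadj cq).
  have im' : tn i m' = false.
    by rewrite -(chart_nadj cp) // -qm adj_nadjF // qd.
  by have := ksum kd id jd m' m'd; rewrite im' jm' -(chart_nadj cp) // -qm kc => ->.
have yk : E (p i) y by rewrite Es.
have := chart_row_sum cq cd ad bd csum yk; rewrite -xa -jb -kc xy.
have neq m : m < d -> p m != y.
  by move=> md; apply: contraTneq (pd m md) => ->; rewrite (nadj_adjF xy).
by rewrite !adjF_nadj ?neq // !(Es _ y) addTb => /negb_inj ->.
Qed.

(** All ways to extend the words in [hs] to index [i] compatibly with the lines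
    whose last point is [i]. *)
Definition extend_words R (i : nat) (hs : seq bitseq) : seq bitseq :=
  let ab := [seq ab <- [seq (a, b) | a <- iota 0 i, b <- iota 0 i]
               | if ab.1 < ab.2 then tline R ab.1 ab.2 i else false] in
  flatten [seq [seq rcons h v | v <- [:: false; true]
     & all (fun ab => v == nth false h ab.1 (+) nth false h ab.2) ab] | h <- hs].

Fixpoint line_words_rows R (n : nat) : seq bitseq :=
  if n is m.+1 then extend_words R m (line_words_rows R m) else [:: [::]].

Definition line_words : seq bitseq := let R := nrows in line_words_rows R d.

Lemma line_wordsP (h : nat -> bool) :
  (forall i j k, i < d -> j < d -> k < d -> tline nrows i j k -> h k = h i (+) h j) ->
  mkseq h d \in line_words.
Proof.
move=> hline; rewrite /line_words /=; have: d <= d by [].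
elim: {1 3 4}d => [|m IHm] md; first by rewrite mem_seq1.
rewrite /= /extend_words; apply/flattenP.
exists [seq rcons (mkseq h m) v | v <- [:: false; true]
   & all (fun ab => v == nth false (mkseq h m) ab.1 (+) nth false (mkseq h m) ab.2)
   [seq ab <- [seq (a, b) | a <- iota 0 m, b <- iota 0 m]
               | if ab.1 < ab.2 then tline nrows ab.1 ab.2 m else false]].
  by apply/mapP; exists (mkseq h m) => //; apply: IHm; exact: ltnW.
apply/mapP; exists (h m).
  rewrite mem_filter; apply/andP; split; last by case: (h m).
  apply/allP => -[a b]; rewrite mem_filter /= => /andP[].
  case: ifP => // ab tl /allpairsP[[a' b'] /= []].
  rewrite !mem_iota /= !add0n => am bm [? ?]; subst a' b'.
  rewrite !nth_mkseq //; apply/eqP; apply: hline => //; lia.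
by rewrite /mkseq -addn1 iotaD map_cat /= cats1 add0n.
Qed.

Lemma mu_line_word (V : eqType) (E : rel V) (Es : symmetric E)
    (Ei : irreflexive E) x y p :
  (forall x, exists p, tchart E x p) -> lines_ok ->
  nadj E x y -> tchart E x p -> mu_word E p y \in line_words.
Proof.
move=> ch lok xy cp; apply: line_wordsP => i j k id jd kd ijk.
have m1 := mu_line1 Es Ei ch lok xy cp.
have [_ _ _ pE] := cp.
have tC a b : a < d -> b < d -> tadj a b = tadj b a.
  by move=> ad bd; rewrite -!pE // Es.
have nC a b : a < d -> b < d -> tn a b = tn b a.
  by move=> ad bd; rewrite /nadj eq_sym tC.
have := ijk; rewrite tlineP => /and4P[ij ik jk /row_sumbP ksum].
have {}ksum := ksum kd id jd.
have jik : tline nrows j i k.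
  rewrite tlineP (tC j i) // ij jk ik /=.
  by apply/row_sumbP => // w wd; rewrite addbC; exact: ksum.
have ikj : tline nrows i k j.
  rewrite tlineP ik ij (tC k j) // jk /=.
  by apply/row_sumbP => // w wd; rewrite (ksum w wd) addKb.
have kij : tline nrows k i j.
  rewrite tlineP (tC k i) // (tC k j) // ik ij jk /=.
  by apply/row_sumbP => // w wd; rewrite (ksum w wd) addbC addKb.
case yi: (E y (p i)); first by rewrite (m1 i j k) //; case: (E y (p j)).
case yj: (E y (p j)); first by rewrite (m1 j i k) // yi.
by apply/negP => yk; move: yj; rewrite (m1 k i j) // yi.
Qed.

End Tables.

(** * Counting in finite graphs *)

Section Counting.

Variables (d kappa : nat) (L : seq (seq bool)).
Variables (V : finType) (E : rel V).
Hypotheses (Es : symmetric E) (Ei : irreflexive E).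
Hypothesis charts : forall x, exists p, tchart d L E x p.

Definition far_count_ok : bool :=
  all (fun r => count id r == kappa) (nrows d L).

Definition mu x y := #|[pred z | E x z & E y z]|.

Definition far x := [pred y | nadj E x y].

Lemma card_local x p (Q : pred V) : tchart d L E x p ->
  #|[pred z | E x z & Q z]| = count (fun i => Q (p i)) (iota 0 d).
Proof.
move=> [pd ps pI _]; rewrite -(count_map p Q) -size_filter.
rewrite -(card_uniqP _); last first.
  rewrite filter_uniq // map_inj_in_uniq ?iota_uniq // => i j.
  by rewrite !mem_iota !add0n; exact: pI.
apply: eq_card => z; rewrite mem_filter inE andbC; congr (_ && _).
apply/idP/mapP => [/ps[i id ->]|[i + ->]].
  by exists i; rewrite ?mem_iota ?add0n.
by rewrite mem_iota add0n => /pd.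
Qed.

Lemma mu_wordE x p y : tchart d L E x p -> count id (mu_word d E p y) = mu x y.
Proof. by move=> cp; rewrite /mu (card_local _ cp) count_map. Qed.

Lemma card_nbr x : #|E x| = d.
Proof.
have [p cp] := charts x; have := card_local predT cp.
rewrite count_predT size_iota => <-; apply: eq_card => z.
by rewrite !inE andbT.
Qed.

Lemma card_far x : #|far x| = #|V| - d.+1.
Proof.
rewrite -(cardC (far x)).
have -> : #|[predC far x]| = d.+1; last by rewrite addnK.
rewrite (cardD1 x) !inE nadjxx /= add1n -(card_nbr x); congr (_.+1).
apply: eq_card => z; rewrite !inE /nadj negb_and !negbK (eq_sym x z).
case: eqVneq => [->|_] //=; by rewrite -topredE /= Ei.
Qed.

Lemma card_far_nbr x z : far_count_ok -> E x z ->
  #|[pred y | nadj E x y & E z y]| = kappa.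
Proof.
move=> /allP ok xz; have [q cq] := charts z; have [_ qs _ _] := cq.
have [i id xi] := qs x ltac:(by rewrite Es).
have -> : #|[pred y | nadj E x y & E z y]| = #|[pred y | E z y & nadj E x y]|.
  by apply: eq_card => y; rewrite !inE andbC.
rewrite (card_local _ cq) xi.
have /ok/eqP <- : nth [::] (nrows d L) i \in nrows d L.
  by apply: mem_nth; rewrite size_mkseq.
rewrite nth_nrows // count_map; apply: eq_in_count => j.
by rewrite mem_iota add0n => /= jd; rewrite (chart_nadj cq).
Qed.

Lemma sum_mu x : far_count_ok -> \sum_(y in far x) mu x y = d * kappa.
Proof.
move=> ok; under eq_bigr => y _ do rewrite /mu -sum1_card.
rewrite (exchange_big_dep (E x)) /=; last by move=> y z _ /andP[].
rewrite (eq_bigr (fun=> kappa)); last first.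
  move=> z xz; rewrite sum1_card -(card_far_nbr ok xz).
  by apply: eq_card => y; rewrite !inE unfold_in /= !inE xz (Es z).
by rewrite sum_nat_const card_nbr.
Qed.

(** When the average of [mu x] over the far vertices is its largest or its
    smallest possible value [k], all values are [k]. *)
Lemma mu_extremal k x : far_count_ok -> (#|V| - d.+1) * k = d * kappa ->
  (forall y, nadj E x y -> mu x y <= k) \/ (forall y, nadj E x y -> k <= mu x y) ->
  forall y, nadj E x y -> mu x y = k.
Proof.
move=> ok tot le y xy; have := sum_mu x ok; rewrite (bigD1 y) //= => sum.
have : \sum_(i in far x) k = k + \sum_(i in far x | i != y) k by rewrite (bigD1 y).
rewrite sum_nat_const card_far tot; case: le => le; have := le y xy.
  have : \sum_(i in far x | i != y) mu x i <= \sum_(i in far x | i != y) k.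
    by apply: leq_sum => i /andP[xi _]; exact: le.
  by move: sum; move: (d * kappa) (\sum_(_ in _ | _) _) (\sum_(_ in _ | _) k); lia.
have : \sum_(i in far x | i != y) k <= \sum_(i in far x | i != y) mu x i.
  by apply: leq_sum => i /andP[xi _]; exact: le.
by move: sum; move: (d * kappa) (\sum_(_ in _ | _) _) (\sum_(_ in _ | _) k); lia.
Qed.

End Counting.

(** ** Weyl graphs given by a root list *)

Definition nbrs0 RL : seq nat := [seq j <- iota 0 (size RL) | adjl RL 0 j].

Definition local_table RL : seq (seq bool) :=
  let D := nbrs0 RL in [seq [seq adjl RL i j | j <- D] | i <- D].

Definition far_words RL : seq bitseq :=
  let D := nbrs0 RL in [seq [seq adjl RL y j | j <- D]
    | y <- [seq y <- iota 0 (size RL) | (0 != y) && ~~ adjl RL 0 y]].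

Section RootListGraph.

Variables (RL : seq (seq int)) (N d : nat) (E : rel 'I_N.+1).
Hypotheses (Es : symmetric E) (Ei : irreflexive E).
Hypothesis EE : forall i j, E i j = adjl RL i j.
Hypotheses (sRL : size RL = N.+1) (sD : size (nbrs0 RL) = d).

Definition base_point (i : nat) : 'I_N.+1 := inord (nth 0 (nbrs0 RL) i).

Lemma val_base_point i : i < d -> val (base_point i) = nth 0 (nbrs0 RL) i.
Proof.
move=> id; rewrite /base_point /= inordK //.
have /(mem_nth 0) : i < size (nbrs0 RL) by rewrite sD.
by rewrite mem_filter mem_iota add0n sRL => /andP[_ /andP[]].
Qed.

Lemma tadj_local_table i j : i < d -> j < d ->
  tadj (local_table RL) i j = E (base_point i) (base_point j).
Proof.
move=> id jd; rewrite EE !val_base_point //.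
by rewrite /tadj (nth_map 0) ?sD // (nth_map 0) ?sD.
Qed.

Lemma base_chart (V : eqType) (F : rel V) x p :
  local_chart F x (E ord0) E p ->
  tchart d (local_table RL) F x (p \o base_point).
Proof.
move=> cp; apply: (chart_comp cp).
- move=> i id; rewrite EE val_base_point //.
  have /(mem_nth 0) : i < size (nbrs0 RL) by rewrite sD.
  by rewrite mem_filter => /andP[].
- move=> i; rewrite EE => h.
  have iD : val i \in nbrs0 RL by rewrite mem_filter h mem_iota sRL /=.
  have ilt : index (val i) (nbrs0 RL) < d by rewrite -sD index_mem.
  by exists (index (val i) (nbrs0 RL)) => //; apply: val_inj; rewrite val_base_point ?nth_index.
- move=> i j id jd /(congr1 val); rewrite !val_base_point // => /eqP.
  by rewrite nth_uniq ?sD // ?filter_uniq ?iota_uniq // => /eqP.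
- by move=> i j id jd; rewrite tadj_local_table.
Qed.

Lemma base_tchart : tchart d (local_table RL) E ord0 base_point.
Proof.
apply: (@base_chart _ E ord0 id); split=> // i j; last by move=> *; exists i.
Qed.

Lemma far_wordsP h : h \in far_words RL ->
  exists2 y, nadj E ord0 y & mu_word d E base_point y = h.
Proof.
case/mapP=> y; rewrite mem_filter mem_iota add0n sRL => /andP[/andP[y0 ay] /= yN] ->.
exists (Ordinal yN); first by rewrite /nadj EE -val_eqE /= y0.
rewrite /mu_word -sD -[RHS](mkseq_nth false) size_map.
apply: (eq_from_nth (x0 := false)); rewrite ?size_mkseq // => i id.
have id' : i < d by rewrite -sD.
by rewrite !nth_mkseq // (nth_map 0) // EE val_base_point.
Qed.

End RootListGraph.

Lemma weyl_charts n (Phi : 'rV_n -> Prop) RL N d (G : graph) :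
  root_list_ok n RL -> size RL = N.+1 -> size (nbrs0 RL) = d ->
  represents RL Phi -> same_local G (weyl_graph_of Phi) -> inhabited G ->
  exists (E : rel 'I_N.+1) (Es : symmetric E) (Ei : irreflexive E),
  [/\ forall i j, E i j = adjl RL i j,
      graph_iso (relgraph Es Ei) (weyl_graph_of Phi),
      forall x, exists p, tchart d (local_table RL) E x p
    & forall (V : eqType) (F : rel V) (Fs : symmetric F) (Fi : irreflexive F),
        graph_iso G (relgraph Fs Fi) ->
        forall x, exists p, tchart d (local_table RL) F x p].
Proof.
move=> RLok sRL sD [R1 R2] loc [g].
have [E [Es [Ei [EE [f [bf fE _]]]]]] := root_list_iso RLok sRL R1 R2.
have WE : graph_iso (relgraph Es Ei) (weyl_graph_of Phi) by exists f.
have locE := iso_local (graph_iso_refl G) (graph_iso_sym WE) loc.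
have ch (V : eqType) (F : rel V) (Fs : symmetric F) (Fi : irreflexive F) :
    same_local (relgraph Fs Fi) (relgraph Es Ei) ->
    forall x, exists p, tchart d (local_table RL) F x p.
  move=> locF x; have [p cp] := chart_of_iso (locF x ord0).
  by exists (p \o base_point RL N); apply: (base_chart EE sRL sD).
exists E, Es, Ei; split=> //.
  apply: (ch _ _ Es Ei) => x y.
  by apply: graph_iso_trans (locE g y); apply: graph_iso_sym; exact: locE.
move=> V F Fs Fi GF; apply: (ch _ _ Fs Fi).
exact: iso_local GF (graph_iso_refl _) locE.
Qed.

Definition weyl_table_ok n RL N d F : bool := [&&
  root_list_ok n RL, size RL == N.+1, size (nbrs0 RL) == d.+1,
  table_ok d.+1 (local_table RL), mu_family_ok d.+1 (local_table RL) F &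
  all (fun h => h \in far_words RL) F].

(** A graph with as many vertices as the Weyl graph, and locally like it, is
    isomorphic to it as soon as counting confines the sets of common neighbours
    of non-adjacent vertices to the family [F]. *)
Lemma weyl_table_iso n (Phi : 'rV_n -> Prop) RL N d F (G : graph) :
  weyl_table_ok n RL N d F -> represents RL Phi ->
  (forall (V : finType) (E : rel V) (Es : symmetric E) (Ei : irreflexive E),
     #|V| = N.+1 -> (forall x, exists p, tchart d.+1 (local_table RL) E x p) ->
     forall x y p, nadj E x y -> tchart d.+1 (local_table RL) E x p ->
     mu_word d.+1 E p y \in F) ->
  same_local G (weyl_graph_of Phi) -> same_card G (weyl_graph_of Phi) ->
  graph_iso G (weyl_graph_of Phi).
Proof.
move=> /and5P[RLok /eqP sRL /eqP sD Lok /andP[Fok /allP real]] rep muF loc card.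
have [R1 R2] := rep; have [E0 [Es0 [Ei0 [_ [f [bf _ _]]]]]] := root_list_iso RLok sRL R1 R2.
have [g0 _] : exists g0 : G, True.
  by have [c [c' _ _]] := card; exists (c' (f ord0)).
have [E [Es [Ei [EE WE ch' chG]]]] :=
  weyl_charts RLok sRL sD rep loc (inhabits g0).
have [|VE [VEs [VEi GV]]] := @finite_iso G 'I_N.+1.
  have [c bc] := card; have [h fK gK] := bf; exists (h \o c); apply: bij_comp bc.
  by exists f.
have ch := chG _ _ _ _ GV.
apply: graph_iso_trans GV (graph_iso_trans _ WE).
apply: (table_iso VEs VEi Es Ei Lok Fok ch ch').
- by apply: muF => //; rewrite card_ord.
- by apply: muF => //; rewrite card_ord.
- exact: base_tchart EE sRL sD.
- by move=> h /real /(far_wordsP EE sRL sD).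
have [p cp] := ch ord0; have [pd _ _ _] := cp.
have [t _ pt] := table_no_cone ch Lok (pd 0 isT).
by exists (p 0), t.
Qed.

(** * The types A6, A7, E6 and E8 *)

Definition of_weight k (F : seq bitseq) := [seq h <- F | count id h == k].

(** The average number of common neighbours is [k], and [F], which contains all
    sets of common neighbours, has no larger member; so all those sets have [k]
    elements. *)
Lemma weyl_extremal_iso n (Phi : 'rV_n -> Prop) RL N d k kappa F (G : graph) :
  weyl_table_ok n RL N d (of_weight k F) -> represents RL Phi ->
  far_count_ok d.+1 kappa (local_table RL) ->
  all (fun h => count id h <= k) F ->
  (N.+1 - d.+2) * k = d.+1 * kappa ->
  (forall (V : finType) (E : rel V) (Es : symmetric E) (Ei : irreflexive E),
     (forall x, exists p, tchart d.+1 (local_table RL) E x p) ->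
     forall x y p, nadj E x y -> tchart d.+1 (local_table RL) E x p ->
     mu_word d.+1 E p y \in F) ->
  same_local G (weyl_graph_of Phi) -> same_card G (weyl_graph_of Phi) ->
  graph_iso G (weyl_graph_of Phi).
Proof.
move=> ok rep far_ok /allP le_k tot muF; apply: weyl_table_iso ok rep _.
move=> V E Es Ei cV ch x y p xy cp.
rewrite mem_filter (mu_wordE _ cp) (muF V E Es Ei ch x y p xy cp) andbT; apply/eqP.
apply: (mu_extremal Es Ei ch far_ok) xy; first by rewrite cV.
left=> y' xy'; rewrite -(mu_wordE _ cp); exact/le_k/(muF V E Es Ei ch x).
Qed.

Lemma weyl_lines_iso n (Phi : 'rV_n -> Prop) RL N d k kappa (G : graph) :
  let L := local_table RL in let F := line_words d.+1 L in
  weyl_table_ok n RL N d (of_weight k F) -> represents RL Phi ->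
  far_count_ok d.+1 kappa L -> lines_ok d.+1 L ->
  all (fun h => count id h <= k) F ->
  (N.+1 - d.+2) * k = d.+1 * kappa ->
  same_local G (weyl_graph_of Phi) -> same_card G (weyl_graph_of Phi) ->
  graph_iso G (weyl_graph_of Phi).
Proof.
move=> L F ok rep far_ok lok le_k tot.
apply: (weyl_extremal_iso ok rep far_ok le_k tot).
by move=> V E Es Ei ch x y p; apply: (mu_line_word Es Ei ch lok).
Qed.

Lemma A7_iso (G : graph) :
  same_local G (weyl_graph (A_ 7)) -> same_card G (weyl_graph (A_ 7)) ->
  graph_iso G (weyl_graph (A_ 7)).
Proof.
apply: (@weyl_lines_iso _ _ (rootlA 8) 27 14 10 8).
- by vm_compute.
- exact: rootlA_represents.
- by vm_compute.
- by vm_compute.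
- by vm_compute.
- by [].
Qed.

Lemma E8_iso (G : graph) :
  same_local G (weyl_graph E_8) -> same_card G (weyl_graph E_8) ->
  graph_iso G (weyl_graph E_8).
Proof.
apply: (@weyl_lines_iso _ _ rootlE8 119 62 36 32).
- by vm_compute.
- exact: rootlE8_represents.
- by vm_compute.
- by vm_compute.
- by vm_compute.
- by vm_compute.
Qed.

(** In the Petersen graph two non-adjacent vertices have exactly one common
    neighbour, so the common neighbours of two vertices at distance two induce a
    matching. *)
Definition matching_words d L : seq bitseq :=
  [seq h <- words d | alln d (fun i => if nth false h i then
     count (fun j => tadj L i j && nth false h j) (iota 0 d) == 1 else true)].

Definition single_mu d L : bool :=
  alln d (fun i => alln d (fun j => if nadj (tadj L) i j then
    count (fun m => tadj L i m && tadj L j m) (iota 0 d) == 1 else true)).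

Lemma mu_matching_word d L (V : finType) (E : rel V) (Es : symmetric E)
    (Ei : irreflexive E) x y p :
  (forall x, exists p, tchart d L E x p) -> single_mu d L ->
  nadj E x y -> tchart d L E x p -> mu_word d E p y \in matching_words d L.
Proof.
move=> ch ok xy cp; rewrite mem_filter mem_words size_mkseq eqxx andbT.
apply/allnP => i id; rewrite nth_mkseq //; case yi: (E y (p i)) => //.
have [pd ps _ pE] := cp; have [q cq] := ch (p i); have [qd qs _ qE] := cq.
have [a ad xa] := qs x ltac:(by rewrite Es pd).
have [b bd yb] := qs y ltac:(by rewrite Es).
move: ok => /allnP/(_ a ad)/allnP/(_ b bd).
rewrite -(chart_nadj cq) // -xa -yb xy => /eqP <-; apply/eqP.
transitivity #|[pred w | E x w & E (p i) w && E y w]|.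
  rewrite (card_local _ cp); apply: eq_in_count => j.
  by rewrite mem_iota add0n => jd; rewrite nth_mkseq // pE.
transitivity #|[pred w | E (p i) w & E x w && E y w]|.
  by apply: eq_card => w; rewrite !inE andbCA.
rewrite (card_local _ cq); apply: eq_in_count => j.
by rewrite mem_iota add0n => jd; rewrite xa yb !qE.
Qed.

Lemma A6_iso (G : graph) :
  same_local G (weyl_graph (A_ 6)) -> same_card G (weyl_graph (A_ 6)) ->
  graph_iso G (weyl_graph (A_ 6)).
Proof.
pose L := local_table (rootlA 7).
apply: (@weyl_extremal_iso _ _ (rootlA 7) 20 9 6 6 (matching_words 10 L)).
- by vm_compute.
- exact: rootlA_represents.
- by vm_compute.
- by vm_compute.
- by [].
move=> V E Es Ei ch x y p; apply: (mu_matching_word Es Ei ch).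
by vm_compute.
Qed.

(** ** Type E6 *)

Section SmallestMu.

Variables (V : finType) (E : rel V) (L : seq (seq bool)).
Hypotheses (Es : symmetric E) (Ei : irreflexive E).
Hypothesis charts : forall x, exists p, tchart 15 L E x p.
Hypothesis cV : #|V| = 36.

(** The sets of common neighbours have 0, 6, 8 or 10 elements; those with 6 or 10
    elements meet the neighbourhood of every other vertex of the local graph. *)
Definition gq_words_ok : bool :=
  let R := nrows 15 L in
  all (fun h => (count id h \in [:: 0; 8]) || (count id h \in [:: 6; 10]) &&
    alln 15 (fun i => if nth false h i then true else
      hasn 15 (fun j => nth false h j && tadj L i j))) (line_words 15 L) &&
  alln 15 (fun i => count (tadj L i) (iota 0 15) == 6).

Hypotheses (far_ok : far_count_ok 15 8 L) (lok : lines_ok 15 L).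
Hypothesis gq_ok : gq_words_ok.

Let N x := [set z | E x z].

Let cardN x : #|N x| = 15.
Proof. by rewrite -(card_nbr charts x); apply: eq_card => z; rewrite !inE. Qed.

Let muE x y : mu E x y = #|N x :&: N y|.
Proof. by apply: eq_card => z; rewrite !inE. Qed.

Lemma mu_le10 x y : nadj E x y -> mu E x y <= 10.
Proof.
move=> xy; have [p cp] := charts x; rewrite -(mu_wordE _ cp).
have := mu_line_word Es Ei charts lok xy cp.
move: gq_ok => /andP[/allP h _] /h; rewrite !inE.
by case/orP=> [/orP[]|/andP[/orP[]]] /eqP->.
Qed.

Lemma common_nbr6 x y : E x y -> #|N x :&: N y| = 6.
Proof.
move=> xy; have [p cp] := charts x; have [_ ps _ pE] := cp.
have [i id yi] := ps y xy; move: gq_ok => /andP[_ /allnP/(_ i id)/eqP <-].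
rewrite -muE /mu (card_local _ cp); apply: eq_in_count => j.
by rewrite mem_iota add0n => jd; rewrite yi pE.
Qed.

Definition beyond x w := ~: ([set x; w] :|: (N x :|: N w)).

Section Disjoint.

Variables (x w : V).
Hypotheses (xw : nadj E x w) (mu0 : mu E x w = 0).

Let U := beyond x w.

Lemma nbrs_disjoint z : E x z -> E w z -> False.
Proof.
move=> xz wz; move/eqP: mu0; apply/negP; rewrite -lt0n; apply/card_gt0P.
by exists z; rewrite inE xz.
Qed.

Lemma cardU : #|U| = 4.
Proof.
have c1 : #|[set x; w]| = 2 by rewrite cards2 (nadj_neq xw).
have c2 : #|N x :|: N w| = 30.
  rewrite cardsU !cardN (_ : N x :&: N w = set0) ?cards0 //.
  apply/setP => z; rewrite !inE; apply/negbTE/negP => /andP[].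
  exact: nbrs_disjoint.
have c3 : #|[set x; w] :|: (N x :|: N w)| = 32.
  rewrite cardsU c1 c2 (_ : _ :&: _ = set0) ?cards0 //.
  apply/setP => z; rewrite !inE; apply/negbTE/negP => /andP[/orP[]/eqP->].
    by rewrite Ei Es (nadj_adjF xw).
  by rewrite Ei (nadj_adjF xw).
by have := cardsC ([set x; w] :|: (N x :|: N w)); rewrite c3 cV => - [].
Qed.

(** A neighbour y of [w] is not adjacent to [x], and [w] has no neighbour among
    the common neighbours of y and [x]; so there are 0 or 8 of those. In the
    latter case all 15 neighbours of y are accounted for. *)
Lemma mu_nbr_far y : E w y ->
  mu E x y = 0 \/ mu E x y = 8 /\ [disjoint N y & U].
Proof.
move=> wy.
have nxy : E x y = false by apply/negP => xy; exact: nbrs_disjoint xy wy.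
have xy : nadj E x y.
  by rewrite /nadj nxy andbT; apply: contraTneq wy => <-; rewrite Es (nadj_adjF xw).
have [q cq] := charts y; have [_ qs _ qE] := cq.
have [b bd wb] := qs w ltac:(by rewrite Es).
have yx : nadj E y x by rewrite nadjC.
have := mu_line_word Es Ei charts lok yx cq.
have muq : mu E x y = count id (mu_word 15 E q x).
  by rewrite (mu_wordE _ cq) !muE setIC.
move: gq_ok => /andP[/allP h _] /h; rewrite -muq.
case/orP=> [|/andP[_ /allnP/(_ b bd)]]; last first.
  rewrite nth_mkseq // -wb (nadj_adjF xw) => /hasnP[j jd].
  rewrite nth_mkseq // => /andP[xj]; rewrite -qE // -wb => wj.
  by case: (nbrs_disjoint xj wj).
rewrite !inE => /orP[/eqP->|/eqP m8]; [by left | right; split=> //].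
rewrite -setI_eq0 -cards_eq0.
pose T := (N y :&: N x) :|: (N y :&: N w).
have cT : #|w |: T| = 15.
  rewrite cardsU1 !inE Ei (nadj_adjF xw) !andbF /= cardsU.
  rewrite [N y :&: N x]setIC -muE m8 common_nbr6 1?Es //.
  rewrite (_ : _ :&: _ = set0) ?cards0 //; apply/setP => z; rewrite !inE.
  apply/negbTE/negP => /andP[/andP[xz _] /andP[_ wz]].
  exact: nbrs_disjoint xz wz.
have : w |: T \subset N y :\: U.
  apply/subsetP => z; rewrite !inE negbK => /predU1P[->|].
    by rewrite eqxx orbT /= Es wy.
  by case/orP=> /andP[-> ->]; rewrite ?orbT.
move/subset_leq_card; rewrite cT.
by have := cardsID U (N y); rewrite cardN; lia.
Qed.

Lemma few_nbrs_beyond : #|[set y in N w | ~~ [disjoint N y & U]]| <= 5.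
Proof.
pose A := [set y in N w | [disjoint N y & U]].
have sum : 120 <= 8 * #|A| + 40.
  rewrite -[120](sum_mu Es charts x far_ok).
  have -> : 8 * #|A| + 40 =
      \sum_y ((if y \in A then 8 else 0) + (if y \in U then 10 else 0)).
    by rewrite big_split /= -!big_mkcond !sum_nat_const cardU mulnC.
  rewrite [X in _ <= X](bigID [in far E x]) /=.
  apply: leq_trans (leq_addr _ _); apply: leq_sum => y xy.
  rewrite inE /= in xy; have [->|nyw] := eqVneq y w; first by rewrite mu0.
  have [wy|nwy] := boolP (E w y).
    by case: (mu_nbr_far wy) => [->//|[-> dU]]; rewrite !inE wy dU.
  have -> : y \in U.
    rewrite !inE (negbTE nyw) (negbTE nwy) (eq_sym y) (negbTE (nadj_neq xy)).
    by rewrite (nadj_adjF xy).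
  by apply: leq_trans (mu_le10 xy) (leq_addl _ _).
have := cardsID [set y | [disjoint N y & U]] (N w); rewrite cardN.
have -> : N w :&: [set y | [disjoint N y & U]] = A by apply/setP => y; rewrite !inE.
have -> : N w :\: [set y | [disjoint N y & U]] = [set y in N w | ~~ [disjoint N y & U]].
  by apply/setP => y; rewrite !inE andbC.
by lia.
Qed.

End Disjoint.

(** If [x] and [w] had no common neighbour, each of the 4 vertices beyond them
    would have at most 5 + 5 + 3 neighbours. *)
Lemma mu_neq0 x w : nadj E x w -> mu E x w != 0.
Proof.
move=> xw; apply/eqP => mu0.
have wx : nadj E w x by rewrite nadjC.
have mu0' : mu E w x = 0 by rewrite muE setIC -muE.
have [u uU] : exists u, u \in beyond x w.
  by apply/card_gt0P; rewrite (cardU xw mu0).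
have bC : beyond w x = beyond x w by rewrite /beyond setUC [N w :|: _]setUC [[set w; x]]setUC setUC.
have b1 := few_nbrs_beyond xw mu0; have b2 := few_nbrs_beyond wx mu0'.
rewrite bC in b2.
set B1 := [set y in N w | _] in b1; set B2 := [set y in N x | _] in b2.
have sub : N u \subset (beyond x w :\ u) :|: (B1 :|: B2).
  apply/subsetP => z; rewrite inE => uz.
  have nd : ~~ [disjoint N z & beyond x w].
    by apply/pred0Pn; exists u; rewrite /= uU andbT inE Es.
  have zu : z != u by rewrite eq_sym (adj_neq Ei uz).
  move: uU; rewrite !inE nd zu !andbT !negb_or /= => /andP[/andP[ux uw] /andP[xu wu]].
  have -> : z != x by apply: contraTneq uz => ->; rewrite Es.
  have -> : z != w by apply: contraTneq uz => ->; rewrite Es.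
  by case: (E x z); case: (E w z).
have := leq_trans (subset_leq_card sub) (leq_card_setU _ _).
rewrite cardN => /leq_trans/(_ (leq_add (leqnn _) (leq_card_setU _ _))).
have := cardsD1 u (beyond x w); rewrite uU (cardU xw mu0); lia.
Qed.

Lemma mu_eq6 x y : nadj E x y -> mu E x y = 6.
Proof.
apply: (mu_extremal Es Ei charts far_ok); first by rewrite cV.
right=> {}y xy; have := mu_neq0 xy; have [p cp] := charts x.
rewrite -(mu_wordE _ cp); have := mu_line_word Es Ei charts lok xy cp.
move: gq_ok => /andP[/allP h _] /h; rewrite !inE.
by case/orP=> [/orP[]|/andP[/orP[]]] /eqP->.
Qed.

End SmallestMu.

Lemma E6_iso (G : graph) :
  same_local G (weyl_graph E_6) -> same_card G (weyl_graph E_6) ->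
  graph_iso G (weyl_graph E_6).
Proof.
pose L := local_table rootlE6.
apply: (@weyl_table_iso _ _ rootlE6 35 14 (of_weight 6 (line_words 15 L))).
- by vm_compute.
- exact: rootlE6_represents.
have far_ok : far_count_ok 15 8 L by vm_compute.
have lok : lines_ok 15 L by vm_compute.
have gq_ok : gq_words_ok L by vm_compute.
move=> V E Es Ei cV ch x y p xy cp.
rewrite mem_filter (mu_wordE _ cp) (mu_line_word Es Ei ch lok xy cp) andbT.
by rewrite (mu_eq6 Es Ei ch cV far_ok lok gq_ok xy).
Qed.

(** * Kneser graphs of pairs *)

Lemma fresh (T : finType) (s : seq T) : size s < #|T| -> exists t, t \notin s.
Proof.
move=> sT; apply/existsP; apply: contraLR sT; rewrite -leqNgt negb_exists.
move=> /forallP h; apply: leq_trans (card_size s).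
by apply/subset_leq_card/subsetP => t _; have := h t; rewrite negbK.
Qed.

(** [p i j], for [i != j], are the vertices satisfying [P]; such a vertex depends
    only on the pair {[i], [j]}, and adjacency is disjointness of pairs. *)
Definition kneser_chart (V : eqType) (P : pred V) (E : rel V) (T : eqType)
    (p : T -> T -> V) : Prop :=
  [/\ forall i j, i != j -> P (p i j),
      forall v, P v -> exists i j, i != j /\ v = p i j,
      forall i j, p i j = p j i,
      forall i j k l, i != j -> k != l -> p i j = p k l ->
        (i = k /\ j = l) \/ (i = l /\ j = k)
    & forall i j k l, i != j -> k != l ->
        E (p i j) (p k l) = [&& i != k, i != l, j != k & j != l]].

Section Chart.

Variables (V : eqType) (P : pred V) (E : rel V) (T : eqType) (p : T -> T -> V).
Hypothesis cp : kneser_chart P E p.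

Lemma kneser_nadj i j k l : i != j -> k != l ->
  nadj E (p i j) (p k l) = ((i == k) || (i == l)) (+) ((j == k) || (j == l)).
Proof.
have [_ _ pC pI pE] := cp; move=> ij kl; rewrite /nadj pE //.
have -> : (p i j == p k l) = ((i == k) && (j == l)) || ((i == l) && (j == k)).
  apply/eqP/orP => [/(pI _ _ _ _ ij kl) [[-> ->]|[-> ->]]|].
  - by left; rewrite !eqxx.
  - by right; rewrite !eqxx.
  - by case=> /andP[/eqP-> /eqP->] //; rewrite pC.
have ab : ~~ ((i == k) && (i == l)).
  by apply: contra kl => /andP[/eqP <- /eqP <-].
have ac : ~~ ((i == k) && (j == k)).
  by apply: contra ij => /andP[/eqP -> /eqP ->].
have bd : ~~ ((i == l) && (j == l)).
  by apply: contra ij => /andP[/eqP -> /eqP ->].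
have cd : ~~ ((j == k) && (j == l)).
  by apply: contra kl => /andP[/eqP <- /eqP <-].
by move: ab ac bd cd; do 4!case: (_ == _).
Qed.

Lemma kneser_nadjP u v : P u -> P v -> nadj E u v ->
  exists a b c, [/\ a != b, a != c, b != c, u = p a b & v = p a c].
Proof.
have [_ pS pC pI pE] := cp.
move=> /pS[i [j [ij ->]]] /pS[k [l [kl ->]]] n.
have ij' : j != i by rewrite eq_sym.
have kl' : l != k by rewrite eq_sym.
have ne (a b c : T) : p i j = p a b -> p k l = p a c -> b != c.
  by move=> e1 e2; apply: contraTneq n => bc; rewrite e1 e2 bc nadjxx.
move: n; rewrite kneser_nadj //.
have [ik _|ik] := eqVneq i k.
  by subst k; exists i, j, l; split=> //; exact: ne.
have [il _|il] := eqVneq i l.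
  by subst l; exists i, j, k; split=> //; apply: ne => //; exact: pC.
move=> /orP[]/eqP jE; subst.
  by exists k, i, l; split=> //; apply: ne => //; exact: pC.
by exists l, i, k; split=> //; apply: ne => //; exact: pC.
Qed.

End Chart.

Lemma kneser_comp (V W : eqType) (E : rel V) (x : V) (D : pred W) (F : rel W)
    (T : eqType) (p : W -> V) (r : T -> T -> W) :
  local_chart E x D F p -> kneser_chart D F r ->
  kneser_chart (E x) E (fun i j => p (r i j)).
Proof.
move=> [pD pS pI pE] [rD rS rC rI rE]; split=> [i j ij|v /pS[w]|||].
- exact/pD/rD.
- by move=> /rS[i [j [ij ->]] ->]; exists i, j.
- by move=> i j; rewrite rC.
- by move=> i j k l ij kl /pI h; apply: rI => //; apply: h; apply: rD.
- by move=> i j k l ij kl; rewrite pE ?rE //; apply: rD.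
Qed.

Section LocallyKneser.

Variables (T : finType) (V : eqType) (E : rel V).
Hypotheses (Es : symmetric E) (Ei : irreflexive E).
Hypothesis cT : 6 < #|T|.
Hypothesis charts : forall x, exists p : T -> T -> V, kneser_chart (E x) E p.

Let fresh1 a b c d e f : exists t : T,
  [&& t != a, t != b, t != c, t != d, t != e & t != f].
Proof.
have [t] := @fresh T [:: a; b; c; d; e; f] cT.
by rewrite !inE !negb_or; exists t.
Qed.

Lemma kneser_no_cone : no_cone E.
Proof.
move=> z v zv; have [p cp] := charts z; have [pP pS _ _ _] := cp.
have [i [j [ij ->]]] := pS v zv; have [k /and5P[ki kj _ _ _]] := fresh1 i j i j i j.
have ik : i != k by rewrite eq_sym.
exists (p i k); first exact: pP.
by rewrite (kneser_nadj cp) // eqxx !(eq_sym j) (negbTE ij) (negbTE kj).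
Qed.

Lemma kneser_locally_reduced : locally_reduced E.
Proof.
move=> z v w zv zw vw; have [p cp] := charts z; have [pP pS pC _ _] := cp.
have [i [j [ij vE]]] := pS v zv; have [k [l [kl wE]]] := pS w zw; subst v w.
(* a point of one pair outside the other gives different rows *)
have sub a b : a != b -> p a b = p i j -> (a == k) || (a == l).
  move=> ab abE; apply/negPn/negP; rewrite negb_or => /andP[ak al].
  have [t /and5P[ta tb tk tl _]] := fresh1 a b k l a a.
  have at' : a != t by rewrite eq_sym.
  have := vw (p a t) (pP _ _ at'); rewrite -abE !(kneser_nadj cp) //.
  rewrite eqxx (eq_sym b a) (negbTE ab) (eq_sym b t) (negbTE tb).
  rewrite (eq_sym k a) (negbTE ak) (eq_sym l a) (negbTE al).
  by rewrite (eq_sym k t) (negbTE tk) (eq_sym l t) (negbTE tl).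
have ikl := sub i j ij erefl.
have jkl : (j == k) || (j == l) by apply: (sub j i); rewrite // eq_sym.
case/orP: ikl => /eqP iE; case/orP: jkl => /eqP jE; subst=> //.
- by rewrite eqxx in ij.
- by rewrite eqxx in ij.
Qed.

Lemma kneser_local_sum z (p : T -> T -> V) a b c : kneser_chart (E z) E p ->
  a != b -> a != c -> b != c -> local_sum E z (p b c) (p a b) (p a c).
Proof.
move=> cp ab ac bc w zw; have [_ pS _ _ _] := cp.
have [k [l [kl ->]]] := pS w zw; rewrite !(kneser_nadj cp) //.
by do 6!case: (_ == _).
Qed.

Lemma kneser_locally_cotriangular : locally_cotriangular E.
Proof.
move=> z x y zx zy xy; have [p cp] := charts z; have [pP _ _ _ _] := cp.
have [a [b [c [ab ac bc -> ->]]]] := kneser_nadjP cp zx zy xy.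
by exists (p b c); [exact: pP | exact: kneser_local_sum].
Qed.

Lemma kneser_locally_rigid : locally_rigid E.
Proof.
move=> z x y y' zx zy zy' xy xy' agr.
have [p cp] := charts z; have [pP pS pC pI pE] := cp.
have [a [b [c [ab ac bc xE yE]]]] := kneser_nadjP cp zx zy xy; subst x y.
have [a' [b' [d [ab' ad bd xE yE]]]] := kneser_nadjP cp zx zy' xy'; subst y'.
have dab : d != a /\ d != b.
  by case: (pI _ _ _ _ ab ab' xE) => [[-> ->]|[-> ->]]; split; rewrite eq_sym.
have [da db] := dab.
have cd : d = c.
  apply/eqP/negPn/negP => dc.
  have [t /and5P[ta tb tc td _]] := fresh1 a b c d a a.
  have ct : c != t by rewrite eq_sym.
  have := agr (p c t) (pP _ _ ct); rewrite !pE // ac bc eqxx andbF.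
  rewrite !(eq_sym _ t) ta tb => /(_ isT); rewrite dc td /= andbT.
  by case: (pI _ _ _ _ ab ab' xE) => [[<- _]|[_ <-]]; rewrite ?ac ?bc ?ta ?tb.
subst d; case: (pI _ _ _ _ ab ab' xE) => [[<- _]|[_ <-]]; first by left.
by right; exact: kneser_local_sum.
Qed.

(** Three pairwise intersecting pairs may form a triangle, but then no fourth pair
    meets them all. *)
Lemma star_of_four (P : pred V) (p : T -> T -> V) v1 v2 v3 v4 : kneser_chart P E p ->
  P v1 -> P v2 -> P v3 -> P v4 ->
  nadj E v1 v2 -> nadj E v1 v3 -> nadj E v1 v4 ->
  nadj E v2 v3 -> nadj E v2 v4 -> nadj E v3 v4 ->
  exists c k1 k2 k3, [/\ c != k1, c != k2, c != k3 &
    [/\ k1 != k2, k1 != k3, k2 != k3 &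
      [/\ v1 = p c k1, v2 = p c k2 & v3 = p c k3]]].
Proof.
move=> cp P1 P2 P3 P4 n12 n13 n14 n23 n24 n34; have [_ pS pC _ _] := cp.
have [c [k1 [k2 [ck1 ck2 k12 e1 e2]]]] := kneser_nadjP cp P1 P2 n12.
have third v : P v -> nadj E v1 v -> nadj E v2 v ->
    (exists2 k, c != k & v = p c k) \/ v = p k1 k2.
  move=> Pv; have [i [j [ij ->]]] := pS v Pv; rewrite e1 e2 !(kneser_nadj cp) //.
  have [ci|ci] := eqVneq c i; first by subst i; left; exists j.
  have [cj|cj] := eqVneq c j.
    by subst j; left; exists i; [rewrite eq_sym | exact: pC].
  move=> /= /orP[]/eqP k1E /orP[]/eqP k2E; subst; rewrite ?eqxx // in k12.
    by right.
  by right; rewrite pC.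
have [[k3 ck3 e3]|e3] := third v3 P3 n13 n23; last first.
  have [[k4 ck4 e4]|e4] := third v4 P4 n14 n24.
    move: n34 n14 n24; rewrite e1 e2 e3 e4 !(kneser_nadj cp) //.
    rewrite !(eq_sym _ c) (negbTE ck1) (negbTE ck2) eqxx /=.
    by case: eqVneq => //= _; case: eqVneq.
  by move: n34; rewrite e3 e4 nadjxx.
exists c, k1, k2, k3; split=> //; split=> //.
- by apply: contraTneq n13 => k13; rewrite e1 e3 k13 nadjxx.
- by apply: contraTneq n23 => k23; rewrite e2 e3 k23 nadjxx.
Qed.

Let three_in_two (i j k1 k2 k3 : T) : k1 != k2 -> k1 != k3 -> k2 != k3 ->
  (i == k1) || (j == k1) -> (i == k2) || (j == k2) -> (i == k3) || (j == k3) ->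
  False.
Proof.
by move=> n12 n13 n23 /orP[]/eqP e1 /orP[]/eqP e2 /orP[]/eqP e3; subst;
   rewrite ?eqxx in n12 n13 n23.
Qed.

(** Near a common neighbour z of [x] and [y], the pairs that are adjacent to [x]
    and z but not to [y] are, seen from z, pairs through one point; seen from [x]
    they intersect pairwise and hence also form a star. *)
Lemma mu_star x y (p : T -> T -> V) a b : nadj E x y -> kneser_chart (E x) E p ->
  a != b -> E y (p a b) -> exists c, [/\ c != a, c != b & forall i j, i != j ->
    i != a -> i != b -> j != a -> j != b -> E y (p i j) = (c != i) && (c != j)].
Proof.
move=> xy cp ab yab; have [pP pS pC pI pE] := cp.
set z := p a b; have [q cq] := charts z; have [qP qS qC qI qE] := cq.
have zx : E z x by rewrite Es pP.
have [al [be [ga [alb alg beg xE yE]]]] := kneser_nadjP cq zx (etrans (Es _ _) yab) xy.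
have [t1 /and5P[t1a t1b t1g _ _]] := fresh1 al be ga al al al.
have [t2 /and5P[t2a t2b t2g t21 _]] := fresh1 al be ga t1 al al.
have [t3 /and5P[t3a t3b t3g t31 /andP[t32 _]]] := fresh1 al be ga t1 t2 al.
have [t4 /and5P[t4a t4b t4g t41 /andP[t42 t43]]] := fresh1 al be ga t1 t2 t3.
have gt t : t != ga -> ga != t by rewrite eq_sym.
have xw t : t != al -> t != be -> t != ga -> E x (q ga t).
  move=> ta tb tg; rewrite xE qE // ?gt // alg beg.
  by rewrite (eq_sym al) ta (eq_sym be) tb.
have ww t u : t != ga -> u != ga -> u != t -> nadj E (q ga t) (q ga u).
  move=> tg ug ut; rewrite (kneser_nadj cq) ?gt // eqxx (negbTE tg).
  by rewrite (eq_sym t) (negbTE ut).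
have [c [k1 [k2 [k3 [ck1 ck2 ck3 [k12 k13 k23 [e1 e2 e3]]]]]]] :
  exists c k1 k2 k3, [/\ c != k1, c != k2, c != k3 &
    [/\ k1 != k2, k1 != k3, k2 != k3 &
      [/\ q ga t1 = p c k1, q ga t2 = p c k2 & q ga t3 = p c k3]]].
  by apply: (@star_of_four (E x) p _ _ _ (q ga t4) cp); rewrite ?xw ?ww.
have zw t : t != ga -> E z (q ga t) by move=> tg; apply: qP; exact: gt.
have := zw t1 t1g; rewrite e1 pE // => /and4P[ac _ bc _].
exists c; split; rewrite 1?eq_sym // => i j ij ia ib ja jb.
have zv : E z (p i j) by rewrite pE // !(eq_sym _ i) !(eq_sym _ j) ia ib ja jb.
have xv := pP i j ij.
have [s [t [st vE]]] := qS _ zv.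
move: (xv); rewrite vE xE qE // => /and4P[als alt' bes bet].
have -> : E y (q s t) = (ga != s) && (ga != t) by rewrite yE qE // als alt'.
have on_star : (c == i) || (c == j) -> ~~ ((ga != s) && (ga != t)).
  move=> cij; apply/negP => /andP[gs g't].
  have nE tn kn : tn != ga -> c != kn -> q ga tn = p c kn -> (s == tn) || (t == tn).
    move=> tg ck en; have : E (p i j) (p c kn) = false.
      by rewrite pE //; case/orP: cij => /eqP <-; rewrite eqxx ?andbF.
    rewrite -en vE qE ?gt // !(eq_sym _ ga) gs g't /= => /negbT.
    by rewrite negb_and !negbK.
  have tt : [/\ t1 != t2, t1 != t3 & t2 != t3] by split; rewrite eq_sym.
  case: tt => t12 t13 t23.
  exact: (three_in_two t12 t13 t23 (nE _ _ t1g ck1 e1) (nE _ _ t2g ck2 e2)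
           (nE _ _ t3g ck3 e3)).
have [ci|ci] := eqVneq c i; first by apply/negbTE/on_star; rewrite ci eqxx.
have [cj|cj] := eqVneq c j; first by apply/negbTE/on_star; rewrite cj eqxx orbT.
apply/negPn/negP => gst.
have nE tn kn : tn != ga -> c != kn -> q ga tn = p c kn -> (i == kn) || (j == kn).
  move=> tg ck en; have : E (q s t) (q ga tn) = false.
    rewrite qE ?gt //; move: gst; rewrite negb_and !negbK !(eq_sym ga).
    by case/orP=> ->; rewrite ?andbF.
  rewrite -vE en pE // !(eq_sym _ c) ci cj /= => /negbT.
  by rewrite negb_and !negbK.
exact: (three_in_two k12 k13 k23 (nE _ _ t1g ck1 e1) (nE _ _ t2g ck2 e2)
         (nE _ _ t3g ck3 e3)).
Qed.

(** The centres of the stars at different common neighbours agree, because two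
    pairs leave two further points. *)
Lemma mu_point x y (p : T -> T -> V) z : nadj E x y -> kneser_chart (E x) E p ->
  E x z -> E z y -> exists c, forall i j, i != j -> E y (p i j) = (c != i) && (c != j).
Proof.
move=> xy cp xz zy; have [pP pS pC pI pE] := cp.
have [a [b [ab zE]]] := pS z xz; subst z.
have star := mu_star xy cp.
have [c [ca cb cM]] := star a b ab (etrans (Es _ _) zy).
have yab : E y (p a b) by rewrite Es.
exists c.
have step d e' i j : d != e' -> d != a -> d != b -> d != c -> e' != a -> e' != b ->
    e' != c -> i != j -> i != d -> i != e' -> j != d -> j != e' ->
    E y (p i j) = (c != i) && (c != j).
  move=> de da db dc ea eb ec ij id ie jd je.
  have yde : E y (p d e') by rewrite cM // !(eq_sym c) dc ec.
  have [c' [c'd c'e c'M]] := star d e' de yde.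
  have := yab; rewrite c'M //; try by rewrite eq_sym.
  move=> /andP[c'a c'b]; rewrite c'M //; have [-> //|c'c] := eqVneq c' c.
  have [f /and5P[fa fb fc fd /andP[fe fc']]] := fresh1 a b c d e' c'.
  have cf : c' != f by rewrite eq_sym.
  have : E y (p c' f) = (c != c') && (c != f) by rewrite cM.
  by rewrite c'M // eqxx !(eq_sym c) c'c fc.
move=> i j ij.
have [d /and5P[da db dc di /andP[dj _]]] := fresh1 a b c i j a.
have [e' /and5P[ea eb ec ei /andP[ej ed]]] := fresh1 a b c i j d.
by apply: (step d e') => //; rewrite eq_sym.
Qed.

Hypothesis conn : connected (relgraph Es Ei).

Lemma kneser_diameter x y : nadj E x y -> exists2 z, E x z & E z y.
Proof.
pose Q (v : V) := [\/ v = x, E x v | exists2 z, E x z & E z v].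
have QQ : forall v, Q v.
  apply: (connected_ind (G := relgraph Es Ei) (x0 := x) conn); first exact: Or31.
  move=> u w; rewrite /Q => Qu uw.
  have [wx|nwx] := eqVneq w x; first exact: Or31.
  have [xw|nxw] := boolP (E x w); first exact: Or32.
  apply: Or33; have [ux|nux] := eqVneq u x; first by rewrite -ux in nxw; rewrite uw in nxw.
  have [xu|nxu] := boolP (E x u); first by exists u.
  case: Qu => [ux|xu|[z xz zu]]; first by rewrite ux eqxx in nux.
    by rewrite xu in nxu.
  have ux : nadj E u x by rewrite /nadj nux Es.
  have [p cp] := charts u; have [pP pS _ _ pE] := cp.
  have [c cM] := mu_point ux cp (etrans (Es _ _) zu) (etrans (Es _ _) xz).
  have [i [j [ij wE]]] := pS w uw.
  have [k /and5P[kc ki kj _ _]] := fresh1 c i j c c c.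
  have [l /and5P[lc li lj lk _]] := fresh1 c i j k c c.
  have kl : k != l by rewrite eq_sym.
  exists (p k l); first by rewrite cM // !(eq_sym c) kc lc.
  by rewrite wE pE // ki kj li lj.
case: (QQ y) => [->|xy|//]; first by rewrite nadjxx.
by rewrite /nadj xy andbF.
Qed.

Lemma kneser_mu x y (p : T -> T -> V) : nadj E x y -> kneser_chart (E x) E p ->
  exists c, forall i j, i != j -> E y (p i j) = (c != i) && (c != j).
Proof.
by move=> xy cp; have [z xz zy] := kneser_diameter xy; exact: mu_point xy cp xz zy.
Qed.

Lemma kneser_mu_meet : mu_meet E.
Proof.
move=> x y w xy xw; have [p cp] := charts x; have [pP _ _ _ _] := cp.
have [c cM] := kneser_mu xy cp; have [d dM] := kneser_mu xw cp.
have [i /and5P[ic id _ _ _]] := fresh1 c d c c c c.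
have [j /and5P[jc jd ji _ _]] := fresh1 c d i c c c.
have ij : i != j by rewrite eq_sym.
exists (p i j); split; first exact: pP.
  by rewrite Es cM // !(eq_sym c) ic jc.
by rewrite Es dM // !(eq_sym d) id jd.
Qed.

Lemma kneser_mu_determined : mu_determined E.
Proof.
move=> x y s z xy xs xz zy zs agr w xw.
have [p cp] := charts x; have [pP pS _ _ pE] := cp.
have [c cM] := kneser_mu xy cp; have [d dM] := kneser_mu xs cp.
have [a [b [ab zE]]] := pS z xz; subst z.
have := zy; rewrite Es cM // => /andP[ca cb].
have [i /and5P[ia ib ic id _]] := fresh1 a b c d a a.
have ci : c != i by rewrite eq_sym.
have cd : d = c.
  apply/eqP/negPn/negP => dc; have := agr (p c i) (pP _ _ ci).
  rewrite pE // !(eq_sym _ c) !(eq_sym _ i) ca cb ia ib => /(_ isT).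
  by rewrite cM // dM // eqxx dc (eq_sym d) id.
have [k [l [kl ->]]] := pS w xw.
by rewrite cM // dM // cd.
Qed.

Lemma kneser_cotriangular : reduced E /\ sum_closed E true.
Proof.
split; first exact: reduced_of_no_cone Ei kneser_no_cone.
apply: cotriangular_of_local => //.
- exact: kneser_locally_reduced.
- exact: kneser_locally_cotriangular.
- exact: kneser_locally_rigid.
- exact: kneser_mu_determined.
- exact: kneser_mu_meet.
Qed.

End LocallyKneser.

Lemma kneser_perm (V : eqType) (P : pred V) (E : rel V) (T : finType)
    (p : T -> T -> V) (s : {perm T}) :
  kneser_chart P E p -> kneser_chart P E (fun i j => p (s i) (s j)).
Proof.
move=> [pP pS pC pI pE]; have sI := inj_eq (@perm_inj _ s).
split=> [i j ij|v /pS[i [j [ij ->]]]|i j|i j k l ij kl|i j k l ij kl].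
- by apply: pP; rewrite sI.
- by exists ((s^-1)%g i), ((s^-1)%g j); rewrite !permKV (inj_eq (@perm_inj _ _)).
- exact: pC.
- case/pI; rewrite ?sI // => -[/perm_inj-> /perm_inj->]; by [left | right].
- by rewrite pE ?sI.
Qed.

(** The common neighbours of [x] and [y] are the pairs that avoid one point; a
    transposition of the points takes it to the one on the other side. *)
Lemma locally_kneser_iso (T : finType) (V V' : eqType) (E : rel V) (E' : rel V')
    (Es : symmetric E) (Ei : irreflexive E)
    (Es' : symmetric E') (Ei' : irreflexive E') :
  6 < #|T| ->
  (forall x, exists p : T -> T -> V, kneser_chart (E x) E p) ->
  (forall x, exists p : T -> T -> V', kneser_chart (E' x) E' p) ->
  connected (relgraph Es Ei) -> connected (relgraph Es' Ei') ->
  graph_iso (relgraph Es Ei) (relgraph Es' Ei').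
Proof.
move=> cT ch ch' conn conn'.
have [red sc] := kneser_cotriangular cT ch conn.
have [red' sc'] := kneser_cotriangular cT ch' conn'.
have far (W : eqType) (F : rel W) (Fs : symmetric F) (Fi : irreflexive F) :
    (forall x, exists p : T -> T -> W, kneser_chart (F x) F p) ->
    inhabited W -> exists x y, nadj F x y.
  move=> chF [x]; have [p cp] := chF x; have [pP _ _ _ _] := cp.
  have [i _] : exists i : T, i \notin [::] by apply: fresh; exact: leq_trans cT.
  have [j] : exists j : T, j \notin [:: i] by apply: fresh; exact: leq_trans cT.
  rewrite inE eq_sym => ij.
  have [t _ pt] := kneser_no_cone cT chF (pP i j ij).
  by exists (p i j), t.
have [x [y xy]] := far V E Es Ei ch (proj1 conn).
have [x' [y' xy']] := far V' E' Es' Ei' ch' (proj1 conn').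
have [p cp] := ch x; have [p0 cp0] := ch' x'.
have [c cM] := kneser_mu cT ch conn xy cp.
have [c' cM'] := kneser_mu cT ch' conn' xy' cp0.
pose s := tperm c c'; have cp' := kneser_perm s cp0.
have [pP pS _ _ _] := cp; have [pP' pS' _ _ _] := cp'.
have sI := inj_eq (@perm_inj _ s).
apply: (@cotriangular_iso _ _ _ _ Es Ei Es' Ei' (T * T)%type (fun ij => ij.1 != ij.2)
  (fun ij => p ij.1 ij.2) (fun ij => p0 (s ij.1) (s ij.2)) x y x' y') => //.
- by move=> [i j] /= ij; exact: pP.
- by move=> [i j] /= ij; exact: pP'.
- by move=> z /pS[i [j [ij ->]]]; exists (i, j).
- by move=> z /pS'[i [j [ij ->]]]; exists (i, j).
- by move=> [i j] [k l] /= ij kl; rewrite (kneser_nadj cp) // (kneser_nadj cp').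
- move=> [i j] /= ij; rewrite cM // cM' ?sI //.
  by rewrite -(tpermL c c') !sI.
Qed.

(** * Type A *)

Lemma pair_coincidences (T : eqType) (i j k l : T) : i != j -> k != l ->
  [/\ ~~ ((i == k) && (i == l)), ~~ ((i == k) && (j == k)),
      ~~ ((i == l) && (j == l)) & ~~ ((j == k) && (j == l))].
Proof.
move=> ij kl; split; apply/negP => /andP[/eqP h1 /eqP h2].
- by rewrite -h1 -h2 eqxx in kl.
- by rewrite h1 h2 eqxx in ij.
- by rewrite h1 h2 eqxx in ij.
- by rewrite -h1 -h2 eqxx in kl.
Qed.

Section WeylA.

Variable n : nat.
Local Open Scope ring_scope.

Let W := {classic reflection (@rootsA n.+1)}.
Let adjW := @adjb (weyl_graph (A_ n.+1)).

Let vecA (ij : 'I_n.+2 * 'I_n.+2) : 'rV[rat]_n.+2 := e ij.1 - e ij.2.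

Lemma dot_vecA i j k l : dot (vecA (i, j)) (vecA (k, l)) =
  (i == k)%:R - (i == l)%:R - (j == k)%:R + (j == l)%:R.
Proof.
rewrite /vecA /= !dotDl !dotDr !dotNl !dotNr !dot_e.
by ring.
Qed.

Lemma vecA_neq0 i j : i != j -> vecA (i, j) != 0.
Proof.
by move=> ij; rewrite -dot_eq0 dot_vecA !eqxx (eq_sym j) (negbTE ij).
Qed.

Lemma weylA_chart : exists r : 'I_n.+2 -> 'I_n.+2 -> W, kneser_chart predT adjW r.
Proof.
have D0 : (ord0 : 'I_n.+2) != ord_max by [].
have [r rE] := @refl_index _ (@rootsA n.+1) _
  (fun ij => ij.1 != ij.2) vecA (ord0, ord_max) D0
  (fun ij h => ex_intro _ ij.1 (ex_intro _ ij.2 (conj (elimN eqP h) erefl))).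
have adjE i j k l : i != j -> k != l -> adjW (r (i, j)) (r (k, l)) =
    (dot (vecA (i, j)) (vecA (k, l)) == 0).
  by move=> ij kl; apply: weyl_adjb; rewrite ?rE ?vecA_neq0.
have rC i j : r (i, j) = r (j, i).
  have [->//|ij] := eqVneq i j; apply: sval_inj.
  rewrite rE //= rE /= 1?eq_sym // -reflN; by rewrite /vecA /= opprB.
exists (fun i j => r (i, j)); split=> //.
- move=> v _; have [a [i [j [ij ->]]] vE] := svalP v.
  by exists i, j; split; [exact/eqP | apply: sval_inj; rewrite rE //; exact/eqP].
- move=> i j k l ij kl /(congr1 sval); rewrite !rE // => /refl_eq_dot.
  move=> /(_ (vecA_neq0 ij)); rewrite !dot_vecA !eqxx !(eq_sym j i) !(eq_sym l k).
  rewrite (negbTE ij) (negbTE kl).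
  have [] := pair_coincidences ij kl.
  case: eqVneq => [->|_]; case: eqVneq => [->|_] //=;
  case: eqVneq => [->|_]; case: eqVneq => [->|_] //=; by [left | right].
- move=> i j k l ij kl; rewrite adjE // dot_vecA.
  by have [] := pair_coincidences ij kl; do 4!case: (_ == _).
Qed.

End WeylA.

Lemma kneser_local_chart (V : eqType) (E : rel V) (T T' : eqType)
    (r : T -> T -> V) (s : T' -> T) a b :
  kneser_chart predT E r -> a != b -> injective s ->
  (forall i, s i != a) -> (forall i, s i != b) ->
  (forall c, c != a -> c != b -> exists i, c = s i) ->
  kneser_chart (E (r a b)) E (fun i j => r (s i) (s j)).
Proof.
move=> [_ rS rC rI rE] ab sI sa sb sS; have sE := inj_eq sI.
split=> [i j ij|v abv|i j|i j k l ij kl|i j k l ij kl].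
- by rewrite rE ?sE // !(eq_sym _ (s _)) !sa !sb.
- have [k [l [kl vE]]] := rS v isT; move: abv; rewrite vE rE //.
  rewrite !(eq_sym _ k) !(eq_sym _ l) => /and4P[ka la kb lb].
  have [i kE] := sS k ka kb; have [j lE] := sS l la lb.
  by exists i, j; rewrite -sE -kE -lE.
- exact: rC.
- by case/rI; rewrite ?sE // => -[/sI-> /sI->]; by [left | right].
- by rewrite rE ?sE.
Qed.

Section Shift2.

Variable m : nat.

Definition pt0 : 'I_m.+2 := @lshift 2 m ord0.
Definition pt1 : 'I_m.+2 := @lshift 2 m ord_max.
Definition shift2 (i : 'I_m) : 'I_m.+2 := @rshift 2 m i.

Lemma pt01 : pt0 != pt1. Proof. by []. Qed.

Lemma shift2_inj : injective shift2. Proof. by move=> i j; exact: (@rshift_inj 2 m). Qed.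

Lemma shift2_pt0 i : shift2 i != pt0. Proof. by []. Qed.

Lemma shift2_pt1 i : shift2 i != pt1. Proof. by []. Qed.

Lemma shift2P c : c != pt0 -> c != pt1 -> exists i, c = shift2 i.
Proof.
move=> c0 c1; have c2 : 1 < c.
  by case: c c0 c1 => -[|[|c]] //= ? c0 c1; move: c0 c1; rewrite -!val_eqE.
have cm : c - 2 < m by have := ltn_ord c; lia.
by exists (Ordinal cm); apply: val_inj => /=; lia.
Qed.

End Shift2.

Lemma kneser_connected (V : eqType) (E : rel V) (Es : symmetric E)
    (Ei : irreflexive E) (T : finType) (r : T -> T -> V) :
  5 < #|T| -> kneser_chart predT E r -> connected (relgraph Es Ei).
Proof.
move=> cT [_ rS rC rI rE].
have [i _] : exists i : T, i \notin [::] by apply: fresh; exact: leq_trans cT.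
split; first exact: inhabits (r i i).
move=> u v; have [a [b [ab ->]]] := rS u isT; have [c [d [cd ->]]] := rS v isT.
have [k] : exists k : T, k \notin [:: a; b; c; d].
  by apply: fresh; exact: leq_trans cT.
have [l] : exists l : T, l \notin [:: a; b; c; d; k] by exact: fresh.
rewrite !inE !negb_or => /and5P[la lb lc ld lk] /and4P[ka kb kc kd].
have kl : k != l by rewrite eq_sym.
apply: (@Relation_Operators.rt_trans _ _ _ (r k l));
  apply: Relation_Operators.rt_step => /=; rewrite rE //.
  by rewrite !(eq_sym a) !(eq_sym b) ka la kb lb.
by rewrite kc kd lc ld.
Qed.

Lemma kneser_local_all (V : eqType) (E : rel V) m (r : 'I_m.+2 -> 'I_m.+2 -> V) :
  kneser_chart predT E r ->
  forall x, exists p : 'I_m -> 'I_m -> V, kneser_chart (E x) E p.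
Proof.
move=> cr x; have [_ rS _ _ _] := cr; have [a [b [ab ->]]] := rS x isT.
(* a permutation that takes [pt0] to [a] and [pt1] to [b] *)
pose t := tperm (pt0 m) a; pose s := (tperm (pt1 m) (t b) * t)%g.
have s0 : s (pt0 m) = a.
  rewrite permM tpermD ?tpermL // eq_sym.
  apply: contra ab => /eqP tb.
  by rewrite -(tpermK (pt0 m) a b) -/t -tb tpermL.
have s1 : s (pt1 m) = b by rewrite permM tpermL tpermK.
have h := kneser_local_chart (kneser_perm s cr) (pt01 m) (@shift2_inj m)
  (@shift2_pt0 m) (@shift2_pt1 m) (@shift2P m).
by rewrite s0 s1 in h; eexists; exact: h.
Qed.

Lemma kneser_iso (V V' : eqType) (E : rel V) (E' : rel V')
    (Es : symmetric E) (Ei : irreflexive E)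
    (Es' : symmetric E') (Ei' : irreflexive E') (T : eqType) (r : T -> T -> V') :
  graph_iso (relgraph Es Ei) (relgraph Es' Ei') -> kneser_chart predT E' r ->
  exists r' : T -> T -> V, kneser_chart predT E r'.
Proof.
case=> f [[g fK gK] fE] [rP rS rC rI rE].
have EE u v : E (g u) (g v) = E' u v.
  by have [h1 h2] := fE (g u) (g v); rewrite !gK in h1 h2; apply/idP/idP.
exists (fun i j => g (r i j)); split=> //.
- by move=> v _; have [i [j [ij vE]]] := rS (f v) isT; exists i, j; rewrite -vE fK.
- by move=> i j; rewrite rC.
- by move=> i j k l ij kl /(can_inj gK); exact: rI.
- by move=> i j k l ij kl; rewrite EE rE.
Qed.

Lemma same_local_kneser (G H : graph) m (r : 'I_m.+2 -> 'I_m.+2 -> {classic H}) :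
  kneser_chart predT (@adjb H) r -> same_local G H ->
  forall x : {classic G}, exists p : 'I_m -> 'I_m -> {classic G},
    kneser_chart (@adjb G x) (@adjb G) p.
Proof.
move=> cr loc x.
have loc' := iso_local (classic_iso G) (classic_iso H) loc.
have [p cp] := chart_of_iso (loc' x (r (pt0 m) (pt1 m))).
exists (fun i j => p (r (shift2 i) (shift2 j))); apply: kneser_comp cp _.
apply: kneser_local_chart cr _ _ _ _ _.
- exact: pt01.
- exact: shift2_inj.
- exact: shift2_pt0.
- exact: shift2_pt1.
- exact: shift2P.
Qed.

Lemma A_iso n (G : graph) : 8 <= n -> connected G ->
  same_local G (weyl_graph (A_ n)) -> graph_iso G (weyl_graph (A_ n)).
Proof.
case: n => // n n8 conn loc; have [r cr] := weylA_chart n.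
set W := weyl_graph (A_ n.+1) in loc *.
apply: graph_iso_trans (classic_iso G) _.
apply: graph_iso_trans _ (graph_iso_sym (classic_iso W)).
apply: (@locally_kneser_iso 'I_n).
- by rewrite card_ord.
- exact: same_local_kneser cr loc.
- exact: kneser_local_all cr.
- exact: connected_iso (classic_iso G) conn.
- by apply: kneser_connected cr; rewrite card_ord; lia.
Qed.

(** * Type D *)

Definition same_pair (T : eqType) (i j k l : T) : bool :=
  ((i == k) && (j == l)) || ((i == l) && (j == k)).

Definition disj_pair (T : eqType) (i j k l : T) : bool :=
  [&& i != k, i != l, j != k & j != l].

Lemma disj_same (T : eqType) (i j k l : T) : disj_pair i j k l ->
  same_pair i j k l = false.
Proof.
rewrite /disj_pair /same_pair => /and4P[/negbTE-> /negbTE->].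
by [].
Qed.

(** The vertices over a Kneser graph with every vertex doubled: [q i j false] and
    [q i j true] are adjacent and have the same other neighbours. *)
Definition double_pairs (V : eqType) (E : rel V) (T : eqType)
    (q : T -> T -> bool -> V) : Prop :=
  [/\ forall i j b, q i j b = q j i b,
      forall i j b k l c, i != j -> k != l -> q i j b = q k l c ->
        b = c /\ same_pair i j k l
    & forall i j b k l c, i != j -> k != l -> E (q i j b) (q k l c) =
        disj_pair i j k l || same_pair i j k l && (b != c)].

Definition double_chart (V : eqType) (E : rel V) (T : eqType)
    (q : T -> T -> bool -> V) : Prop :=
  double_pairs E q /\ forall v, exists i j b, i != j /\ v = q i j b.

(** [t] is adjacent to all other neighbours of [x], which are doubled pairs. *)
Definition double_local (V : eqType) (E : rel V) (T : eqType) (x t : V)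
    (q : T -> T -> bool -> V) : Prop :=
  [/\ double_pairs E q, E x t, forall i j b, i != j -> E x (q i j b),
      forall i j b, i != j -> E t (q i j b)
    & forall v, E x v -> v = t \/ exists i j b, i != j /\ v = q i j b].

Lemma double_iso (V V' : eqType) (E : rel V) (E' : rel V')
    (Es : symmetric E) (Ei : irreflexive E)
    (Es' : symmetric E') (Ei' : irreflexive E') (T : eqType)
    (q : T -> T -> bool -> V) (q' : T -> T -> bool -> V') :
  double_chart E q -> double_chart E' q' ->
  graph_iso (relgraph Es Ei) (relgraph Es' Ei').
Proof.
move=> [[qC qI qE] qS] [[qC' qI' qE'] qS'].
have sameP i j k l : same_pair i j k l -> (i = k /\ j = l) \/ (i = l /\ j = k).
  by case/orP=> /andP[/eqP-> /eqP->]; [left | right].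
apply: (@graph_iso_rel (relgraph Es Ei) (relgraph Es' Ei') (fun v v' => exists i j b,
  [/\ i != j, v = q i j b & v' = q' i j b])).
- by move=> v; have [i [j [b [ij vE]]]] := qS v; exists (q' i j b), i, j, b.
- by move=> v; have [i [j [b [ij vE]]]] := qS' v; exists (q i j b), i, j, b.
- move=> _ _ _ _ [i [j [b [ij -> ->]]]] [k [l [c [kl -> ->]]]]; split.
    by case/qI => // -> /sameP[[-> ->]|[-> ->]].
  by case/qI' => // -> /sameP[[-> ->]|[-> ->]].
- move=> _ _ _ _ [i [j [b [ij -> ->]]]] [k [l [c [kl -> ->]]]] /=.
  by rewrite qE // qE'.
Qed.

Section WeylD.

Variable n : nat.
Local Open Scope ring_scope.

Let W := {classic reflection (@rootsD n.+2)}.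
Let adjW := @adjb (weyl_graph (D_ n.+2)).

Let vecD (x : 'I_n.+2 * 'I_n.+2 * bool) : 'rV[rat]_n.+2 :=
  e x.1.1 + (-1) ^+ (~~ x.2) *: e x.1.2.

Lemma dot_vecD i j b k l c : dot (vecD (i, j, b)) (vecD (k, l, c)) =
  (i == k)%:R + (-1) ^+ (~~ c) * (i == l)%:R + (-1) ^+ (~~ b) * (j == k)%:R
  + (-1) ^+ (~~ b) * (-1) ^+ (~~ c) * (j == l)%:R.
Proof.
by rewrite /vecD /= !dotDl !dotDr !dotZl !dotZr !dot_e; ring.
Qed.

Lemma vecD_neq0 i j b : i != j -> vecD (i, j, b) != 0.
Proof.
move=> ij; rewrite -dot_eq0 dot_vecD !eqxx (eq_sym j) (negbTE ij).
by case: b.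
Qed.

Lemma weylD_chart : exists r : 'I_n.+2 -> 'I_n.+2 -> bool -> W, double_chart adjW r.
Proof.
have D0 : (ord0 : 'I_n.+2) != ord_max by [].
have vP x : x.1.1 != x.1.2 -> @rootsD n.+2 (vecD x).
  move=> h; exists x.1.1, x.1.2, false, (~~ x.2); split; first exact/eqP.
  by rewrite /vecD scale1r.
have [r rE] := @refl_index _ (@rootsD n.+2) _
  (fun x => x.1.1 != x.1.2) vecD (ord0, ord_max, false) D0 vP.
have adjE i j b k l c : i != j -> k != l -> adjW (r (i, j, b)) (r (k, l, c)) =
    (dot (vecD (i, j, b)) (vecD (k, l, c)) == 0).
  by move=> ij kl; apply: weyl_adjb; rewrite ?rE ?vecD_neq0.
have rC i j b : r (i, j, b) = r (j, i, b).
  have [->//|ij] := eqVneq i j; apply: sval_inj.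
  rewrite rE //= rE /= 1?eq_sym // /vecD /=; case: b => /=.
    by rewrite scale1r scale1r addrC.
  by rewrite expr1 !scaleN1r -[RHS]reflN opprB.
exists (fun i j b => r (i, j, b)); split; first split=> //.
- move=> i j b k l c ij kl /(congr1 sval); rewrite !rE // => /refl_eq_dot.
  move=> /(_ (vecD_neq0 b ij)); rewrite !dot_vecD !eqxx !(eq_sym j i) !(eq_sym l k).
  rewrite (negbTE ij) (negbTE kl) /same_pair.
  have [] := pair_coincidences ij kl => h1 h2 h3 h4 /eqP; move: h1 h2 h3 h4.
  move: (i == k) (i == l) (j == k) (j == l) => [] [] [] [] //= _ _ _ _;
    by case: b; case: c; vm_compute.
- move=> i j b k l c ij kl; rewrite adjE // dot_vecD /disj_pair /same_pair.
  have [] := pair_coincidences ij kl.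
  by move: (i == k) (i == l) (j == k) (j == l) => [] [] [] [] //=;
    case: b; case: c.
move=> v; have [a [i [j [s [t [ij ->]]]]] vE] := svalP v.
exists i, j, (~~ (s (+) t)); split; first exact/eqP.
apply: sval_inj; rewrite rE /=; last exact/eqP.
rewrite vE /vecD /= negbK -(@reflZ _ ((-1) ^+ s) (_ + _)) ?signr_eq0 //.
by rewrite scalerDr scalerA -signr_addb addbA addbb.
Qed.

End WeylD.

(** ** The quotient by twins *)

Section Twins.

Variables (T : finType) (V : choiceType) (E : rel V).
Hypotheses (Es : symmetric E) (Ei : irreflexive E).
Hypothesis cT : 4 < #|T|.
Hypothesis loc : forall x, exists t (q : T -> T -> bool -> V), double_local E x t q.

Definition twin x t := E x t /\ forall v, E x v -> v != t -> E t v.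

Let fresh4 a b c d : exists t : T, [&& t != a, t != b, t != c & t != d].
Proof.
have [t] := @fresh T [:: a; b; c; d] cT.
by rewrite !inE !negb_or; exists t.
Qed.

Lemma double_local_twin x t (q : T -> T -> bool -> V) :
  double_local E x t q -> twin x t.
Proof.
case=> _ xt _ tq xS; split=> // v /xS[->|[i [j [b [ij ->]]]] _]; first by rewrite eqxx.
exact: tq.
Qed.

Lemma twin_uniq x t t' : twin x t -> twin x t' -> t = t'.
Proof.
have [t0 [q [[qC qI qE] xt xq tq xS]]] := loc x.
suff h s : twin x s -> s = t0 by move=> /h-> /h->.
case=> xs su; case: (xS s xs) => // -[i [j [b [ij sE]]]].
have [k /and4P[ki kj _ _]] := fresh4 i j i j.
have ik : i != k by rewrite eq_sym.
have nsame : same_pair i k i j = false.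
  by rewrite /same_pair eqxx (negbTE kj) (negbTE ij).
have : E s (q i k false) = false.
  by rewrite sE qE // /disj_pair /same_pair eqxx (eq_sym j k) (negbTE kj) (negbTE ik).
rewrite su //; first exact: xq.
by apply/eqP; rewrite sE => /qI[] //; rewrite nsame.
Qed.

Lemma twin_sym x t : twin x t -> twin t x.
Proof.
move=> [xt tu]; have [t2 [q loct]] := loc t; have tt2 := double_local_twin loct.
have [[qC qI qE] _ tq t2q tS] := loct.
have [xE|[k [l [b [kl xE]]]]] := tS x ltac:(by rewrite Es).
  by rewrite xE.
have xt2 : twin x t2.
  split; first by rewrite xE Es t2q.
  move=> v xv vt2; have [->|vt] := eqVneq v t; first by rewrite Es; case: tt2.
  by case: (tS v (tu v xv vt)) vt2 => [->|[i [j [c [ij ->]]]]]; rewrite ?eqxx // t2q.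
have := proj1 tt2; rewrite -(twin_uniq xt2 (conj xt tu)).
by rewrite (twin_uniq xt2 (conj xt tu)) Ei.
Qed.

Variable tw : V -> V.
Hypothesis twP : forall x, twin x (tw x).

Lemma twK : involutive tw.
Proof. by move=> x; apply: twin_uniq (twP _) (twin_sym (twP x)). Qed.

Lemma adj_tw x : E x (tw x).
Proof. by case: (twP x). Qed.

Lemma twin_neq x : tw x != x.
Proof. by rewrite eq_sym (adj_neq Ei (adj_tw x)). Qed.

Lemma twin_adj x v : v != x -> v != tw x -> E (tw x) v = E x v.
Proof.
move=> vx vtx; apply/idP/idP => [tv|xv]; last by case: (twP x) => _; apply.
by case: (twP (tw x)) => _ /(_ v tv); rewrite twK; apply.
Qed.

Lemma twin_pair x t (q : T -> T -> bool -> V) i j b : double_local E x t q ->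
  i != j -> tw (q i j b) = q i j (~~ b).
Proof.
move=> locx ij; have xE := twin_uniq (double_local_twin locx) (twP x); subst t.
have [[qC qI qE] _ xq tq xS] := locx.
set v := q i j b; set s := tw v.
have sx : s != x.
  apply/eqP => sx; have := tq i j b ij; rewrite -/v -[v]twK -/s sx.
  by rewrite Ei.
have xv : E x v by exact: xq.
have Esx : E s x by rewrite twin_adj ?(adj_neq Ei xv) // 1?eq_sym // Es.
case: (xS s) => [|st|[k [l [c [kl sE]]]]]; first by rewrite Es.
  by have := xq i j b ij; rewrite -/v -[v]twK -/s st twK Ei.
have vs : E v s by exact: adj_tw.
move: vs; rewrite sE qE // => /orP[dis|/andP[sm bc]]; last first.
  have -> : c = ~~ b by case: b c bc {v s sx xv Esx sE} => [] [].
  by case/orP: sm => /andP[/eqP-> /eqP->] //; rewrite qC.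
have [r /and4P[ri rj rk rl]] := fresh4 i j k l.
have kr : k != r by rewrite eq_sym.
have disr : disj_pair i j k r.
  move: dis; rewrite /disj_pair => /and4P[-> _ -> _] /=.
  by rewrite !(eq_sym _ r) ri rj.
have : E s (q k r false) = false.
  rewrite sE qE // /disj_pair /same_pair eqxx (eq_sym l r) (negbTE rl).
  by rewrite /= (eq_sym l k) (negbTE kl) andbF.
have nv : q k r false != v.
  apply/eqP => /esym/qI[] // _; by rewrite disj_same.
have ns : q k r false != s.
  apply/eqP; rewrite sE => /qI[] // _; rewrite /same_pair eqxx (negbTE rl).
  by rewrite (negbTE kl).
by rewrite twin_adj // qE // disr.
Qed.

Let cls x := [pred v | (v == x) || (v == tw x)].

Let cls_ex x : exists v, cls x v.
Proof. by exists x; rewrite /= eqxx. Qed.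

(** A choice of one vertex in each pair of twins. *)
Definition rep x := xchoose (cls_ex x).

Lemma repP x : rep x = x \/ rep x = tw x.
Proof. by have /orP[/eqP|/eqP] := xchooseP (cls_ex x); [left | right]. Qed.

Lemma rep_tw x : rep (tw x) = rep x.
Proof. by apply: eq_xchoose => v /=; rewrite twK orbC. Qed.

Lemma rep_rep x : rep (rep x) = rep x.
Proof. by case: (repP x) => h; rewrite [in LHS]h ?rep_tw. Qed.

Lemma rep_eq x y : rep x = rep y -> y = x \/ y = tw x.
Proof.
case: (repP x) => ->; case: (repP y) => -> h.
- by left.
- by right; rewrite h twK.
- by right.
- by left; rewrite -[y]twK -h twK.
Qed.

Lemma rep_adj u v : v != u -> v != tw u -> E (rep u) (rep v) = E u v.
Proof.
move=> vu vtu; have uv : u != v by rewrite eq_sym.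
have tuv : u != tw v by apply: contraNneq vtu => ->; rewrite twK.
have h w : v != w -> v != tw w -> E w (rep v) = E w v.
  move=> vw vtw; case: (repP v) => -> //; rewrite Es twin_adj 1?Es // 1?eq_sym //.
  by apply: contraNneq vtw => <-; rewrite twK.
by case: (repP u) => ->; rewrite h ?twK // twin_adj.
Qed.

Definition quot := {v : V | rep v == v}.

Definition qadj (u v : quot) := E (val u) (val v).

Lemma qadj_sym : symmetric qadj. Proof. by move=> u v; exact: Es. Qed.

Lemma qadj_irr : irreflexive qadj. Proof. by move=> u; exact: Ei. Qed.

Definition qcls (v : V) : quot := exist _ (rep v) (introT eqP (rep_rep v)).

Lemma qcls_val u : qcls (val u) = u.
Proof. by apply: val_inj; apply/eqP/(valP u). Qed.

(** The quotient identifies [t] with [x], and the two members of each doubled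
    pair. *)
Lemma quot_chart (u : quot) :
  exists p : T -> T -> quot, kneser_chart (qadj u) qadj p.
Proof.
have [t [q locu]] := loc (val u).
have tE := twin_uniq (double_local_twin locu) (twP (val u)).
have [[qC qI qE] _ uq tq uS] := locu.
have repu : rep (val u) = val u by apply/eqP/(valP u).
have qpair i j k l : i != j -> k != l -> qcls (q i j false) = qcls (q k l false) ->
    same_pair i j k l.
  move=> ij kl /(congr1 val) /= /rep_eq[].
    by case/qI => // _; rewrite /same_pair !(eq_sym k) !(eq_sym l) [in X in _ -> _ || X]andbC.
  rewrite (twin_pair _ locu) //= => /qI[] //.
have qadjE i j k l : i != j -> k != l ->
    qadj (qcls (q i j false)) (qcls (q k l false)) = disj_pair i j k l.
  move=> ij kl; have [sm|nsm] := boolP (same_pair i j k l).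
    have [[ki lj]|[kj li]] : (k = i /\ l = j) \/ (k = j /\ l = i).
      by case/orP: sm => /andP[/eqP-> /eqP->]; [left | right].
    - by subst; rewrite qadj_irr /disj_pair eqxx.
    - by subst; rewrite qC qadj_irr /disj_pair eqxx andbF.
  rewrite /qadj /= rep_adj ?qE // ?(negbTE nsm) ?orbF //.
    by apply/eqP => /esym/qI[] // _; rewrite (negbTE nsm).
  by rewrite (twin_pair _ locu) //; apply/eqP => /esym/qI[] //.
exists (fun i j => qcls (q i j false)); split.
- move=> i j ij; rewrite /qadj /= -repu rep_adj; first exact: uq.
    by rewrite eq_sym (adj_neq Ei (uq _ _ _ ij)).
  by rewrite -tE eq_sym (adj_neq Ei (tq _ _ _ ij)).
- move=> v uv; case: (uS _ uv) => [vt|[i [j [b [ij vE]]]]].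
    have := adj_neq Ei uv; have /eqP <- := valP v.
    by rewrite vt tE rep_tw repu eqxx.
  exists i, j; split=> //; rewrite -[v]qcls_val vE; apply: val_inj => /=.
  by case: b vE => // _; rewrite -(rep_tw (q i j true)) (twin_pair _ locu).
- by move=> i j; rewrite qC.
- move=> i j k l ij kl /(qpair _ _ _ _ ij kl) /orP[]/andP[/eqP-> /eqP->].
    by left.
  by right.
- exact: qadjE.
Qed.

Lemma quot_connected : connected (relgraph Es Ei) -> connected (relgraph qadj_sym qadj_irr).
Proof.
move=> conn; have [[x0] _] := conn; split; first exact: inhabits (qcls x0).
move=> u v; rewrite -(qcls_val v).
apply: (connected_ind (G := relgraph Es Ei) (x0 := val u) conn
  (P := fun w => Relation_Operators.clos_refl_trans _ _ u (qcls w))).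
  by rewrite qcls_val; exact: Relation_Operators.rt_refl.
move=> x y ux xy; have [yx|yx] := eqVneq y (tw x).
  suff -> : qcls y = qcls x by [].
  by apply: val_inj; rewrite /= yx rep_tw.
apply: Relation_Operators.rt_trans ux _; apply: Relation_Operators.rt_step.
by rewrite /= /qadj /= rep_adj // eq_sym (adj_neq Ei xy).
Qed.

Lemma quot_double (S : eqType) (r : S -> S -> quot) :
  kneser_chart predT qadj r ->
  double_chart E (fun i j b => if b then tw (val (r i j)) else val (r i j)).
Proof.
move=> [_ rS rC rI rE].
have vrep (u : quot) : rep (val u) = val u by apply/eqP/(valP u).
have notw (u v : quot) : val u != tw (val v).
  apply/eqP => uv; have := twin_neq (val v); rewrite -uv.
  by rewrite -(vrep u) uv rep_tw vrep eqxx.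
have pairP i j k l : i != j -> k != l -> reflect (r i j = r k l) (same_pair i j k l).
  move=> ij kl; apply: (iffP idP) => [/orP[]/andP[/eqP-> /eqP->] //|].
  by case/(rI _ _ _ _ ij kl) => [[-> ->]|[-> ->]]; rewrite /same_pair !eqxx ?orbT.
split; first split.
- by move=> i j b; rewrite rC.
- move=> i j b k l c ij kl h.
  have bc : b = c.
    by case: b c h => -[] // /eqP h; [have := notw (r k l) (r i j) |
      have := notw (r i j) (r k l)]; rewrite ?h // eq_sym h.
  split=> //; apply/pairP => //; apply: val_inj; subst c.
  by case: b h => // /(can_inj twK).
- move=> i j b k l c ij kl; have [sm|nsm] := boolP (same_pair i j k l).
    have -> : disj_pair i j k l = false.
      by apply/negbTE/negP => /disj_same; rewrite sm.
    have /pairP -> // := sm.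
    by case: b c => -[]; rewrite ?Ei // ?adj_tw // Es adj_tw.
  have uv : val (r k l) != val (r i j).
    by rewrite val_eqE eq_sym; apply: contra nsm => /eqP/(pairP _ _ _ _ ij kl).
  have vu : val (r i j) != val (r k l) by rewrite eq_sym.
  have uE : E (val (r i j)) (val (r k l)) = disj_pair i j k l by rewrite -/(qadj _ _) rE.
  rewrite orbF -uE; case: b c => -[] //.
  + by rewrite twin_adj ?(inj_eq (can_inj twK)) // 1?eq_sym // Es twin_adj // Es.
  + by rewrite twin_adj.
  + by rewrite Es twin_adj // Es.
move=> v; have [i [j [ij vE]]] := rS (qcls v) isT.
exists i, j; have := congr1 val vE => /= repE; case: (repP v) => rv.
  by exists false; rewrite -repE rv.
by exists true; rewrite -repE rv twK.
Qed.

Lemma quot_bool : same_card (quot * bool) V.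
Proof.
exists (fun ub => if ub.2 then tw (val ub.1) else val ub.1).
exists (fun v => (qcls v, rep v != v)) => [[u b]|v] /=.
  have repu : rep (val u) = val u by apply/eqP/(valP u).
  case: b; rewrite ?qcls_val ?rep_tw repu ?eqxx //.
  rewrite eq_sym twin_neq; congr (_, _); apply: val_inj.
  by rewrite /= rep_tw repu.
by case: eqVneq => //= nv; case: (repP v) nv => ->; rewrite ?eqxx // twK.
Qed.

End Twins.

Lemma same_card_sym (T U : Type) : same_card T U -> same_card U T.
Proof. by case=> f [g fK gK]; exists g, f. Qed.

Lemma same_card_trans (T U S : Type) :
  same_card T U -> same_card U S -> same_card T S.
Proof. by case=> f bf [g bg]; exists (g \o f); exact: bij_comp. Qed.

Lemma injection_card (K : Type) (T : finType) (g : K -> T) :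
  injective g -> exists N, same_card K 'I_N.
Proof.
move=> gI; pose A := [pred t | `[< exists k, g k = t >]].
have gA k : A (g k) by apply/asboolP; exists k.
pose f k : {t | A t} := exist _ (g k) (gA k).
have fS (u : {t | A t}) : exists k, f k = u.
  have /asboolP[k gk] := valP u.
  by exists k; apply: val_inj.
have [h hK] := choice fS; exists #|{: {t | A t}}|; exists (enum_rank \o f).
apply: bij_comp; first exact: enum_rank_bij.
exists h => [k|u]; last exact: hK.
by apply: gI; have /(congr1 val) := hK (f k).
Qed.

Lemma same_card_half (X Y : Type) (T : finType) (g : Y -> T) :
  injective g -> same_card (X * bool) (Y * bool) -> same_card X Y.
Proof.
move=> gI XY; have [N YN] := injection_card gI.
have dbl (A B : Type) : same_card A B -> same_card (A * bool) (B * bool).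
  case=> f [h fK hK]; exists (fun x => (f x.1, x.2)).
  by exists (fun x => (h x.1, x.2)) => -[x b] /=; rewrite ?fK ?hK.
have [f bf] := same_card_trans XY (dbl _ _ YN).
have fI : injective (fun x => f (x, false)).
  by move=> x y /(bij_inj bf) [].
have [M XM] := injection_card fI.
have [h bh] : same_card ('I_M * bool) ('I_N * bool).
  apply: same_card_trans (same_card_sym (dbl _ _ XM)) _.
  by exists f.
have := bij_eq_card bh; rewrite !card_prod !card_ord card_bool => /eqP.
rewrite eqn_pmul2r // => /eqP MN; subst M.
exact: same_card_trans XM (same_card_sym YN).
Qed.

Lemma double_kneser_card (V W : eqType) (E : rel V) (F : rel W) (S : finType)
    (r : S -> S -> V) (q : S -> S -> bool -> W) :
  kneser_chart predT E r -> double_chart F q -> same_card (V * bool) W.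
Proof.
move=> [_ rS rC rI _] [[qC qI _] qS].
have /choice[f fP] : forall u : V * bool, exists w : W, exists i j,
    [/\ i != j, u.1 = r i j & w = q i j u.2].
  by move=> [u b]; have [i [j [ij uE]]] := rS u isT; exists (q i j b), i, j.
have /choice[g gP] : forall w, exists u, f u = w.
  move=> w; have [i [j [b [ij ->]]]] := qS w; exists (r i j, b).
  have [k [l [kl /= rE ->]]] := fP (r i j, b).
  by case: (rI _ _ _ _ ij kl rE) => [[-> ->]|[-> ->]].
exists f, g => // -[u b]; have := gP (f (u, b)).
move: (g _) => [u' b']; have [i [j [ij /= -> ->]]] := fP (u, b).
have [k [l [kl /= -> ->]]] := fP (u', b').
case/qI => // -> /orP[]/andP[/eqP-> /eqP->] //.
by rewrite rC.
Qed.

Lemma double_local_chart (V : eqType) (E : rel V) (T T' : eqType)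
    (r : T -> T -> bool -> V) (s : T' -> T) a b :
  double_chart E r -> a != b -> injective s ->
  (forall i, s i != a) -> (forall i, s i != b) ->
  (forall c, c != a -> c != b -> exists i, c = s i) ->
  double_local E (r a b false) (r a b true) (fun i j => r (s i) (s j)).
Proof.
move=> [[rC rI rE] rS] ab sI sa sb sS; have sE := inj_eq sI.
have dis i j : disj_pair a b (s i) (s j).
  by rewrite /disj_pair !(eq_sym _ (s _)) !sa !sb.
split; [split|..].
- by move=> i j c; rewrite rC.
- move=> i j c k l d ij kl /rI; rewrite !sE => /(_ ij kl) [-> ].
  by rewrite /same_pair !sE.
- by move=> i j c k l d ij kl; rewrite rE ?sE // /disj_pair /same_pair !sE.
- by rewrite rE // /same_pair !eqxx orbT.
- by move=> i j c ij; rewrite rE ?sE // dis.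
- by move=> i j c ij; rewrite rE ?sE // dis.
move=> v; have [k [l [c [kl ->]]]] := rS v; rewrite rE // => /orP[|].
  rewrite /disj_pair !(eq_sym _ k) !(eq_sym _ l) => /and4P[ka la kb lb].
  have [i kE] := sS k ka kb; have [j lE] := sS l la lb.
  by right; exists i, j, c; rewrite -sE -kE -lE.
case: c; rewrite ?andbF // => /andP[/orP[]/andP[/eqP-> /eqP->] _]; left=> //.
Qed.

Lemma double_local_comp (V W : eqType) (E : rel V) (F : rel W) (T : eqType)
    (x : V) (y t : W) (p : W -> V) (q : T -> T -> bool -> W) :
  local_chart E x (F y) F p -> double_local F y t q ->
  double_local E x (p t) (fun i j b => p (q i j b)).
Proof.
move=> [pD pS pI pE] [[qC qI qE] yt yq tq yS]; split; [split|..].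
- by move=> i j b; rewrite qC.
- by move=> i j b k l c ij kl /pI h; apply: qI => //; apply: h; exact: yq.
- by move=> i j b k l c ij kl; rewrite pE ?qE //; exact: yq.
- exact: pD.
- by move=> i j b ij; apply/pD/yq.
- by move=> i j b ij; rewrite pE ?tq //; exact: yq.
move=> v /pS[w /yS[->|[i [j [b [ij ->]]]]] ->]; first by left.
by right; exists i, j, b.
Qed.

Lemma kneser_same_local (V V' : eqType) (E : rel V) (E' : rel V')
    (Es : symmetric E) (Ei : irreflexive E)
    (Es' : symmetric E') (Ei' : irreflexive E') (T : eqType) :
  (forall x, exists p : T -> T -> V, kneser_chart (E x) E p) ->
  (forall x, exists p : T -> T -> V', kneser_chart (E' x) E' p) ->
  same_local (relgraph Es Ei) (relgraph Es' Ei').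
Proof.
move=> ch ch' x y; have [p [pP pS pC pI pE]] := ch x.
have [q [qP qS qC qI qE]] := ch' y.
apply: (@graph_iso_rel (local_graph x) (local_graph y) (fun u v =>
  exists i j, [/\ i != j, sval u = p i j & sval v = q i j])).
- move=> u; have [i [j [ij uE]]] := pS _ (svalP u).
  by exists (exist _ (q i j) (qP i j ij)), i, j.
- move=> v; have [i [j [ij vE]]] := qS _ (svalP v).
  by exists (exist _ (p i j) (pP i j ij)), i, j.
- move=> u u' v v' [i [j [ij uE vE]]] [k [l [kl uE' vE']]].
  split=> [/(congr1 sval)|/(congr1 sval)].
    rewrite uE uE' => /(pI _ _ _ _ ij kl) h; apply: sval_inj; rewrite vE vE'.
    by case: h => [[-> ->]|[-> ->]].
  rewrite vE vE' => /(qI _ _ _ _ ij kl) h; apply: sval_inj; rewrite uE uE'.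
  by case: h => [[-> ->]|[-> ->]].
- move=> u u' v v' [i [j [ij uE vE]]] [k [l [kl uE' vE']]] /=.
  by rewrite uE uE' vE vE' pE // qE.
Qed.

(** A graph locally like the Weyl graph of type D is the double of its quotient by
    twins, which is locally like the Weyl graph of type A. *)
Lemma D_iso_of_A n (G : graph) : 5 <= n ->
  same_local G (weyl_graph (D_ n.+2)) ->
  (forall H : graph, same_local H (weyl_graph (A_ n.+1)) ->
     (connected G -> connected H) ->
     (same_card G (weyl_graph (D_ n.+2)) -> same_card H (weyl_graph (A_ n.+1))) ->
     graph_iso H (weyl_graph (A_ n.+1))) ->
  graph_iso G (weyl_graph (D_ n.+2)).
Proof.
move=> n5 loc isoA; have [r cr] := weylA_chart n; have [q cq] := weylD_chart n.
have cT : 4 < #|'I_n| by rewrite card_ord.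
have Es := @adjb_sym G; have Ei := @adjb_irr G.
have locG (x : {classic G}) : exists t (q : 'I_n -> 'I_n -> bool -> {classic G}),
    double_local (@adjb G) x t q.
  have loc' := iso_local (classic_iso G) (classic_iso _) loc.
  have [p cp] := chart_of_iso (loc' x (q (pt0 n) (pt1 n) false)).
  have cl := double_local_chart cq (pt01 n) (@shift2_inj n) (@shift2_pt0 n)
    (@shift2_pt1 n) (@shift2P n).
  by exists (p (q (pt0 n) (pt1 n) true)); eexists; exact: double_local_comp cp cl.
have /choice[tw twP] : forall x : {classic G}, exists t, twin (@adjb G) x t.
  by move=> x; have [t [q0 locx]] := locG x; exists t; exact: double_local_twin locx.
pose WA := weyl_graph (A_ n.+1).
pose H := relgraph (qadj_sym Es (tw := tw)) (qadj_irr Ei (tw := tw)).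
have locH : same_local H WA.
  apply: (iso_local (graph_iso_refl _) (graph_iso_sym (classic_iso WA))).
  apply: kneser_same_local; first exact: (quot_chart Es Ei cT locG twP).
  exact: (kneser_local_all cr).
have [] := isoA H locH.
- by move=> conn; exact: (quot_connected cT locG twP (connected_iso (classic_iso G) conn)).
- move=> [f bf]; have /choice[g gP] : forall v : {classic WA}, exists ij : 'I_n.+2 * 'I_n.+2,
      v = r ij.1 ij.2.
    by move=> v; have [_ rS _ _ _] := cr; have [i [j [_ ->]]] := rS v isT; exists (i, j).
  apply: (same_card_half (g := g)); first by move=> u v uv; rewrite (gP u) uv -gP.
  apply: same_card_trans (quot_bool Es Ei cT locG twP) _.
  apply: same_card_trans (ex_intro _ f bf) _.
  exact/same_card_sym/(double_kneser_card cr cq).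
move=> f fP; have HW : graph_iso H WA by exists f.
have [r' cr'] := kneser_iso (graph_iso_trans HW (classic_iso WA)) cr.
apply: graph_iso_trans (classic_iso G) _.
apply: graph_iso_trans _ (graph_iso_sym (classic_iso _)).
exact: double_iso (quot_double Es Ei cT locG twP cr') cq.
Qed.

Lemma D_iso n (G : graph) : 9 <= n -> connected G ->
  same_local G (weyl_graph (D_ n)) -> graph_iso G (weyl_graph (D_ n)).
Proof.
case: n => [|[|n]] // n9 conn loc; apply: D_iso_of_A => //; first by lia.
by move=> H locH connH _; apply: A_iso; [lia | exact: connH |].
Qed.

(** * Type E7 *)

(** A check that the vertices of the table come in pairs of twins and that,
    modulo twins, they form a generalized quadrangle with three points on a
    line. *)
Definition quadrangle_ok_rows d L (R : seq bitseq) : bool :=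
  let row := nth [::] R in let tn i := nth false (row i) in let t := tadj L in
  [&& alln d (fun u => has id (row u)),
      alln d (fun u => hasn d (fun v => if u == v then false else row u == row v)),
      alln d (fun u => alln d (fun v => if u == v then true else
        if row u == row v then alln d (fun w => if u == w then true else
          if row u == row w then v == w else true) else true)),
      alln d (fun u => alln d (fun v => if t u v then
        if all3b (fun a b _ => if a then true else ~~ b) (row u) (row v) (row u)
        then row u == row v else true else true))
    & alln d (fun i => alln d (fun j => if tn i j then
        hasn d (fun k => t i k && t k j) &&
        alln d (fun k => if t i k then if tn k j then
          if row k == row i then true else alln d (fun l =>
            if t i l then if t k l then if row l == row i then true else
              if row l == row k then true else t l j
            else true else true) else true else true) else true))].

Definition quadrangle_ok d L : bool :=
  let R := nrows d L in quadrangle_ok_rows d L R.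

Section Polar.

Variables (d : nat) (L : seq (seq bool)).

Notation tn := (nadj (tadj L)).
Notation row := (nth [::] (nrows d L)).

Lemma eq_rowP i j : i < d -> j < d ->
  reflect (forall k, k < d -> tn i k = tn j k) (row i == row j).
Proof.
move=> id jd; rewrite !nth_nrows //; apply: (iffP eqP) => [h k kd|h].
  by move/(congr1 (fun s => nth false s k)): h; rewrite !nth_mkseq.
apply: (eq_from_nth (x0 := false)); rewrite !size_mkseq // => k kd.
by rewrite !nth_mkseq // h.
Qed.

Hypothesis qok : quadrangle_ok d L.

Section OneGraph.

Variables (V : eqType) (E : rel V).
Hypotheses (Es : symmetric E) (Ei : irreflexive E).
Hypothesis charts : forall x, exists p, tchart d L E x p.

(** The third point of the line through [x] and [y]. *)
Definition third x y t : Prop :=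
  [/\ E x t, E y t & forall w, E x w -> E y w -> w != t -> E t w].

Lemma polar_no_cone : no_cone E.
Proof.
have /and5P[/allnP h _ _ _ _] := qok; move=> z v zv; have [p cp] := charts z.
have [pd ps _ _] := cp; have [i id ->] := ps v zv.
move: (h i id); rewrite nth_nrows // => /hasP[_ /mapP[j + ->] ij].
rewrite mem_iota /= => jd; exists (p j); first exact: pd.
by rewrite (chart_nadj cp).
Qed.

Lemma third_chart x p i j : tchart d L E x p -> i < d -> j < d ->
  third x (p i) (p j) <-> i != j /\ row i == row j.
Proof.
move=> cp id jd; have [pd ps pI pE] := cp.
have /and5P[_ _ _ /allnP h _] := qok.
have tC a b : a < d -> b < d -> tn a b = tn b a.
  by move=> ad bd; rewrite -!(chart_nadj cp) // nadjC.
split=> [[_ ij all]|[nij /eq_rowP rij]].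
  have nij : i != j by apply: contraTneq ij => ->; rewrite Ei.
  split=> //; move: (h i id) => /allnP/(_ j jd); rewrite -pE // ij.
  case: ifP => // /negP[]; rewrite !nth_nrows //; apply/all3bP => k kd.
  case ik: (tn i k) => //; rewrite tC // -(chart_nadj cp) //.
  have [->|nkj] := eqVneq k j; first by rewrite nadjxx.
  have [->|nki] := eqVneq k i; first by rewrite adj_nadjF.
  have Eik : E (p i) (p k).
    rewrite pE //; move: ik; rewrite /nadj eq_sym nki /= => /negbFE.
    by [].
  rewrite nadjC // adj_nadjF //; apply: all => //; first exact: pd.
  by apply: contra nkj => /eqP/pI ->.
split; first exact: pd.
  rewrite (adj_nadj Ei) (chart_nadj cp) // rij // nadjxx andbT.
  by apply: contra nij => /eqP/pI ->.
move=> w /ps[k kd ->] ik kj; rewrite (adj_nadj Ei) eq_sym kj (chart_nadj cp) //.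
by rewrite -rij // -(chart_nadj cp) // adj_nadjF.
Qed.

Lemma thirdC x y t : E x y -> third x y t -> third y x t.
Proof. by move=> xy [xt yt all]; split=> // w yw xw; apply: all. Qed.

Lemma third_swap x y t : E x y -> third x y t -> third x t y.
Proof.
move=> xy xyt; have [p cp] := charts x; have [_ ps _ _] := cp.
have [xt _ _] := xyt; have [i id yi] := ps y xy; have [j jd tj] := ps t xt.
move: xyt; rewrite yi tj => /(third_chart cp id jd) [ij rij].
by apply/(third_chart cp jd id); rewrite eq_sym ij eq_sym.
Qed.

Lemma third_uniq x y t t' : E x y -> third x y t -> third x y t' -> t = t'.
Proof.
have /and5P[_ _ /allnP h _ _] := qok.
move=> xy xyt xyt'; have [p cp] := charts x; have [_ ps _ _] := cp.
have [i id yi] := ps y xy; have [xt _ _] := xyt; have [xt' _ _] := xyt'.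
have [j jd tj] := ps t xt; have [k kd tk] := ps t' xt'.
move: xyt xyt'; rewrite yi tj tk => /(third_chart cp id jd) [ij rij].
move=> /(third_chart cp id kd) [ik rik].
move: (h i id) => /allnP/(_ j jd); rewrite (negbTE ij) rij => /allnP/(_ k kd).
by rewrite (negbTE ik) rik => /eqP ->.
Qed.

Lemma third_ex x y : E x y -> exists t, third x y t.
Proof.
have /and5P[_ /allnP h _ _ _] := qok.
move=> xy; have [p cp] := charts x; have [_ ps _ _] := cp.
have [i id ->] := ps y xy; have /hasnP[j jd] := h i id.
case: eqVneq => // ij rij; exists (p j); exact/(third_chart cp id jd).
Qed.

Lemma third_nadj x y t w : E x y -> third x y t -> E x w -> nadj E t w = nadj E y w.
Proof.
move=> xy xyt xw; have [p cp] := charts x; have [_ ps _ _] := cp.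
have [i id yi] := ps y xy; have [xt _ _] := xyt; have [j jd tj] := ps t xt.
have [k kd ->] := ps w xw; move: xyt; rewrite yi tj.
move=> /(third_chart cp id jd) [_ /eq_rowP rij].
by rewrite !(chart_nadj cp) // rij.
Qed.

Lemma third_at_most_one x y a t : nadj E x y -> E x a -> third x a t ->
  E y a -> E y t -> False.
Proof.
move=> xy xa xat ya yt; have [xt at' _] := xat.
have tax : third a t x.
  by apply: third_swap; [rewrite Es | apply: thirdC].
have [_ _ /(_ y)] := tax; rewrite !(Es _ y) ya yt => /(_ isT isT).
by rewrite eq_sym (nadj_neq xy) Es (nadj_adjF xy) => /(_ isT).
Qed.

(** Buekenhout-Shult: if [a] is adjacent to [x] and [y], then [y] is adjacent to
    a point other than [x] of each line through [x] in the neighbourhood of [a]. *)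
Lemma third_step x y a b t : nadj E x y -> E x a -> E a y -> E x b -> E a b ->
  third x b t -> E y b \/ E y t.
Proof.
have /and5P[_ _ _ _ /allnP h] := qok.
move=> xy xa ay xb ab xbt; have [xt bt tall] := xbt.
have [yb|nyb] := boolP (E y b); [by left | right].
have [<-|nat] := eqVneq a t; first by rewrite Es.
have ax : E a x by rewrite Es.
have ta : E t a by apply: tall; rewrite // Es.
have [q cq] := charts a; have [qd qs _ qE] := cq.
have [i id xi] := qs x ax; have [j jd yj] := qs y ay.
have [k kd bk] := qs b ab; have [l ld tl] := qs t ltac:(by rewrite Es).
move: (h i id) => /allnP/(_ j jd); rewrite nth_nrows // nth_mkseq //.
rewrite -(chart_nadj cq) // -xi -yj xy => /andP[_ /allnP/(_ k kd)].
rewrite nth_nrows // nth_mkseq // -(chart_nadj cq) // -qE // -bk -xi -yj xb.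
have -> : nadj E b y.
  rewrite nadjC // /nadj nyb andbT; apply: contraTneq xb => <-.
  by rewrite (nadj_adjF xy).
rewrite -!nth_nrows //; have [rki|_] := boolP (row k == row i).
  have axb : third a x b.
    rewrite xi bk; apply/(third_chart cq id kd); split; last by rewrite eq_sym.
    by apply: contraTneq xb => ik; rewrite xi bk ik Ei.
  have := third_swap xa (thirdC ax axb) => /(third_uniq xb)/(_ xbt) at'.
  by rewrite at' eqxx in nat.
move=> /allnP/(_ l ld); rewrite -!qE // -xi -bk -tl -yj xt bt.
have [rli|_] := boolP (row l == row i).
  have lxt : third a x t.
    rewrite xi tl; apply/(third_chart cq id ld); split; last by rewrite eq_sym.
    by apply: contraTneq xt => il; rewrite xi tl il Ei.
  have := third_swap xb xbt; have := third_swap xa (thirdC ax lxt).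
  by move=> /(third_uniq xt) h1 /h1 ba; rewrite -ba Ei in ab.
have [rlk|_] := boolP (row l == row k).
  have lbt : third a b t.
    rewrite bk tl; apply/(third_chart cq kd ld); split; last by rewrite eq_sym.
    by apply: contraTneq bt => il; rewrite bk tl il Ei.
  have ba : E b a by rewrite Es.
  have bx : E b x by rewrite Es.
  have := third_swap ba (thirdC ab lbt); have := third_swap bx (thirdC xb xbt).
  by move=> /(third_uniq bt) h1 /h1 xa'; rewrite xa' Ei in xa.
by rewrite Es.
Qed.

Definition meets x y := exists z, E x z /\ E z y.

Lemma one_or_all x y b t : nadj E x y -> meets x y -> E x b -> third x b t ->
  E y t = ~~ E y b.
Proof.
have /and5P[_ _ _ _ /allnP h] := qok.
move=> xy [z [xz zy]] xb xbt.
have one : E y b \/ E y t.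
  have [bz|nbz] := eqVneq b z; first by left; rewrite bz Es.
  have [zb|nzb] := boolP (E z b); first exact: (third_step xy xz zy xb zb xbt).
  have [p cp] := charts x; have [pd ps _ pE] := cp.
  have [i id zi] := ps z xz; have [j jd bj] := ps b xb.
  move: (h i id) => /allnP/(_ j jd); rewrite nth_nrows // nth_mkseq //.
  rewrite -(chart_nadj cp) // -zi -bj /nadj eq_sym nbz nzb /=.
  move=> /andP[/hasnP[k kd /andP[ik kj]] _].
  have zk : E z (p k) by rewrite zi pE.
  have kb : E (p k) b by rewrite bj pE.
  have [t' xkt] := third_ex (pd k kd); have [xt' kt' _] := xkt.
  case: (third_step xy xz zy (pd k kd) zk xkt) => [yk|yt'].
    by apply: (third_step xy (pd k kd) _ xb kb xbt); rewrite Es.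
  have [->|nbt'] := eqVneq b t'; first by left.
  apply: (third_step xy xt' _ xb _ xbt); first by rewrite Es.
  rewrite (adj_nadj Ei) eq_sym nbt' (third_nadj (pd k kd) xkt) //.
  by rewrite adj_nadjF.
have two := third_at_most_one xy xb xbt.
case: one => h1; first by rewrite h1; apply/negP => /(two h1).
by rewrite h1; apply/esym/negP => yb; exact: two yb h1.
Qed.

Hypothesis conn : connected (relgraph Es Ei).

Lemma polar_meets x y : nadj E x y -> meets x y.
Proof.
pose Q (v : V) := [\/ v = x, E x v | meets x v].
have QQ : forall v, Q v.
  apply: (connected_ind (G := relgraph Es Ei) (x0 := x) conn); first exact: Or31.
  move=> u w; rewrite /Q => Qu uw.
  have [wx|nwx] := eqVneq w x; first exact: Or31.
  have [xw|nxw] := boolP (E x w); first exact: Or32.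
  apply: Or33; have [ux|nux] := eqVneq u x; first by rewrite -ux uw in nxw.
  have [xu|nxu] := boolP (E x u); first by exists u.
  case: Qu => [ux|xu|[z [xz zu]]]; first by rewrite ux eqxx in nux.
    by rewrite xu in nxu.
  have ux : nadj E u x by rewrite /nadj nux Es.
  have [t uwt] := third_ex uw; have [_ wt _] := uwt.
  exists t; split; last by rewrite Es.
  have -> := one_or_all ux _ uw uwt; first exact: nxw.
  by exists z; rewrite Es zu Es.
case: (QQ y) => [->|xy|//]; first by rewrite nadjxx.
by rewrite /nadj xy andbF.
Qed.

Lemma third_row_sum x y t : E x y -> third x y t -> row_sum E t x y.
Proof.
move=> xy xyt w; have [xt yt _] := xyt.
have [<-|nxw] := eqVneq x w.
  by rewrite nadjxx !adj_nadjF // Es.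
have [xw|nxw'] := boolP (E x w).
  by rewrite (adj_nadjF xw) (third_nadj xy).
have xw : nadj E x w by rewrite /nadj nxw.
have neq v : E x v -> v != w by move=> xv; apply: contraTneq xv => ->; exact: nxw'.
rewrite xw !adjF_nadj ?neq // !(Es _ w) (one_or_all xw (polar_meets xw) xy xyt).
by [].
Qed.

Lemma polar_sum_closed : sum_closed E false.
Proof.
move=> a b ab nab; have Eab : E a b by rewrite (adj_nadj Ei) ab nab.
by have [t abt] := third_ex Eab; exists t; exact: third_row_sum.
Qed.

(** A vertex that is adjacent neither to [x] nor to [y] lies on a line joining a
    neighbour of [x] to one of [y], or has the same common neighbours with [x] as
    [y] has; any line through a vertex of the second kind contains one of the
    first. *)
Lemma polar_generated x y : nadj E x y ->
  forall v, generated E false (fun a => [\/ a = x, a = y | E x a && E y a]) v.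
Proof.
move=> xy; set S := fun a => _.
have yx : nadj E y x by rewrite nadjC.
have sum a b t : E a b -> third a b t -> generated E false S a ->
    generated E false S b -> generated E false S t.
  move=> ab abt ga gb; apply: (GenSum ga gb).
  - exact: adj_neq ab.
  - exact: adj_nadjF.
  - exact: third_row_sum.
have gx0 : generated E false S x by apply: GenBase; exact: Or31.
have gy0 : generated E false S y by apply: GenBase; exact: Or32.
have gM a : E x a -> E y a -> generated E false S a.
  by move=> xa ya; apply: GenBase; apply: Or33; rewrite xa.
have gx a : E x a -> generated E false S a.
  move=> xa; have [ya|nya] := boolP (E y a); first exact: gM.
  have [t xat] := third_ex xa; have [xt _ _] := xat.
  apply: (sum x t) => //; first exact: third_swap.
  by apply: gM => //; rewrite (one_or_all xy (polar_meets xy) xa xat).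
have gy a : E y a -> generated E false S a.
  move=> ya; have [xa|nxa] := boolP (E x a); first exact: gM.
  have [t yat] := third_ex ya; have [yt _ _] := yat.
  apply: (sum y t) => //; first exact: third_swap.
  by apply: gM => //; rewrite (one_or_all yx (polar_meets yx) ya yat).
have far w : nadj E x w -> nadj E y w ->
    generated E false S w \/ forall a, E x a -> E y a -> E w a.
  move=> xw yw; have wx : nadj E w x by rewrite nadjC.
  have wy : nadj E w y by rewrite nadjC.
  have [[s [t [xs ws wst yt]]]|none] :=
      EM (exists s t, [/\ E x s, E w s, third w s t & E y t]).
    left; have sw : E s w by rewrite Es.
    have [wt st _] := wst.
    apply: (sum s t) => //; [|exact: gx|exact: gy].
    exact: third_swap sw (thirdC ws wst).
  right=> a xa ya; apply/negPn/negP => nwa.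
  have [t xat] := third_ex xa; have [xt _ _] := xat.
  have wt : E w t by rewrite (one_or_all xw (polar_meets xw) xa xat).
  apply: (third_at_most_one xy xa xat ya).
  have [u wtu] := third_ex wt; apply/negPn/negP => nyt; apply: none.
  exists t, u; split=> //.
  by rewrite (one_or_all wy (polar_meets wy) wt wtu).
move=> v; have [->//|nvx] := eqVneq v x; have [->//|nvy] := eqVneq v y.
have [xv|nxv] := boolP (E x v); first exact: gx.
have [yv|nyv] := boolP (E y v); first exact: gy.
have xv : nadj E x v by rewrite /nadj eq_sym nvx.
have yv : nadj E y v by rewrite /nadj eq_sym nvy.
case: (far v xv yv) => // all.
have [m [xm my]] := polar_meets xy; have ym : E y m by rewrite Es.
have vm := all m xm ym; have [t vmt] := third_ex vm; have [vt mt _] := vmt.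
have tE := third_row_sum vm vmt.
(* a common neighbour of x and y that is not adjacent to m *)
have [n [xn yn mn]] : exists n, [/\ E x n, E y n & nadj E m n].
  have [c xc mc] := polar_no_cone xm.
  have [yc|nyc] := boolP (E y c); first by exists c.
  have [c' xcc'] := third_ex xc; have [xc' _ _] := xcc'.
  exists c'; rewrite xc' (one_or_all xy (polar_meets xy) xc xcc') nyc; split=> //.
  by rewrite nadjC // (third_nadj xc) // nadjC.
have xt : nadj E x t.
  by rewrite nadjC // tE nadjC // xv nadjC // adj_nadjF.
have yt : nadj E y t.
  by rewrite nadjC // tE nadjC // yv nadjC // adj_nadjF.
case: (far t xt yt) => [gt|/(_ n xn yn)].
  have mv : E m v by rewrite Es.
  apply: (sum m t) => //; last exact: gx.
  exact: third_swap mv (thirdC vm vmt).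
rewrite (adj_nadj Ei) tE mn (adj_nadjF (all n xn yn)).
by rewrite andbF.
Qed.

End OneGraph.

(** Generators [x], [y] and their common neighbours. A neighbour of [x] on one
    side is matched with the point of the corresponding line on the other side
    that is adjacent to the second generator. *)
Lemma polar_iso (V V' : eqType) (E : rel V) (E' : rel V')
    (Es : symmetric E) (Ei : irreflexive E)
    (Es' : symmetric E') (Ei' : irreflexive E') :
  (forall x, exists p, tchart d L E x p) ->
  (forall x, exists p, tchart d L E' x p) ->
  connected (relgraph Es Ei) -> connected (relgraph Es' Ei') ->
  (exists x y, nadj E x y) -> (exists x y, nadj E' x y) ->
  graph_iso (relgraph Es Ei) (relgraph Es' Ei').
Proof.
move=> ch ch' conn conn' [x [y xy]] [x' [y' xy']].
have [p cp] := ch x; have [p' cp'] := ch' x'.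
have [pd ps _ _] := cp; have [pd' ps' _ _] := cp'.
pose R0 a a' := [\/ a = x /\ a' = x', a = y /\ a' = y'
  | exists i j, [/\ i < d, j < d, row i == row j &
      [/\ a = p i, a' = p' j, E y a & E' y' a']]].
have yx : nadj E y x by rewrite nadjC.
have yx' : nadj E' y' x' by rewrite nadjC.
apply: (@iso_of_generators _ _ _ _ Es Ei Es' Ei' false R0).
- exact: reduced_of_no_cone Ei (polar_no_cone ch).
- exact: reduced_of_no_cone Ei' (polar_no_cone ch').
- exact: polar_sum_closed.
- exact: polar_sum_closed.
- move=> a a' b b'.
  case=> [[-> ->]|[-> ->]|[i [j [id jd /eq_rowP rij [-> -> yi yj]]]]];
  case=> [[-> ->]|[-> ->]|[k [l [kd ld /eq_rowP rkl [-> -> yk yl]]]]].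
  + by rewrite !nadjxx.
  + by rewrite xy xy'.
  + by rewrite !adj_nadjF ?pd ?pd'.
  + by rewrite yx yx'.
  + by rewrite !nadjxx.
  + by rewrite !adj_nadjF.
  + by rewrite nadjC // [RHS]nadjC // !adj_nadjF ?pd ?pd'.
  + by rewrite nadjC // [RHS]nadjC // !adj_nadjF.
  + rewrite (chart_nadj cp) // rij // -(chart_nadj cp) // nadjC //.
    rewrite (chart_nadj cp) // rkl // [RHS]nadjC // (chart_nadj cp') //.
- move=> v; elim: (polar_generated ch conn xy v) => {v} [s Ss|a b s _ ga _ gb ab eab sE].
    apply: GenBase; case: Ss => [->|->|/andP[/ps[i id ->] yi]].
    + by exists x'; apply: Or31.
    + by exists y'; apply: Or32.
    have [yi'|nyi'] := boolP (E' y' (p' i)).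
      by exists (p' i); apply: Or33; exists i, i; rewrite eqxx.
    have [t it] := third_ex Es' Ei' ch' (pd' i id); have [xt _ _] := it.
    have [j jd tj] := ps' t xt; subst t.
    have [_ rij] := (proj1 (third_chart Es' Ei' cp' id jd)) it.
    exists (p' j); apply: Or33; exists i, j; split=> //; split=> //.
    by rewrite (one_or_all Es' Ei' ch' xy' (polar_meets ch' conn' xy') (pd' i id) it).
  exact: GenSum ga gb ab eab sE.
- move=> v; elim: (polar_generated ch' conn' xy' v) => {v} [s Ss|a b s _ ga _ gb ab eab sE].
    apply: GenBase; case: Ss => [->|->|/andP[/ps'[i id ->] yi]].
    + by exists x; apply: Or31.
    + by exists y; apply: Or32.
    have [yi'|nyi'] := boolP (E y (p i)).
      by exists (p i); apply: Or33; exists i, i; rewrite eqxx.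
    have [t it] := third_ex Es Ei ch (pd i id); have [xt _ _] := it.
    have [j jd tj] := ps t xt; subst t.
    have [_ rij] := (proj1 (third_chart Es Ei cp id jd)) it.
    exists (p j); apply: Or33; exists j, i; split=> //; first by rewrite eq_sym.
    split=> //.
    by rewrite (one_or_all Es Ei ch xy (polar_meets ch conn xy) (pd i id) it).
  exact: GenSum ga gb ab eab sE.
Qed.

End Polar.

Definition diameter2 RL : bool := let n := size RL in
  all (fun i => (i == 0) || adjl RL 0 i ||
    has (fun k => adjl RL 0 k && adjl RL k i) (iota 0 n)) (iota 0 n).

Lemma diameter2_connected RL N (E : rel 'I_N.+1) (Es : symmetric E)
    (Ei : irreflexive E) :
  (forall i j, E i j = adjl RL i j) -> size RL = N.+1 -> diameter2 RL ->
  connected (relgraph Es Ei).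
Proof.
move=> EE sRL /allP diam; split; first exact: inhabits ord0.
pose path := Relation_Operators.clos_refl_trans _ (@adj (relgraph Es Ei)).
have step x y : E x y -> path x y by exact: Relation_Operators.rt_step.
have p0 i : path ord0 i.
  have := diam (val i); rewrite mem_iota sRL add0n => /(_ (ltn_ord i)).
  case/orP=> [/orP[/eqP i0|a0i]|/hasP[k]].
  - by rewrite (_ : i = ord0); [exact: Relation_Operators.rt_refl | exact: val_inj].
  - by apply: step; rewrite EE.
  rewrite mem_iota add0n => /= kN /andP[a0k aki].
  apply: (@Relation_Operators.rt_trans _ _ _ (Ordinal kN)); apply: step;
    by rewrite EE.
have pC x y : path x y -> path y x.
  elim=> {x y} [x y xy|x|x y z _ yx _ zy].
  - by apply: step; rewrite Es.
  - exact: Relation_Operators.rt_refl.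
  - exact: Relation_Operators.rt_trans zy yx.
by move=> x y; apply: Relation_Operators.rt_trans (pC _ _ (p0 x)) (p0 y).
Qed.

Lemma E7_iso (G : graph) : connected G ->
  same_local G (weyl_graph E_7) -> graph_iso G (weyl_graph E_7).
Proof.
move=> conn loc; pose L := local_table rootlE7.
have rok : root_list_ok 8 rootlE7 by vm_compute.
have sRL : size rootlE7 = 63 by vm_compute.
have sD : size (nbrs0 rootlE7) = 30 by vm_compute.
have qok : quadrangle_ok 30 L by vm_compute.
have diam : diameter2 rootlE7 by vm_compute.
have [E [Es [Ei [EE WE ch' chG]]]] :=
  weyl_charts rok sRL sD rootlE7_represents loc (proj1 conn).
have ch := chG _ _ _ _ (classic_iso G).
have far (V : eqType) (F : rel V) (x : V) :
    (forall x, exists p, tchart 30 L F x p) -> exists x y, nadj F x y.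
  move=> chF; have [p cp] := chF x; have [pd _ _ _] := cp.
  have [t _ pt] := polar_no_cone qok chF (pd 0 isT).
  by exists (p 0), t.
have [[g] _] := conn.
apply: graph_iso_trans (classic_iso G) (graph_iso_trans _ WE).
apply: (polar_iso qok ch ch').
- exact: connected_iso (classic_iso G) conn.
- exact: diameter2_connected EE sRL diam.
- exact: (far _ _ (g : {classic G}) ch).
- exact: (far _ _ ord0 ch').
Qed.

(** * Types B and C *)

Definition badj (T : eqType) (i j k l : T) : bool :=
  [&& i != k, i != l, j != k & j != l] || [&& i != j, i == l & j == k].

(** The vertices [q i j]: they are of the kind [K] when [i = j]. *)
Definition bpairs (V : eqType) (E : rel V) (K : pred V) (T : eqType)
    (D : pred T) (q : T -> T -> V) : Prop :=
  [/\ forall i j k l, D i -> D j -> D k -> D l -> q i j = q k l -> i = k /\ j = l,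
      forall i j k l, D i -> D j -> D k -> D l -> E (q i j) (q k l) = badj i j k l
    & forall i j, D i -> D j -> K (q i j) = (i == j)].

Definition bchart (V : eqType) (P : pred V) (E : rel V) (K : pred V) (T : eqType)
    (D : pred T) (q : T -> T -> V) : Prop :=
  [/\ bpairs E K D q, forall i j, D i -> D j -> P (q i j)
    & forall v, P v -> exists i j, [/\ D i, D j & v = q i j]].

(** The local graph at a vertex [x] not of the kind [K]: the vertex [t] is
    adjacent to all others. *)
Definition blocal (V : eqType) (E : rel V) (K : pred V) (T : eqType) (x t : V)
    (q : T -> T -> V) : Prop :=
  [/\ bpairs E K predT q, E x t /\ ~~ K t, forall i j, E x (q i j),
      forall i j, E t (q i j)
    & forall v, E x v -> v = t \/ exists i j, v = q i j].

Section LocallyB.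

Variables (m : nat) (V : eqType) (E : rel V) (K : pred V).
Hypotheses (Es : symmetric E) (Ei : irreflexive E).
Hypothesis m13 : m = 1 \/ 2 < m.
Hypothesis locK : forall x, K x ->
  exists p : 'I_m.+1 -> 'I_m.+1 -> V, bchart (E x) E K predT p.
Hypothesis locN : forall x, ~~ K x ->
  exists t (p : 'I_m -> 'I_m -> V), blocal E K x t p.

Let fresh_m k l : 2 < m -> exists s : 'I_m, (s != k) && (s != l).
Proof.
move=> m3; have [s] : exists s : 'I_m, s \notin [:: k; l].
  by apply: fresh; rewrite card_ord.
by rewrite !inE negb_or; exists s.
Qed.

(** In a local chart the vertices of the kind [K] are on the diagonal. *)
Lemma kind_clique u a b : E u a -> E u b -> K a -> K b -> a = b \/ E a b.
Proof.
have badj_diag (T : eqType) (i k : T) : i != k -> badj i i k k.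
  by move=> ik; rewrite /badj ik.
have [Ku|Ku] := boolP (K u).
  have [p [[pI pE pK] pP pS]] := locK Ku.
  move=> /pS[i [j [_ _ ->]]] /pS[k [l [_ _ ->]]]; rewrite !pK // => /eqP-> /eqP->.
  have [->|jl] := eqVneq j l; [by left | right].
  by rewrite pE // badj_diag.
have [t [p [[pI pE pK] [xt nKt] xp tp xS]]] := locN Ku.
move=> /xS[->|[i [j ->]]] /xS[->|[k [l ->]]]; rewrite ?(negbTE nKt) // !pK //.
move=> /eqP-> /eqP->; have [->|jl] := eqVneq j l; [by left | right].
by rewrite pE // badj_diag.
Qed.

Section Clique.

Variable c : 'I_m.+2 -> V.
Hypotheses (cI : injective c) (cK : forall i, K (c i)).
Hypothesis cE : forall i j, E (c i) (c j) = (i != j).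
Hypothesis cC : forall i v, K v -> E (c i) v -> exists j, v = c j.
Hypothesis conn : connected (relgraph Es Ei).

(** A neighbour [w] of [u] misses at most two of the members of the clique that are
    adjacent to [u]: these are on the diagonal of the chart at [u]. *)
Lemma clique_dominates w : (exists i, w = c i) \/ ~~ K w /\ exists i, E (c i) w.
Proof.
pose Q (v : V) := (exists i, v = c i) \/ ~~ K v /\ exists i, E (c i) v.
suff QQ : forall v, Q v by exact: QQ.
clear w.
apply: (connected_ind (G := relgraph Es Ei) (x0 := c ord0) conn).
  by left; exists ord0.
move=> u w Qu uw; rewrite /Q.
have Kin i : E u (c i) -> K w -> exists j, w = c j.
  move=> uc Kw; case: (kind_clique uc uw (cK i) Kw) => [<-|]; first by exists i.
  exact: cC.
case: Qu => [[i ui]|[nKu [i ciu]]].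
  have [Kw|nKw] := boolP (K w).
    by left; apply: (cC (i := i)) => //; rewrite -ui.
  by right; split=> //; exists i; rewrite -ui.
have uci : E u (c i) by rewrite Es.
have [Kw|nKw] := boolP (K w); first by left; exact: Kin uci Kw.
right; split=> //; have [t [p [[pI pE pK] [ut nKt] up tp uS]]] := locN nKu.
have [wt|[k [l wE]]] := uS w uw.
  exists i; have [ct|[k [l ->]]] := uS _ uci; last by rewrite wt Es.
  by have := cK i; rewrite ct (negbTE nKt).
have kl : k != l by move: nKw; rewrite wE pK.
have [m1|m3] := m13.
  by case/eqP: kl; apply: val_inj => /=; have := ltn_ord k; have := ltn_ord l; lia.
have [s /andP[sk sl]] := fresh_m k l m3.
have Ks : K (p s s) by rewrite pK.
have [j sE] : exists j, p s s = c j.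
  case: (kind_clique uci (up s s) (cK i) Ks) => [<-|]; first by exists i.
  exact: cC.
by exists j; rewrite -sE wE pE // /badj sk sl.
Qed.

(** The chart at a member of the clique, labelled so that the clique is the
    diagonal. *)
Lemma clique_chart i : exists p : 'I_m.+2 -> 'I_m.+2 -> V,
  bchart (E (c i)) E K (fun k => k != i) p /\ forall k, k != i -> p k k = c k.
Proof.
have [p [[pI pE pK] pP pS]] := locK (cK i).
have /choice[s sP] : forall k, exists j, k != i -> c k = p j j.
  move=> k; have [ki|ki] := boolP (k != i); last by exists ord0.
  have [a [b [_ _ ab]]] := pS (c k) ltac:(by rewrite cE eq_sym).
  exists b => _; rewrite ab; have := cK k; rewrite ab pK // => /eqP->.
  by [].
have sI k l : k != i -> l != i -> s k = s l -> k = l.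
  by move=> ki li kl; apply: cI; rewrite !sP // kl.
have sS j : exists2 k, k != i & j = s k.
  have [k ck] := cC (i := i) (v := p j j) ltac:(by rewrite pK) (pP j j isT isT).
  have ki : k != i by rewrite eq_sym -cE -ck pP.
  exists k => //; move: ck; rewrite sP // => /pI[] //.
have seq k l : k != i -> l != i -> (s k == s l) = (k == l).
  by move=> ki li; apply/eqP/eqP => [/sI->|->].
exists (fun k l => p (s k) (s l)); split; last by move=> k ki; rewrite -sP.
split; first split.
- by move=> a b k l ai bi ki li /pI[] // /sI -> // /sI ->.
- by move=> a b k l ai bi ki li; rewrite pE // /badj !seq.
- by move=> a b ai bi; rewrite pK // seq.
- by move=> a b _ _; exact: pP.
move=> v /pS[a [b [_ _ ->]]]; have [k ki ->] := sS a; have [l li ->] := sS b.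
by exists k, l.
Qed.

(** The members of the clique that are not adjacent to [w] are the two indices
    of [w] in the chart at [c i]. *)
Lemma clique_support i w : ~~ K w -> E (c i) w ->
  exists k l, [/\ k != l, k != i, l != i & forall j, E (c j) w = (j != k) && (j != l)].
Proof.
move=> nKw ciw; have [p [[[pI pE pK] pP pS] pc]] := clique_chart i.
have [k [l [ki li wE]]] := pS w ciw; have kl : k != l by move: nKw; rewrite wE pK.
exists k, l; split=> // j; have [->|ji] := eqVneq j i.
  by rewrite ciw !(eq_sym i) ki li.
rewrite -pc // wE pE // /badj eqxx /= orbF.
by case: (j != k); case: (j != l).
Qed.

Let other (k l : 'I_m.+2) : 'I_m.+2 := odflt k [pick i | (i != k) && (i != l)].

Let fresh2 (k l : 'I_m.+2) : exists s, (s != k) && (s != l).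
Proof.
have m0 : 2 < m.+2 by lia.
have [s] : exists s : 'I_m.+2, s \notin [:: k; l] by apply: fresh; rewrite card_ord.
by rewrite !inE negb_or; exists s.
Qed.

Lemma otherC k l : other k l = other l k.
Proof.
rewrite /other (eq_pick (Q := fun i => (i != l) && (i != k))).
  case: pickP => //= none; have [s] := fresh2 k l.
  by rewrite andbC; have /= -> := none s.
by move=> i /=; rewrite andbC.
Qed.

Lemma otherP k l : (other k l != k) && (other k l != l).
Proof.
rewrite /other; case: pickP => //= none; have [s] := fresh2 k l.
by have /= -> := none s.
Qed.

(** The two vertices with the support {k, l} are distinguished by the chart at
    the member [other k l] of the clique, which depends only on {k, l}. The chart
    at any other member names the two in the same or in the opposite order. As
    both change their names together, adjacency can be read off in the chart at
    any index outside the two supports. *)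
Lemma clique_bchart : exists q : 'I_m.+2 -> 'I_m.+2 -> V, bchart predT E K predT q.
Proof.
have /choice[P PP] := clique_chart.
pose q k l := P (other k l) k l.
have qkk k : q k k = c k.
  have /andP[ok _] := otherP k k; have [_ h] := PP (other k k).
  by apply: h; rewrite eq_sym.
have onb k l : E (c (other k l)) (q k l).
  have /andP[ok ol] := otherP k l; have [[_ pP _] _] := PP (other k l).
  by apply: pP; rewrite eq_sym.
have qK k l : K (q k l) = (k == l).
  have /andP[ok ol] := otherP k l; have [[[_ _ pK] _ _] _] := PP (other k l).
  by apply: pK; rewrite eq_sym.
have qsupp k l j : k != l -> E (c j) (q k l) = (j != k) && (j != l).
  move=> kl; have nK : ~~ K (q k l) by rewrite qK.
  have [a [b [ab ai bi supp]]] := clique_support nK (onb k l).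
  have /andP[ok ol] := otherP k l.
  have [[[pI pE pK] pP pS] pc] := PP (other k l).
  have [->|jo] := eqVneq j (other k l); first by rewrite onb ok ol.
  have [ko lo] : k != other k l /\ l != other k l by rewrite !(eq_sym _ (other k l)).
  rewrite -pc // pE // /badj eqxx /= orbF.
  by case: (j != k); case: (j != l).
have qneq k l : k != l -> q k l != q l k.
  move=> kl; rewrite /q (otherC l k); apply/eqP.
  have /andP[ok ol] := otherP k l; have [[[pI _ _] _ _] _] := PP (other k l).
  by move=> /pI; rewrite !(eq_sym _ (other k l)) => /(_ ok ol ol ok) [klE _]; rewrite klE eqxx in kl.
have suppI (a b k l : 'I_m.+2) : a != b -> k != l ->
    (forall j, (j != a) && (j != b) = (j != k) && (j != l)) ->
    (a = k /\ b = l) \/ (a = l /\ b = k).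
  move=> ab kl h; have := h a; have := h b; rewrite !eqxx !andbF.
  move=> /esym/negbT; rewrite negb_and !negbK => bE.
  move=> /esym/negbT; rewrite negb_and !negbK => aE.
  case/orP: aE => /eqP aE; case/orP: bE => /eqP bE; [|by left|by right|];
    by rewrite aE bE eqxx in ab.
have qP k l j : j != k -> j != l ->
    (q k l = P j k l /\ q l k = P j l k) \/ (q k l = P j l k /\ q l k = P j k l).
  move=> jk jl; have [[[pI pE pK] pP pS] pc] := PP j.
  have [->|kl] := eqVneq k l; first by left; rewrite qkk pc // eq_sym.
  have one a b : a != b -> j != a -> j != b -> q a b = P j a b \/ q a b = P j b a.
    move=> ab ja jb; have [a' [b' [ja' jb' qE]]] := pS (q a b) ltac:(by rewrite qsupp // ja jb).
    have ab' : a' != b' by rewrite -pK // -qE qK.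
    case: (@suppI a b a' b' ab ab') => [r|[aE bE]|[aE bE]];
      [|by left; rewrite qE aE bE|by right; rewrite qE aE bE].
    rewrite -qsupp // qE; have [->|rj] := eqVneq r j.
      by rewrite pP // !(eq_sym j) ja' jb'.
    rewrite -pc // pE // /badj eqxx /= orbF.
    by case: (r != a'); case: (r != b').
  have lk : l != k by rewrite eq_sym.
  have := qneq k l kl; case: (one k l kl jk jl) => -> ; case: (one l k lk jl jk) => ->.
  - by left.
  - by rewrite eqxx.
  - by rewrite eqxx.
  - by right.
have qS v : exists k l, v = q k l.
  case: (clique_dominates v) => [[i ->]|[nKv [i civ]]]; first by exists i, i; rewrite qkk.
  have [k [l [kl ki li supp]]] := clique_support nKv civ.
  have [[[pI pE pK] pP pS] pc] := PP i.
  have [a [b [ai bi vE]]] := pS v civ.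
  have ab : a != b by move: nKv; rewrite vE pK.
  have ia : i != a by rewrite eq_sym.
  have ib : i != b by rewrite eq_sym.
  by case: (qP a b i ia ib) => -[h1 h2]; [exists a, b | exists b, a]; rewrite vE.
have qI a b k l : q a b = q k l -> a = k /\ b = l.
  move=> h; have := qK a b; rewrite h qK.
  have [kl|kl] := eqVneq k l; have [ab|ab] := eqVneq a b => // _.
    by subst b l; move: h; rewrite !qkk => /cI ->.
  case: (@suppI a b k l ab kl) => [j|//|[aE bE]]; first by rewrite -!qsupp // h.
  by move: h; rewrite aE bE => /esym/eqP; rewrite (negbTE (qneq k l kl)).
suff qE a b k l : E (q a b) (q k l) = badj a b k l.
  exists q; split; [split|..] => //.
  - by move=> a b k l _ _ _ _; exact: qI.
  - by move=> v _; have [k [l ->]] := qS v; exists k, l.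
have [<-|ab] := eqVneq a b; have [<-|kl] := eqVneq k l.
- by rewrite !qkk cE /badj !eqxx; case: (a != k).
- by rewrite qkk qsupp // /badj eqxx orbF; case: (a != k); case: (a != l).
- rewrite qkk Es qsupp // /badj !(eq_sym k).
  have -> : [&& a != b, a == k & b == k] = false.
    by apply/negP => /and3P[_ /eqP ak /eqP bk]; rewrite ak bk eqxx in ab.
  by case: (a != k); case: (b != k).
have Et : E (q a b) (q b a).
  have ba : b != a by rewrite eq_sym.
  have /andP[oa ob] := otherP a b; have [[[_ oE _] _ _] _] := PP (other a b).
  have [ao bo] : a != other a b /\ b != other a b by rewrite !(eq_sym _ (other a b)).
  by case: (qP a b _ oa ob) => -[-> ->]; rewrite oE // /badj !eqxx ?ab ?ba orbT.
have [/andP[/eqP al /eqP bk]|swap] := boolP ((a == l) && (b == k)).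
  by rewrite -al -bk Et /badj ab !eqxx orbT.
have [/andP[/eqP ak /eqP bl]|nsame] := boolP ((a == k) && (b == l)).
  by rewrite -ak -bl Ei /badj eqxx (negbTE ab) andbF.
have [[s /and4P[sa sb sk sl]]|none] :=
    EM (exists s, [&& s != a, s != b, s != k & s != l]).
  have [[[pI pE pK] pP pS] pc] := PP s.
  have [as' bs] : a != s /\ b != s by rewrite !(eq_sym _ s).
  have [ks ls] : k != s /\ l != s by rewrite !(eq_sym _ s).
  move: swap nsame.
  by case: (qP a b s sa sb) => -[ab1 ab2]; case: (qP k l s sk sl) => -[kl1 kl2];
    rewrite ab1 kl1 pE // /badj 1?(eq_sym b a) ab /=;
    case: (a == k); case: (a == l); case: (b == k); case: (b == l).
(* [a], [b], [k], [l] are then all the indices, so m = 1, and a member of the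
   clique is the only neighbour of the kind [K] of [q a b] *)
have m1 : m = 1.
  case: m13 => // m3; case: none.
  have [s] : exists s : 'I_m.+2, s \notin [:: a; b; k; l] by apply: fresh; rewrite card_ord.
  by rewrite !inE !negb_or; exists s.
have nK i j : i != j -> ~~ K (q i j) by rewrite qK.
have [t [p [[pI pE pK] [ut nKt] up tp uS]]] := locN (nK a b ab).
have toT v : E (q a b) v -> ~~ K v -> v = t.
  move=> uv nKv; case: (uS v uv) => // -[i [j vE]].
  case/negP: nKv; rewrite vE pK // -val_eqE; apply/eqP => /=.
  by have := ltn_ord i; have := ltn_ord j; lia.
have ba : b != a by rewrite eq_sym.
have tE := toT _ Et (nK b a ba).
apply/idP/idP => [h|].
  have := toT _ h (nK k l kl); rewrite -tE => /qI[-> ->].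
  by rewrite /badj ab !eqxx orbT.
case/orP=> [dis|/and3P[_ al bk]]; last by rewrite al bk in swap.
(* four distinct indices do not fit into three *)
case/and4P: dis => ak al bk bl; exfalso.
have : uniq [:: a; b; k; l] by rewrite /= !inE !negb_or ab ak al bk bl kl.
move/card_uniqP => c4; have := max_card (mem [:: a; b; k; l]).
by rewrite c4 card_ord /=; lia.
Qed.

End Clique.

Lemma locally_B_chart : connected (relgraph Es Ei) ->
  exists q : 'I_m.+2 -> 'I_m.+2 -> V, bchart predT E K predT q.
Proof.
move=> conn; have [[v] _] := conn.
have [x0 K0] : exists x0, K x0.
  have [Kv|nKv] := boolP (K v); first by exists v.
  have m0 : 0 < m by lia.
  have [t [p [[_ _ pK] _ _ _ _]]] := locN nKv.
  by exists (p (Ordinal m0) (Ordinal m0)); rewrite pK // eqxx.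
have [p [[pI pE pK] pP pS]] := locK K0.
pose c i := if unlift ord0 i is Some j then p j j else x0.
have c0 : c ord0 = x0 by rewrite /c unlift_none.
have cl j : c (lift ord0 j) = p j j by rewrite /c liftK.
have cK i : K (c i).
  by case: (unliftP ord0 i) => [j|] ->; rewrite ?c0 ?cl // pK // eqxx.
have cE i j : E (c i) (c j) = (i != j).
  case: (unliftP ord0 i) => [i'|] ->; case: (unliftP ord0 j) => [j'|] ->; rewrite ?c0 ?cl.
  - rewrite pE // (inj_eq lift_inj) /badj !eqxx /=.
    by case: (i' != j').
  - by rewrite Es pP // eq_sym neq_lift.
  - by rewrite pP // neq_lift.
  - by rewrite Ei eqxx.
have cI : injective c.
  by move=> i j ij; apply/eqP; rewrite -[_ == _]negbK -cE ij Ei.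
have C0 w : K w -> E x0 w -> exists j, w = c j.
  move=> Kw /pS[i [j [_ _ wE]]]; move: Kw; rewrite wE pK // => /eqP ->.
  by exists (lift ord0 j); rewrite cl.
apply: (clique_bchart cI cK cE _ conn) => i w Kw ciw.
have [i0|ni0] := eqVneq i ord0; first by apply: C0; rewrite // -c0 -i0.
have cix : E (c i) x0 by rewrite -c0 cE.
case: (kind_clique cix ciw K0 Kw) => [<-|]; first by exists ord0.
exact: C0.
Qed.

End LocallyB.

(** ** Bichromatic charts *)

Definition kindb (G : bigraph) (c : bool) (v : {classic G}) : bool :=
  `[< short v >] == c.

Lemma kindb_short (G H : bigraph) c (v : {classic G}) (w : {classic H}) :
  kindb c v = kindb c w -> (short v <-> short w).
Proof.
rewrite /kindb => h; split=> s; apply/asboolP; move: h; rewrite (asboolT s).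
  by case: c; case: `[< _ >].
by case: c; case: `[< _ >].
Qed.

Lemma bi_chart_of_iso (G H : bigraph) (x : G) (y : H) :
  bigraph_iso (local_bigraph x) (local_bigraph y) ->
  exists p : {classic H} -> {classic G},
    local_chart (@adjb G) x (@adjb H y) (@adjb H) p /\
    forall d, @adjb H y d -> (short (p d) <-> short d).
Proof.
case/bigraph_iso_sym=> f [[g fK gK] fE fs].
pose p (d : {classic H}) : {classic G} := match pselect (adj y d) with
  | left yd => sval (f (exist _ d yd)) | right _ => x end.
have pE d (yd : adj y d) : p d = sval (f (exist _ d yd)).
  rewrite /p; case: pselect => // yd'; congr (sval (f _)).
  exact: sval_inj.
exists p; split; last first.
  by move=> d /asboolP yd; rewrite (pE d yd); have := fs (exist _ d yd) => /= ->.
split=> [d /asboolP yd|z /asboolP xz|d d' /asboolP yd /asboolP yd'|d d' /asboolP yd /asboolP yd'].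
- by rewrite (pE d yd); apply/asboolP; exact: svalP (f _).
- pose u : local_bigraph x := exist _ z xz.
  exists (sval (g u)); first by apply/asboolP; exact: svalP (g u).
  rewrite (pE _ (svalP (g u))) -[z]/(sval u) -[in LHS](gK u).
  by congr (sval (f _)); apply: sval_inj.
- rewrite (pE d yd) (pE d' yd') => /sval_inj /(can_inj fK).
  by case.
- rewrite (pE d yd) (pE d' yd').
  have := fE (exist _ d yd) (exist _ d' yd') => /= h.
  by apply/asboolP/asboolP => /h.
Qed.

Lemma bchart_iso (G H : bigraph) c (T : eqType) (q : T -> T -> {classic G})
    (r : T -> T -> {classic H}) :
  bchart predT (@adjb G) (kindb c) predT q ->
  bchart predT (@adjb H) (kindb c) predT r -> bigraph_iso G H.
Proof.
move=> [[qI qE qK] _ qS] [[rI rE rK] _ rS].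
apply: (@bigraph_iso_rel G H (fun v w => exists i j, v = q i j /\ w = r i j)).
- by move=> v; have [i [j [_ _ vE]]] := qS v isT; exists (r i j), i, j.
- by move=> v; have [i [j [_ _ vE]]] := rS v isT; exists (q i j), i, j.
- move=> _ _ _ _ [i [j [-> ->]]] [k [l [-> ->]]]; split.
    by case/qI => // -> ->.
  by case/rI => // -> ->.
- move=> _ _ _ _ [i [j [-> ->]]] [k [l [-> ->]]].
  have := qE i j k l isT isT isT isT; have := rE i j k l isT isT isT isT.
  move=> <- h; split=> a; apply/asboolP.
    by rewrite -[`[< _ >]]h; apply/asboolP.
  by rewrite -[`[< _ >]]/(adjb _ _) h; apply/asboolP.
- move=> _ _ [i [j [-> ->]]]; apply: (@kindb_short _ _ c).
  by rewrite qK // rK.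
Qed.

Section ChartComp.

Variables (V W : eqType) (E : rel V) (F : rel W) (K : pred V) (K' : pred W).
Variables (x : V) (y : W) (p : W -> V) (T : eqType).
Hypothesis cp : local_chart E x (F y) F p.
Hypothesis pK : forall d, F y d -> K (p d) = K' d.

Lemma bchart_comp (q : T -> T -> W) :
  bchart (F y) F K' predT q -> bchart (E x) E K predT (fun i j => p (q i j)).
Proof.
have [pD pS pI pE] := cp; move=> [[qI qE qK] qP qS].
split; first split.
- by move=> i j k l *; apply: qI => //; apply: pI => //; apply: qP.
- by move=> i j k l *; rewrite pE ?qE //; apply: qP.
- by move=> i j *; rewrite pK ?qK //; apply: qP.
- by move=> i j *; apply/pD/qP.
- by move=> v /pS[w /qS[i [j [_ _ ->]]] ->]; exists i, j.
Qed.

Lemma blocal_comp t (q : T -> T -> W) :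
  blocal F K' y t q -> blocal E K x (p t) (fun i j => p (q i j)).
Proof.
have [pD pS pI pE] := cp; move=> [[qI qE qK] [yt nKt] yq tq yS].
split; first split.
- by move=> i j k l *; apply: qI => //; apply: pI => //; apply: yq.
- by move=> i j k l *; rewrite pE ?qE //; apply: yq.
- by move=> i j *; rewrite pK ?qK //; apply: yq.
- by rewrite pD // pK.
- by move=> i j; apply: pD.
- by move=> i j; rewrite pE ?tq //; apply: yq.
move=> v /pS[w /yS[->|[i [j ->]]] ->]; [by left | right].
by exists i, j.
Qed.

End ChartComp.

Section LocalBase.

Variables (V : eqType) (E : rel V) (K : pred V) (m : nat).
Variable q : 'I_m.+2 -> 'I_m.+2 -> V.
Hypothesis cq : bchart predT E K predT q.

Lemma bchart_base : bchart (E (q ord0 ord0)) E K predT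
  (fun i j : 'I_m.+1 => q (lift ord0 i) (lift ord0 j)).
Proof.
have [[qI qE qK] _ qS] := cq; have lI := inj_eq (@lift_inj _ (ord0 : 'I_m.+2)).
split; first split.
- by move=> i j k l _ _ _ _ /qI[] // /lift_inj-> /lift_inj->.
- by move=> i j k l *; rewrite qE // /badj !lI.
- by move=> i j *; rewrite qK // lI.
- by move=> i j *; rewrite qE // /badj !neq_lift.
- move=> v; have [k [l [_ _ ->]]] := qS v isT; rewrite qE // /badj eqxx /= orbF.
  move=> /and4P[k0 l0 _ _].
  case: (unliftP ord0 k) k0 => [i ->|->]; last by rewrite eqxx.
  case: (unliftP ord0 l) l0 => [j ->|->]; last by rewrite eqxx.
  by exists i, j.
Qed.

Lemma blocal_base : blocal E K (q (pt0 m) (pt1 m)) (q (pt1 m) (pt0 m))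
  (fun i j => q (shift2 i) (shift2 j)).
Proof.
have [[qI qE qK] _ qS] := cq; have sI := inj_eq (@shift2_inj m).
split; first split.
- by move=> i j k l _ _ _ _ /qI[] // /shift2_inj-> /shift2_inj->.
- by move=> i j k l *; rewrite qE // /badj !sI.
- by move=> i j *; rewrite qK // sI.
- by rewrite qE // qK.
- by move=> i j; rewrite qE.
- by move=> i j; rewrite qE.
move=> v; have [k [l [_ _ ->]]] := qS v isT; rewrite qE // => /orP[/and4P[k0 l0 k1 l1]|].
  right; rewrite !(eq_sym _ k) !(eq_sym _ l) in k0 l0 k1 l1.
  have [i ->] := shift2P k0 k1; have [j ->] := shift2P l0 l1.
  by exists i, j.
by case/and3P=> _ /eqP<- /eqP<-; left.
Qed.

End LocalBase.

(** Type B is the case [c = true], type C the case [c = false]. *)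
Lemma locally_B_iso m c (G W : bigraph) (r : 'I_m.+2 -> 'I_m.+2 -> {classic W}) :
  m = 1 \/ 2 < m -> bchart predT (@adjb W) (kindb c) predT r ->
  connected G -> bi_locally_like G W -> bigraph_iso G W.
Proof.
move=> m13 cr conn /bi_locally_like_local loc.
have kE (x : {classic G}) (y : {classic W}) : kindb c x = kindb c y ->
    exists p : {classic W} -> {classic G}, local_chart (@adjb G) x (@adjb W y) (@adjb W) p /\
    forall d, @adjb W y d -> kindb c (p d) = kindb c d.
  move=> /kindb_short/loc/bi_chart_of_iso[p [cp ps]]; exists p; split=> // d /ps s.
  by rewrite /kindb; congr (_ == _); apply/asboolP/asboolP => /s.
have [[_ _ rK] _ _] := cr.
have [|||q cq] := @locally_B_chart m _ (@adjb G) (kindb c) (@adjb_sym G) (@adjb_irr G) m13.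
- move=> x Kx; have [|p [cp pK]] := kE x (r ord0 ord0); first by rewrite Kx rK.
  by eexists; exact: (bchart_comp cp pK (bchart_base cr)).
- move=> x Kx; have [|p [cp pK]] := kE x (r (pt0 m) (pt1 m)).
    by rewrite (negbTE Kx) rK.
  by eexists; eexists; exact: (blocal_comp cp pK (blocal_base cr)).
- exact: connected_iso (classic_iso G) conn.
exact: bchart_iso cq cr.
Qed.

Section WeylB.

Variables (c : bool) (m : nat).
Local Open Scope ring_scope.

Notation n := m.+2.

Definition rootsBC : 'rV[rat]_n -> Prop := if c then @rootsB n else @rootsC n.

Let cc : rat := if c then 1 else 2.

Definition vecB (x : 'I_n * 'I_n) : 'rV[rat]_n :=
  if x.1 == x.2 then cc *: e x.1
  else e x.1 + (-1) ^+ (x.1 < x.2)%N *: e x.2.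

Lemma dot_vecB i j k l : dot (vecB (i, j)) (vecB (k, l)) =
  if i == j then
    if k == l then cc * cc * (i == k)%:R
    else cc * ((i == k)%:R + (-1) ^+ (k < l)%N * (i == l)%:R)
  else
    if k == l then cc * ((i == k)%:R + (-1) ^+ (i < j)%N * (j == k)%:R)
    else (i == k)%:R + (-1) ^+ (k < l)%N * (i == l)%:R
      + (-1) ^+ (i < j)%N * (j == k)%:R
      + (-1) ^+ (i < j)%N * (-1) ^+ (k < l)%N * (j == l)%:R.
Proof.
rewrite /vecB /=; case: (i == j); case: (k == l);
  rewrite ?dotDl ?dotDr ?dotZl ?dotZr ?dotDl ?dotDr ?dotZl ?dotZr !dot_e; ring.
Qed.

Lemma order_coincidences (i j k l : 'I_n) : i != j -> k != l ->
  [/\ (i == k) && (j == l) -> (k < l)%N = (i < j)%N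
    & (i == l) && (j == k) -> (k < l)%N = ~~ (i < j)%N].
Proof.
move=> ij _; split=> /andP[/eqP <- /eqP <-] //.
by rewrite -leqNgt ltn_neqAle eq_sym ij.
Qed.

Lemma vecB_neq0 x : vecB x != 0.
Proof.
case: x => i j; rewrite -dot_eq0 dot_vecB !eqxx (eq_sym j).
by case: (i == j); rewrite /cc; case: c; case: (i < j)%N.
Qed.

Lemma dot_vecB_eq0 i j k l : (dot (vecB (i, j)) (vecB (k, l)) == 0) = badj i j k l.
Proof.
rewrite dot_vecB /badj /cc; have [<-|ij] := eqVneq i j; have [<-|kl] := eqVneq k l.
- by case: c; case: (i == k).
- have : ~~ ((i == k) && (i == l)).
    by apply: contra kl => /andP[/eqP<- /eqP<-].
  by move: (i == k) (i == l) (k < l)%N => [] [] []; case: c.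
- have : ~~ ((i == k) && (j == k)).
    by apply: contra ij => /andP[/eqP-> /eqP->].
  by move: (i == k) (j == k) (i < j)%N => [] [] []; case: c.
have [o1 o2] := order_coincidences ij kl.
have [] := pair_coincidences ij kl; move: o1 o2.
move: (i == k) (i == l) (j == k) (j == l) (i < j)%N (k < l)%N.
by move=> [] [] [] [] [] [] //= h1 h2 _ _ _ _;
  solve [have := h1 isT => // | have := h2 isT => //].
Qed.

Lemma vecB_inj i j k l : refl (vecB (i, j)) = refl (vecB (k, l)) -> i = k /\ j = l.
Proof.
move=> /(refl_eq_dot (vecB_neq0 _)) /eqP; rewrite !dot_vecB !eqxx /cc.
rewrite (eq_sym j i) (eq_sym l k) => h.
suff /andP[/eqP-> /eqP->] : (i == k) && (j == l) by [].
move: h; have [<-|ij] := eqVneq i j; have [<-|kl] := eqVneq k l.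
- by case: (i == k); case: c.
- have : ~~ ((i == k) && (i == l)).
    by apply: contra kl => /andP[/eqP<- /eqP<-].
  by move: (i == k) (i == l) (k < l)%N => [] [] []; case: c.
- have : ~~ ((i == k) && (j == k)).
    by apply: contra ij => /andP[/eqP-> /eqP->].
  by move: (i == k) (j == k) (i < j)%N => [] [] []; case: c.
have [o1 o2] := order_coincidences ij kl.
have [] := pair_coincidences ij kl; move: o1 o2.
move: (i == k) (i == l) (j == k) (j == l) (i < j)%N (k < l)%N.
by move=> [] [] [] [] [] [] //= h1 h2 _ _ _ _;
  solve [have := h1 isT => // | have := h2 isT => //].
Qed.

Lemma vecB_root x : rootsBC (vecB x).
Proof.
case: x => i j; rewrite /rootsBC /vecB /cc /=; have [_|ij] := eqVneq i j.
  by case: c; right; exists i, false; rewrite expr0 !scale1r.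
have D : @rootsD n (e i + (-1) ^+ (i < j)%N *: e j).
  by exists i, j, false, (i < j)%N; rewrite expr0 scale1r; split=> //; exact/eqP.
by case: c; left.
Qed.

Lemma rootsD_vecB a : @rootsD n a ->
  dot a a = 2 /\ exists i j, i != j /\ refl a = refl (vecB (i, j)).
Proof.
case=> i [j [s [t [/eqP ij ->]]]]; split.
  rewrite !dotDl !dotDr !dotZl !dotZr !dot_e !eqxx (eq_sym j) (negbTE ij).
  by case: s; case: t.
have main (k l : 'I_n) (u v : bool) : k != l -> (k < l)%N = u (+) v ->
    refl ((-1) ^+ u *: e k + (-1) ^+ v *: e l) = refl (vecB (k, l)).
  move=> kl uv; rewrite /vecB /= (negbTE kl) uv.
  rewrite -[LHS](@reflZ _ ((-1) ^+ u)) ?signr_eq0 // scalerDr !scalerA -!signr_addb.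
  by rewrite addbb expr0 scale1r.
have [st|st] := eqVneq (i < j)%N (s (+) t); first by exists i, j; split; last exact: main.
have ji : j != i by rewrite eq_sym.
exists j, i; split=> //; rewrite addrC; apply: main => //.
have -> : (j < i)%N = ~~ (i < j)%N by rewrite -leqNgt ltn_neqAle eq_sym ij.
by move: st; case: (i < j)%N; case: s; case: t.
Qed.

Lemma axis_vecB (i : 'I_n) (s : bool) : let a := (-1) ^+ s *: (cc *: e i) in
  dot a a = cc * cc /\ refl a = refl (vecB (i, i)).
Proof.
split; last by rewrite /vecB /= eqxx (@reflZ _ ((-1) ^+ s)) ?signr_eq0.
rewrite !dotZl !dotZr dot_e eqxx.
by case: s; rewrite /= ?expr0 ?expr1 ?mulr1 ?mul1r ?mulN1r ?mulrN ?opprK // mulrN1 opprK.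
Qed.

Lemma rootsBC_cases a : rootsBC a ->
  @rootsD n a \/ exists i (s : bool), a = (-1) ^+ s *: (cc *: e i).
Proof.
rewrite /rootsBC /cc; case: c => -[h|[i [s ->]]]; try by left.
  by right; exists i, s; rewrite scale1r.
by right; exists i, s.
Qed.

Lemma rootsBC_vecB a : rootsBC a -> exists x, refl a = refl (vecB x).
Proof.
case/rootsBC_cases => [/rootsD_vecB[_ [i [j [_ ->]]]]|[i [s ->]]].
  by exists (i, j).
by exists (i, i); case: (axis_vecB i s).
Qed.

(** Roots on the coordinate axes have square length 1 in type B and 4 in type C,
    the others have square length 2. *)
Lemma short_vecB i j :
  (exists2 a, short_root rootsBC a & refl (vecB (i, j)) = refl a) <-> (i == j) = c.
Proof.
have norm a : rootsBC a -> (dot a a == 2) || (dot a a == cc * cc).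
  case/rootsBC_cases => [/rootsD_vecB[-> _]|[k [s ->]]]; first by rewrite eqxx.
  by have [-> _] := axis_vecB k s; rewrite eqxx orbT.
split=> [[a [ra [b rb ab]]]|ijc].
  case/rootsBC_cases: ra => [/rootsD_vecB[a2 [k [l [kl ->]]]]|[k [s aE]]].
    case/vecB_inj => -> ->; rewrite (negbTE kl); apply/esym/negP => ct.
    by move: (norm b rb) ab; rewrite a2 /cc ct => /orP[]/eqP->.
  have [an rE] := axis_vecB k s; rewrite -aE in an rE; rewrite rE.
  case/vecB_inj => -> ->; rewrite eqxx; apply/esym/negPn/negP => cf.
  by move: (norm b rb) ab; rewrite an /cc (negbTE cf) => /orP[]/eqP->.
exists (vecB (i, j)) => //; split; first exact: vecB_root.
exists (vecB (if c then (pt0 m, pt1 m) else (ord0, ord0))); first exact: vecB_root.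
rewrite !dot_vecB /cc; move: ijc; case: c => ijc.
  by rewrite !eqxx ijc (negbTE (pt01 m)) eq_sym (negbTE (pt01 m)).
by rewrite !eqxx ijc (eq_sym j) ijc; case: (i < j)%N.
Qed.

End WeylB.

Lemma weylB_chart c m (W := @weyl_bigraph_of m.+2 (@rootsBC c m)) :
  exists r : 'I_m.+2 -> 'I_m.+2 -> {classic W},
  bchart predT (@adjb W) (kindb c) predT r.
Proof.
have [r rE] := @refl_index _ (@rootsBC c m) _ (fun=> True) (@vecB c m) (ord0, ord0) I
  (fun x _ => vecB_root c x).
have {}rE x : sval (r x) = refl (vecB c x) by apply: rE.
exists (fun i j => r (i, j)); split; first split.
- move=> i j k l _ _ _ _ /(congr1 sval); rewrite !rE; exact: vecB_inj.
- move=> i j k l _ _ _ _; rewrite -(dot_vecB_eq0 c).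
  by apply: weyl_adjb; rewrite ?rE ?vecB_neq0.
- move=> i j _ _; rewrite /kindb; have sv := short_vecB c i j.
  have -> : `[< short (r (i, j) : W) >] = ((i == j) == c).
    apply/asboolP/eqP => /=; rewrite rE; by case: sv.
  by case: (i == j); case: c {W r rE sv}.
- by [].
move=> v _; have [a ra va] := svalP v; have [[i j] aE] := rootsBC_vecB ra.
by exists i, j; split=> //; apply: sval_inj; rewrite rE va.
Qed.

Lemma BC_iso c n (G : bigraph) : n = 3 \/ 5 <= n -> connected G ->
  bi_locally_like G (weyl_bigraph (if c then B_ n else C_ n)) ->
  bigraph_iso G (weyl_bigraph (if c then B_ n else C_ n)).
Proof.
case: n => [|[|m]] [] // n35 conn; have [r cr] := weylB_chart c m.
all: have m13 : m = 1 \/ 2 < m by lia.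
all: by case: c r cr => r cr; exact: locally_B_iso m13 cr conn.
Qed.

(** * Type F4 *)

(** The three nonzero linear forms on the plane over the field with two
    elements. *)
Definition lform (j : 'I_3) (u : bool * bool) : bool :=
  if val j is 0 then u.1 else if val j is 1 then u.2 else u.1 (+) u.2.

(** The nonzero vector in the kernel of [lform j]. *)
Definition ker_vec (j : 'I_3) : bool * bool :=
  if val j is 0 then (false, true) else if val j is 1 then (true, false)
  else (true, true).

Definition f4point := (bool * 'I_3 * (bool * bool))%type.

(** Three short ([true]) and three long ([false]) cliques, each labelled by the
    plane; the short clique [i] and the long clique [j] are joined by an affine
    equation whose constant term is [sg i j]. *)
Definition f4adj (sg : 'I_3 -> 'I_3 -> bool) (x y : f4point) : bool :=
  let: (c, i, u) := x in let: (c', j, v) := y in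
  if c == c' then (i == j) && (u != v)
  else lform j u (+) lform i v == (if c then sg i j else sg j i).

Definition f4chart (V : eqType) (E : rel V) (K : pred V)
    (sg : 'I_3 -> 'I_3 -> bool) (f : f4point -> V) : Prop :=
  [/\ bijective f, forall x y, E (f x) (f y) = f4adj sg x y
    & forall x, K (f x) = x.1.1].

(** The local graph at [z]: the rest [u] of the clique of [z], and three pairs
    [l j], one in each clique of the other kind. *)
Definition f4star (V : eqType) (E : rel V) (K : pred V) (z : V)
    (u : 'I_3 -> V) (l : 'I_3 -> bool -> V) : Prop :=
  [/\ forall k, K (u k) = K z /\ E z (u k),
      forall j b, K (l j b) = ~~ K z /\ E z (l j b),
      forall w, E z w -> (exists k, w = u k) \/ (exists j b, w = l j b),
      (forall j b k c, l j b = l k c -> j = k /\ b = c) /\ injective u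
    & [/\ forall k k', E (u k) (u k') = (k != k'),
        forall j b k c, E (l j b) (l k c) = (j == k) && (b != c)
        & forall k j b, E (u k) (l j b) = (j == k)]].

Section Classify.

Variables (V : finType) (E : rel V) (K : pred V).
Hypotheses (Es : symmetric E) (Ei : irreflexive E).
Hypothesis stars : forall z, exists u l, f4star E K z u l.
Hypothesis cV : #|V| = 24.

(** [z] and [w] lie in the same clique of vertices of one kind. *)
Definition mono z w : bool := (z == w) || (K z == K w) && E z w.

Lemma mono_refl z : mono z z. Proof. by rewrite /mono eqxx. Qed.

Lemma mono_sym z w : mono z w = mono w z.
Proof. by rewrite /mono eq_sym Es (eq_sym (K z)). Qed.

Lemma mono_kind z w : mono z w -> K z = K w.
Proof. by case/orP=> [/eqP->//|/andP[/eqP]]. Qed.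

Lemma mono_trans z w v : mono z w -> mono w v -> mono z v.
Proof.
have [->//|nzw] := eqVneq z w; have [->//|nwv] := eqVneq w v.
rewrite {1 2}/mono (negbTE nzw) (negbTE nwv) /= => /andP[/eqP Kzw zw] /andP[/eqP Kwv wv].
have [u [l [uP lP all [_ uI] [uE _ _]]]] := stars w.
have same t : K t = K w -> E w t -> exists k, t = u k.
  move=> Kt /all[//|[j [b tE]]]; have [Kl _] := lP j b.
  by move: Kt; rewrite tE Kl; case: (K w).
have [k ->] := same z Kzw ltac:(by rewrite Es).
have [k' ->] := same v (esym Kwv) wv.
have [->|kk] := eqVneq k k'; first exact: mono_refl.
by rewrite /mono uE kk (proj1 (uP k)) (proj1 (uP k')) eqxx orbT.
Qed.

Section Reps.

Variable C : bool -> 'I_3 -> V.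
Hypothesis CK : forall c i, K (C c i) = c.
Hypothesis CI : forall c i j, mono (C c i) (C c j) -> i = j.

Lemma C_uniq c i j v : mono (C c i) v -> mono (C c j) v -> i = j.
Proof. by move=> iv jv; apply: (@CI c); apply: mono_trans iv _; rewrite mono_sym. Qed.

Section Points.

Variables (U : bool -> 'I_3 -> 'I_3 -> V) (L : bool -> 'I_3 -> 'I_3 -> bool -> V).
Hypothesis CU : forall c i, f4star E K (C c i) (U c i) (L c i).

(** The clique of [C c i], with [C c i] itself at [None]. *)
Definition clique_pt c i (o : option 'I_3) : V :=
  if o is Some k then U c i k else C c i.

Lemma clique_pt_mono c i o : mono (C c i) (clique_pt c i o).
Proof.
case: o => [k|] /=; last exact: mono_refl.
have [uP _ _ _ _] := CU c i; have [/= Ku zu] := uP k.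
by rewrite /mono Ku eqxx zu orbT.
Qed.

Lemma clique_pt_kind c i o : K (clique_pt c i o) = c.
Proof. by rewrite -(mono_kind (clique_pt_mono c i o)) CK. Qed.

Lemma clique_pt_adj c i o o' :
  E (clique_pt c i o) (clique_pt c i o') = (o != o').
Proof.
have [uP _ _ _ [uE _ _]] := CU c i.
case: o o' => [k|] [k'|] /=; rewrite ?Ei // ?uE //.
- by rewrite Es; case: (uP k).
- by case: (uP k').
Qed.

Lemma clique_pt_inj c i o c' i' o' : clique_pt c i o = clique_pt c' i' o' ->
  [/\ c = c', i = i' & o = o'].
Proof.
move=> h; have cc : c = c' by rewrite -(clique_pt_kind c i o) h clique_pt_kind.
subst c'; have ii : i = i'.
  by apply: (C_uniq (clique_pt_mono c i o)); rewrite h clique_pt_mono.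
subst i'; split=> //; apply/eqP.
by rewrite -[_ == _]negbK -(clique_pt_adj c i) h Ei.
Qed.

(** The points of the six cliques are distinct, and there are 24 of them. *)
Lemma clique_pt_surj v : exists c i o, v = clique_pt c i o.
Proof.
pose g (x : bool * 'I_3 * option 'I_3) := clique_pt x.1.1 x.1.2 x.2.
have gI : injective g by move=> [[c i] o] [[c' i'] o'] /clique_pt_inj/= [-> -> ->].
have [h _ hK] : bijective g.
  by apply: inj_card_bij => //; rewrite cV !card_prod card_bool card_option card_ord.
by exists (h v).1.1, (h v).1.2, (h v).2; rewrite -[LHS]hK.
Qed.

End Points.

Lemma C_cover v : exists i, mono (C (K v) i) v.
Proof.
have /choice[U UP] : forall ci : bool * 'I_3, exists u, exists l,
  f4star E K (C ci.1 ci.2) u l by move=> ci; exact: stars.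
have /choice[L CU] := UP.
have CU' c i : f4star E K (C c i) (U (c, i)) (L (c, i)) by exact: (CU (c, i)).
have [c [i [o ->]]] := clique_pt_surj CU' v.
by exists i; rewrite (clique_pt_kind CU'); exact: (clique_pt_mono CU').
Qed.

(** The pairs at [z] numbered by the cliques that contain them. *)
Lemma based_star z : exists u l, f4star E K z u l /\
  forall j b, mono (C (~~ K z) j) (l j b).
Proof.
have [u [l [uP lP all [lI uI] [uE lE ulE]]]] := stars z.
have /choice[jj jjP] : forall k, exists j, mono (C (~~ K z) j) (l k false).
  by move=> k; have [j] := C_cover (l k false); rewrite (proj1 (lP k false)); exists j.
have lmono k k' : mono (l k false) (l k' false) -> k = k'.
  case/orP=> [/eqP/lI[]//|/andP[_]].
  by rewrite lE andbF.
have jjI : injective jj.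
  move=> k k' h; apply: lmono; apply: mono_trans (jjP k').
  by rewrite mono_sym -h.
have [rho jjK rhoK] := injF_bij jjI.
have rhoI : injective rho := can_inj rhoK.
have rE := inj_eq rhoI.
exists (fun j => u (rho j)), (fun j b => l (rho j) b); split.
  split.
  - by move=> k; exact: uP.
  - by move=> j b; exact: lP.
  - move=> w /all[[k ->]|[j [b ->]]]; [left|right].
      by exists (jj k); rewrite jjK.
    by exists (jj j), b; rewrite jjK.
  - by split=> [j b k c /lI[/rhoI -> ->]|k k' /uI/rhoI].
  - by split=> [k k'|j b k c|k j b]; rewrite ?uE ?lE ?ulE rE.
move=> j b; have := jjP (rho j); rewrite rhoK => h; apply: mono_trans h _.
case: b; last exact: mono_refl.
by rewrite /mono lE !eqxx !(proj1 (lP _ _)) eqxx orbT.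
Qed.

Lemma star_pair z u l j w : f4star E K z u l ->
  (forall j b, mono (C (~~ K z) j) (l j b)) ->
  mono (C (~~ K z) j) w -> E z w -> exists b, w = l j b.
Proof.
move=> [uP lP all _ _] lC jw /all[[k wE]|[k [b wE]]].
  have := mono_kind jw; rewrite CK wE (proj1 (uP k)).
  by case: (K z).
by exists b; rewrite wE; congr (l _ b); apply: C_uniq jw; rewrite wE.
Qed.

(** A point [u k] of the clique of [z] has the same neighbours as [z] in the
    clique of the other kind numbered [k], and the complementary ones in the
    other two: [w], if not adjacent to [z], is adjacent to exactly two points of
    the clique, and neither to [z] nor to [u j]. *)
Lemma star_clique c i u l j k w : f4star E K (C c i) u l ->
  (forall j b, mono (C (~~ c) j) (l j b)) ->
  mono (C (~~ c) j) w -> E (u k) w = E (C c i) w (+) (j != k).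
Proof.
set z := C c i => st lC jw; have Kz : K z = c by exact: CK.
have lC' j' b : mono (C (~~ K z) j') (l j' b) by rewrite Kz.
have jw' : mono (C (~~ K z) j) w by rewrite Kz.
have [uP lP all [lI uI] [uE lE ulE]] := st.
have [zw|nzw] := boolP (E z w).
  by have [b ->] := star_pair st lC' jw' zw; rewrite ulE; case: (j == k).
have nuj : E (u j) w = false.
  apply/negP => ujw; have [u1 [l1 [st1 lC1]]] := based_star (u j).
  have Ku : K (u j) = K z by case: (uP j).
  have [b3 wE] : exists b, w = l1 j b by apply: (star_pair st1 lC1); rewrite ?Ku.
  have pr b : exists b', l j b = l1 j b'.
    by apply: (star_pair st1 lC1); rewrite ?Ku ?ulE.
  have [b1 e1] := pr false; have [b2 e2] := pr true.
  have b12 : b1 != b2.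
    by apply: contraTneq isT => b12; move: e2; rewrite -b12 -e1 => /lI[].
  have : exists b, w = l j b.
    move: b12 wE; case: b1 e1; case: b2 e2; case: b3 => //= e2 e1 _ wE;
      by [exists false; rewrite e1 | exists true; rewrite e2].
  by case=> b wb; rewrite wb (proj2 (lP j b)) in nzw.
have [jk|kj] := eqVneq j k; first by subst k; rewrite nuj.
rewrite /= Es.
have Kw : K w = ~~ c by rewrite -(mono_kind jw) CK.
have [u2 [l2 [st2 lC2]]] := based_star w.
have [_ lP2 _ [lI2 _] _] := st2.
have two b : exists2 k', k' != j & l2 i b = u k'.
  have : mono z (l2 i b) by have := lC2 i b; rewrite Kw negbK.
  case/orP=> [/eqP zE|/andP[/eqP Kl zl]].
    by have := proj2 (lP2 i b); rewrite -zE Es (negbTE nzw).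
  case: (all _ zl) => [[k' lE2]|[j' [b' lE2]]].
    exists k' => //; apply/eqP => k'j.
    by have := proj2 (lP2 i b); rewrite lE2 k'j Es nuj.
  by move: Kl; rewrite lE2 (proj1 (lP j' b')); case: (K z).
have [k1 k1j e1] := two false; have [k2 k2j e2] := two true.
have k12 : k1 != k2.
  by apply: contraTneq isT => k12; move: e2; rewrite -k12 -e1 => /lI2[].
have : (k == k1) || (k == k2).
  move: {two e1 e2 jw jw' nuj} kj k1j k2j k12; rewrite -!val_eqE /=.
  by move: (ltn_ord j) (ltn_ord k) (ltn_ord k1) (ltn_ord k2); lia.
by case/orP=> /eqP ->; rewrite -?e1 -?e2; case: (lP2 i false); case: (lP2 i true).
Qed.

(** The nonzero vectors, numbered so that [w] is killed by the form with its own
    number. *)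
Definition plane_pt (w : bool * bool) : option 'I_3 :=
  match w with
  | (false, false) => None
  | (false, true) => Some ord0
  | (true, false) => Some (inord 1)
  | (true, true) => Some ord_max
  end.

Lemma lform_pt j w : lform j w = if plane_pt w is Some k then j != k else false.
Proof.
case: w => -[] []; case: j => -[|[|[|]]] //= ?; rewrite -?val_eqE /= ?inordK //.
Qed.

Lemma plane_pt_inj : injective plane_pt.
Proof.
have i01 : (inord 1 : 'I_3) != ord0 by rewrite -val_eqE /= inordK.
have i12 : (inord 1 : 'I_3) != ord_max by rewrite -val_eqE /= inordK.
move=> [[] []] [[] []] //= [] /eqP; rewrite ?(negbTE i01) ?(negbTE i12) // eq_sym.
  by rewrite (negbTE i12).
by rewrite (negbTE i01).
Qed.

Lemma f4_chart_of_reps : exists sg f, f4chart E K sg f.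
Proof.
have /choice[U /choice[L UP]] : forall ci : bool * 'I_3, exists u, exists l,
    f4star E K (C ci.1 ci.2) u l /\ forall j b, mono (C (~~ ci.1) j) (l j b).
  move=> [c i] /=; have [u [l [st lC]]] := based_star (C c i).
  by exists u, l; split=> // j b; have := lC j b; rewrite CK.
have CU c i : f4star E K (C c i) (U (c, i)) (L (c, i)) by case: (UP (c, i)).
pose a := clique_pt (fun c i => U (c, i)).
have aC c i o : mono (C c i) (a c i o) by exact: (clique_pt_mono CU).
have aK c i o : K (a c i o) = c by exact: (clique_pt_kind CU).
pose f (x : f4point) := a x.1.1 x.1.2 (plane_pt x.2).
pose form j' (o : option 'I_3) := if o is Some k then j' != k else false.
have aE c i o j w : mono (C (~~ c) j) w ->
    E (a c i o) w = E (C c i) w (+) form j o.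
  move=> jw; case: o => [k|]; last by rewrite addbF.
  by have [st lC] := UP (c, i); exact: star_clique st lC jw.
have two i' j' o o' : E (a true i' o) (a false j' o') =
    E (C true i') (C false j') (+) form j' o (+) form i' o'.
  rewrite (aE true i' o j') ?aC // Es (aE false j' o' i'); last exact: mono_refl.
  by rewrite (Es (C false j')) addbAC.
exists (fun i j => ~~ E (C true i) (C false j)), f; split.
- apply: inj_card_bij; last by rewrite cV !card_prod card_bool card_ord.
  move=> [[c i] w] [[c' i'] w'] /(clique_pt_inj CU)/= [<- <-].
  by move=> /plane_pt_inj->.
- move=> [[c i] u] [[c' j] v]; rewrite /f4adj /f /=.
  have [<-|cc] := eqVneq c c'.
    have [<-|ij] := eqVneq i j.
      by rewrite (clique_pt_adj CU) (inj_eq plane_pt_inj).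
    apply/negP => h; case/eqP: ij; apply: (C_uniq (c := c)) (aC c i (plane_pt u)) _.
    by apply: (mono_trans (aC c j (plane_pt v))); rewrite /mono !aK eqxx Es h orbT.
  rewrite !lform_pt -![if plane_pt _ is Some _ then _ else _]/(form _ _).
  case: c c' cc => -[] // _; last rewrite Es; rewrite two.
    by move: (E _ _) (form _ _) (form _ _) => [] [] [].
  by move: (E _ _) (form _ _) (form _ _) => [] [] [].
- by move=> [[c i] w]; rewrite /f aK.
Qed.

End Reps.

(** The representatives of the cliques are the points [l j false] of the star at
    a short vertex [s], and the same for the star at [l ord0 false]. *)
Lemma f4_chart : exists sg f, f4chart E K sg f.
Proof.
have [s Ks] : exists s, K s.
  have [v _] : exists v : V, v \in V by apply/card_gt0P; rewrite cV.
  have [Kv|/negbTE Kv] := boolP (K v); first by exists v.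
  have [u [l [_ lP _ _ _]]] := stars v.
  by exists (l ord0 false); rewrite (proj1 (lP _ _)) Kv.
have [u [l [_ lP _ [lI _] [_ lE _]]]] := stars s.
have Kl j b : K (l j b) = false by rewrite (proj1 (lP j b)) Ks.
have [u' [l' [_ lP' _ [lI' _] [_ lE' _]]]] := stars (l ord0 false).
pose C c (i : 'I_3) := if c then l' i false else l i false.
apply: (@f4_chart_of_reps C).
- by case=> i /=; rewrite ?Kl ?(proj1 (lP' i false)) ?Kl.
- case=> i j; rewrite /mono /= ?lE ?lE' !eqxx /= !andbF orbF.
    by move=> /eqP/lI'[].
  by move=> /eqP/lI[].
Qed.

End Classify.

(** ** The local structure of the F4 charts *)

Definition i0 : 'I_3 := @Ordinal 3 0 isT.
Definition i1 : 'I_3 := @Ordinal 3 1 isT.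
Definition i2 : 'I_3 := @Ordinal 3 2 isT.

Lemma ord3_ind (P : 'I_3 -> Prop) : P i0 -> P i1 -> P i2 -> forall i, P i.
Proof.
move=> P0 P1 P2 [[|[|[|//]]] ip].
- by rewrite (_ : Ordinal ip = i0) //; apply: val_inj.
- by rewrite (_ : Ordinal ip = i1) //; apply: val_inj.
- by rewrite (_ : Ordinal ip = i2) //; apply: val_inj.
Qed.

Definition xorv (u v : bool * bool) : bool * bool := (u.1 (+) v.1, u.2 (+) v.2).

Lemma xorvK v : involutive (xorv^~ v).
Proof. by case: v => [] [] [] [[] []]. Qed.

Lemma lform_xorv j u v : lform j (xorv u v) = lform j u (+) lform j v.
Proof. by elim/ord3_ind: j; case: u v => [[] []] [[] []]. Qed.

Lemma lform_ker j k : lform j (ker_vec k) = (j != k).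
Proof. by elim/ord3_ind: j; elim/ord3_ind: k. Qed.

Lemma ker_vec_inj : injective ker_vec.
Proof. by elim/ord3_ind; elim/ord3_ind. Qed.

Lemma ker_vecP u v : u != v -> exists k, v = xorv u (ker_vec k).
Proof.
by case: u v => [[] []] [[] []] //= _;
  (by exists i0) || (by exists i1) || (by exists i2).
Qed.

(** The two points, numbered by [b], of the line with the equation
    [lform j u = t]. *)
Definition line_pt (j : 'I_3) (t b : bool) : bool * bool :=
  if val j is 0 then (t, b) else if val j is 1 then (b, t) else (b, b (+) t).

Lemma lform_line j t b : lform j (line_pt j t b) = t.
Proof. by elim/ord3_ind: j; case: t b => [] []. Qed.

Lemma line_ptP j t u : lform j u = t -> exists b, u = line_pt j t b.
Proof.
move=> <-; exists (if val j is 0 then u.2 else u.1).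
by elim/ord3_ind: j; case: u => [] [] [].
Qed.

Lemma line_pt_eq j t b b' : (line_pt j t b == line_pt j t b') = (b == b').
Proof. by elim/ord3_ind: j; case: t b b' => [] [] []. Qed.

Section StarOfChart.

Variables (V : eqType) (E : rel V) (K : pred V) (sg : 'I_3 -> 'I_3 -> bool).
Variable f : f4point -> V.
Hypothesis cf : f4chart E K sg f.

Lemma f4chart_star x : exists u l, f4star E K (f x) u l.
Proof.
have [bf fE fK] := cf; have fI := bij_inj bf; case: x => -[c i] w.
pose t j := lform j w (+) (if c then sg i j else sg j i).
pose u k := f (c, i, xorv w (ker_vec k)).
pose l j b := f (~~ c, j, line_pt i (t j) b).
have xl j v : E (f (c, i, w)) (f (~~ c, j, v)) = (lform i v == t j).
  rewrite fE /= /t; case: c {u l t}; rewrite /=.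
    by case: (lform j w); case: (lform i v); case: (sg i j).
  by case: (lform j w); case: (lform i v); case: (sg j i).
have nuw k : w != xorv w (ker_vec k).
  by elim/ord3_ind: k; case: w {u l t xl} => [] [] [].
have uw k k' : (xorv w (ker_vec k) != xorv w (ker_vec k')) = (k != k').
  congr (~~ _); apply/eqP/eqP => [h|->//]; apply: ker_vec_inj.
  by move: h; case: w {u l t xl nuw} => w1 w2 [] /addbI h1 /addbI h2;
    case: (ker_vec k) (ker_vec k') h1 h2 => [? ?] [? ?] /= -> ->.
exists u, l; split.
- by move=> k; rewrite !fK fE /= !eqxx nuw.
- by move=> j b; rewrite !fK xl lform_line eqxx.
- move=> v; have [g _ gK] := bf; rewrite -(gK v); case: (g v) => -[c' j] w'.
  have [cc|cc] := eqVneq c c'.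
    subst c'; rewrite fE /= eqxx => /andP[/eqP<- /ker_vecP[k ->]].
    by left; exists k.
  have -> : c' = ~~ c by case: c c' cc {u l t xl} => [] [].
  by rewrite xl => /eqP/line_ptP[b ->]; right; exists j, b.
- split=> [j b k b' /fI[jk]|k k' /fI[h1 h2]].
    by subst k; move/eqP; rewrite line_pt_eq => /eqP.
  by apply/eqP; rewrite -[_ == _]negbK -uw negbK; apply/eqP; congr (_, _).
- split=> [k k'|j b k b'|k j b].
  + by rewrite fE /= !eqxx uw.
  + rewrite fE /= eqxx; have [jk|//] := eqVneq j k.
    by subst k; rewrite line_pt_eq.
  + rewrite fE; case: c @t {u l xl} => t /=; rewrite lform_xorv lform_ker lform_line /t.
      by case: (lform j w); case: (j == k); case: (sg i j).
    by case: (lform j w); case: (j == k); case: (sg j i).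
Qed.

End StarOfChart.

Lemma f4star_chart (V V' : eqType) (E : rel V) (E' : rel V') (K : pred V)
    (K' : pred V') (z : V) (y : V') (p : V' -> V) u l :
  local_chart E z (E' y) E' p -> K z = K' y ->
  (forall d, E' y d -> K (p d) = K' d) ->
  f4star E' K' y u l -> f4star E K z (p \o u) (fun j b => p (l j b)).
Proof.
move=> [pD pS pI pE] Kz Kp [uP lP all [lI uI] [uE lE ulE]].
have uD k : E' y (u k) by case: (uP k).
have lD j b : E' y (l j b) by case: (lP j b).
split.
- by move=> k /=; rewrite Kp // Kz pD //; case: (uP k).
- by move=> j b /=; rewrite Kp // Kz pD //; case: (lP j b).
- move=> w /pS[d /all[[k ->]|[j [b ->]]] ->]; [left|right]; first by exists k.
  by exists j, b.
- by split=> [j b k c /pI/lI|k k' /pI/uI]; apply.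
- by split=> *; rewrite /= pE.
Qed.

Definition star_pt (V : Type) (u : 'I_3 -> V) (l : 'I_3 -> bool -> V)
    (x : 'I_3 + 'I_3 * bool) : V :=
  match x with inl k => u k | inr (j, b) => l j b end.

Definition star_adj (x y : 'I_3 + 'I_3 * bool) : bool :=
  match x, y with
  | inl k, inl k' => k != k'
  | inr (j, b), inr (k, c) => (j == k) && (b != c)
  | inl k, inr (j, _) | inr (j, _), inl k => j == k
  end.

Lemma star_ptP (V : eqType) (E : rel V) (K : pred V) z u l (p := star_pt u l) :
  symmetric E -> f4star E K z u l ->
  [/\ injective p, forall x y, E (p x) (p y) = star_adj x y,
      forall x, E z (p x), forall x, K (p x) = K z (+) (if x is inl _ then false else true)
    & forall v, E z v -> exists x, v = p x].
Proof.
move=> Es [uP lP all [lI uI] [uE lE ulE]].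
have ul k j b : u k <> l j b.
  move=> ukl; have [Ku _] := uP k; have [Kl _] := lP j b.
  by move: Kl; rewrite -ukl Ku; case: (K z).
split.
- case=> [k|[j b]] [k'|[j' b']] /=; first by move/uI->.
  + by move/ul.
  + by move/esym/ul.
  + by case/lI=> -> ->.
- by case=> [k|[j b]] [k'|[j' b']] //=; rewrite Es.
- by case=> [k|[j b]]; [case: (uP k) | case: (lP j b)].
- case=> [k|[j b]] /=; first by rewrite addbF; case: (uP k).
  by rewrite addbT; case: (lP j b).
- move=> v /all[[k ->]|[j [b ->]]]; first by exists (inl k).
  by exists (inr (j, b)).
Qed.

Section Bigraphs.

Implicit Types G H : bigraph.

Definition charted G sg : Prop :=
  exists f, f4chart (@adjb G) (kindb true) sg f.

Lemma kindb_iff G H (v : {classic G}) (w : {classic H}) :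
  (short v <-> short w) -> kindb true v = kindb true w.
Proof. by move=> vw; rewrite /kindb; congr (_ == _); apply/asboolP/asboolP; rewrite vw. Qed.

Lemma f4star_iso G H (z : G) (y : H) u l u' l' :
  f4star (@adjb G) (kindb true) z u l -> f4star (@adjb H) (kindb true) y u' l' ->
  (short z <-> short y) -> bigraph_iso (local_bigraph z) (local_bigraph y).
Proof.
move=> /(star_ptP (@adjb_sym G)); set p := star_pt u l => -[pI pE zp pK pS].
move=> /(star_ptP (@adjb_sym H)); set q := star_pt u' l' => -[qI qE yq qK qS] zy.
have Kzy := @kindb_iff G H z y zy.
pose R (v : local_bigraph z) (w : local_bigraph y) :=
  exists x, sval v = p x /\ sval w = q x.
apply: (@bigraph_iso_rel (local_bigraph z) (local_bigraph y) R).
- move=> [v zv]; have [x vE] := pS v (asboolT zv).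
  by have /asboolP yx := yq x; exists (exist _ (q x) yx), x.
- move=> [v yv]; have [x vE] := qS v (asboolT yv).
  by have /asboolP zx := zp x; exists (exist _ (p x) zx), x.
- move=> v v' w w' [x [vE wE]] [x' [vE' wE']]; split=> [vv|ww]; apply: sval_inj.
    by rewrite wE wE'; congr q; apply: pI; rewrite -vE -vE' vv.
  by rewrite vE vE'; congr p; apply: qI; rewrite -wE -wE' ww.
- move=> [v zv] [v' zv'] [w yw] [w' yw'] [x [/= -> ->]] [x' [/= -> ->]].
  have pq : @adjb G (p x) (p x') = @adjb H (q x) (q x') by rewrite pE qE.
  split=> h; apply/asboolP.
    by rewrite -[`[< _ >]]pq; apply/asboolP.
  by rewrite -[`[< _ >]]/(adjb _ _) pq; apply/asboolP.
- move=> [v zv] [w yw] [x [/= -> ->]]; apply: (@kindb_short G H true).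
  by rewrite pK qK Kzy.
Qed.

Lemma charted_iso G H sg : bigraph_iso G H -> charted H sg -> charted G sg.
Proof.
move=> /bigraph_iso_sym[g [bg gE gs]] [f [bf fE fK]]; exists (g \o f); split.
- exact: bij_comp bg bf.
- move=> x y; rewrite -fE; apply/asboolP/asboolP => /=; rewrite /adjb => h;
    by apply/gE.
- by move=> x; rewrite -fK; apply/esym/kindb_iff/gs.
Qed.

Lemma charted_card G sg : charted G sg -> same_card G 'I_24.
Proof.
move=> [f [[g fK gK] _ _]].
have c24 : #|{: f4point}| = 24 by rewrite !card_prod card_bool card_ord.
exists (fun x => cast_ord c24 (enum_rank (g x))).
exists (fun i => f (enum_val (cast_ord (esym c24) i))) => [x|i].
  by rewrite cast_ordK enum_rankK gK.
by rewrite fK enum_valK cast_ordKV.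
Qed.

Lemma charted_locally_like G H sg sg' :
  charted G sg -> charted H sg' -> bi_locally_like G H.
Proof.
have pt c : exists x : f4point, x.1.1 = c by exists (c, i0, (false, false)).
have rep (L : bigraph) sg0 (c : bool) : charted L sg0 -> exists v : L, if c then short v else ~ short v.
  move=> [f [_ _ fK]]; have [x xc] := pt c; exists (f x).
  by have := fK x; rewrite xc /kindb; case: asboolP => h <-.
have star (L : bigraph) sg0 (v : L) : charted L sg0 ->
    exists u l, f4star (@adjb L) (kindb true) v u l.
  move=> [f cf]; have [[g _ gK] _ _] := cf.
  by have := f4chart_star cf (g v); rewrite gK.
move=> cG cH; have [sG /= sGP] := rep G sg true cG; have [lG /= lGP] := rep G sg false cG.
have [sH /= sHP] := rep H sg' true cH; have [lH /= lHP] := rep H sg' false cH.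
have loc (L L' : bigraph) sg1 sg2 (x : L) (y : L') : charted L sg1 -> charted L' sg2 ->
    (short x <-> short y) -> bigraph_iso (local_bigraph x) (local_bigraph y).
  move=> cL cL'; have [u [l st]] := star L sg1 x cL.
  by have [u' [l' st']] := star L' sg2 y cL'; exact: f4star_iso st st'.
exists (local_bigraph sG), (local_bigraph lG), (local_bigraph sH), (local_bigraph lH).
by split; [split=> x sx; apply: (loc _ _ sg sg) | split=> x sx; apply: (loc _ _ sg' sg')
  | apply: (loc _ _ sg sg') | apply: (loc _ _ sg sg')] => //; tauto.
Qed.

Lemma locally_like_charted G H sg' : same_card G 'I_24 -> charted H sg' ->
  bi_locally_like G H -> exists sg, charted G sg.
Proof.
move=> [h [g hK gK]] [f cf] GH; have [_ _ fK] := cf.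
pose E (i j : 'I_24) := @adjb G (g i) (g j).
pose K (i : 'I_24) := @kindb G true (g i).
have [||||sg [f' [bf' fE' fK']]] := @f4_chart 'I_24 E K.
- by move=> i j; exact: adjb_sym.
- by move=> i; exact: adjb_irr.
- move=> z; pose y : {classic H} := f (kindb true (g z : {classic G}), i0, (false, false)).
  have zy : kindb true (g z : {classic G}) = kindb true y by rewrite fK.
  have [u [l st]] := f4chart_star cf (kindb true (g z : {classic G}), i0, (false, false)).
  have [p [pc ps]] := bi_chart_of_iso (bi_locally_like_local GH (kindb_short zy)).
  have st1 := f4star_chart pc zy (fun d yd => kindb_iff (ps d yd)) st.
  have hc : local_chart E z (@adjb G (g z)) (@adjb G) h.
    split=> [v|i zi|v w _ _|v w _ _]; rewrite /E ?hK //; first by exists (g i); rewrite ?gK.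
    exact: (can_inj hK).
  have hKi d : K (h d) = kindb true (d : {classic G}) by rewrite /K hK.
  exists (h \o (p \o u)), (fun j b => h (p (l j b))).
  exact: (@f4star_chart _ _ E _ K (kindb true) z _ h _ _ hc (erefl _) (fun d _ => hKi d) st1).
- by rewrite card_ord.
exists sg, (g \o f'); split=> //.
by apply: bij_comp bf'; exists h.
Qed.

End Bigraphs.

(** ** The parity of a chart and the twist *)

Definition parity (sg : 'I_3 -> 'I_3 -> bool) : bool :=
  sg i0 i0 (+) sg i0 i1 (+) sg i0 i2 (+) (sg i1 i0 (+) sg i1 i1 (+) sg i1 i2)
  (+) (sg i2 i0 (+) sg i2 i1 (+) sg i2 i2).

Lemma parity_addb sg sg' :
  parity (fun i j => sg i j (+) sg' i j) = parity sg (+) parity sg'.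
Proof.
have addb3 a b c a' b' c' : a (+) a' (+) (b (+) b') (+) (c (+) c') =
    a (+) b (+) c (+) (a' (+) b' (+) c').
  by case: a; case: b; case: c; case: a'; case: b'; case: c'.
by rewrite /parity (addb3 (sg i0 i0) (sg i0 i1) (sg i0 i2))
  (addb3 (sg i1 i0) (sg i1 i1) (sg i1 i2)) (addb3 (sg i2 i0) (sg i2 i1) (sg i2 i2)) addb3.
Qed.

(** Moving the short clique [i] by [t i] and the long clique [j] by [s j]. *)
Lemma f4chart_move (V : eqType) (E : rel V) (K : pred V) sg sg' f
    (t s : 'I_3 -> bool * bool) :
  f4chart E K sg f ->
  (forall i j, sg' i j = sg i j (+) lform j (t i) (+) lform i (s j)) ->
  exists f', f4chart E K sg' f'.
Proof.
move=> [bf fE fK] sgE.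
pose tr (x : f4point) : f4point :=
  (x.1.1, x.1.2, xorv x.2 (if x.1.1 then t x.1.2 else s x.1.2)).
have trK : involutive tr by move=> [[c i] u]; rewrite /tr /= xorvK.
exists (f \o tr); split.
- by apply: bij_comp bf _; exists tr.
- move=> [[c i] u] [[c' j] v]; rewrite fE /= !lform_xorv !sgE.
  have [<-|cc] := eqVneq c c'.
    have [<-|//] := eqVneq i j.
    by rewrite (inj_eq (can_inj (xorvK _))).
  case: c c' cc => -[] // _.
    by move: (lform _ _) (lform _ _) (lform _ _) (lform _ _) (sg _ _) => [] [] [] [] [].
  by move: (lform _ _) (lform _ _) (lform _ _) (lform _ _) (sg _ _) => [] [] [] [] [].
- by move=> [[c i] u]; rewrite fK.
Qed.

(** The representatives of the two classes of constant terms up to moves. *)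
Definition std_sg (b : bool) (i j : 'I_3) : bool := [&& b, i == i0 & j == i0].

(** The moves of the short cliques clear the columns [i1] and [i2], and those of
    the long clique [i0] then clear the column [i0] but for one entry. *)
Lemma charted_std G sg : charted G sg -> charted G (std_sg (parity sg)).
Proof.
move=> [f cf]; pose r i := sg i i0 (+) sg i i1 (+) sg i i2.
pose t i := (sg i i1 (+) sg i i2, sg i i1).
pose s j := if j == i0 then (r i1 (+) r i2, r i1) else (false, false).
apply: (f4chart_move (t := t) (s := s) cf) => i j; rewrite /parity /std_sg.
by elim/ord3_ind: i; elim/ord3_ind: j; rewrite /s /t /r /=;
  move: (sg i0 i0) (sg i0 i1) (sg i0 i2) (sg i1 i0) (sg i1 i1) (sg i1 i2)
    (sg i2 i0) (sg i2 i1) (sg i2 i2) => [] [] [] [] [] [] [] [] [].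
Qed.

Lemma charted_parity G H sg sg' : charted G sg -> charted H sg' ->
  parity sg = parity sg' -> bigraph_iso G H.
Proof.
move=> /charted_std[f [bf fE fK]] /charted_std[f' [bf' fE' fK']] pp.
have fI := bij_inj bf; have fI' := bij_inj bf'.
apply: (@bigraph_iso_rel G H (fun v w => exists x, v = f x /\ w = f' x)).
- by move=> v; have [g _ gK] := bf; exists (f' (g v)), (g v); rewrite gK.
- by move=> w; have [g _ gK] := bf'; exists (f (g w)), (g w); rewrite gK.
- by move=> _ _ _ _ [x [-> ->]] [y [-> ->]]; split=> [/fI->|/fI'->].
- move=> _ _ _ _ [x [-> ->]] [y [-> ->]].
  have ff : @adjb G (f x) (f y) = @adjb H (f' x) (f' y) by rewrite fE fE' pp.
  split=> h; apply/asboolP; first by rewrite -[`[< _ >]]ff; apply/asboolP.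
  by rewrite -[`[< _ >]]/(adjb _ _) ff; apply/asboolP.
- by move=> _ _ [x [-> ->]]; apply: (@kindb_short G H true); rewrite fK fK'.
Qed.

Section Twist.

Variables (G : bigraph) (sg : 'I_3 -> 'I_3 -> bool) (f : f4point -> {classic G}).
Hypothesis cf : f4chart (@adjb G) (kindb true) sg f.

Lemma chart_adj x y : adj (f x) (f y) <-> f4adj sg x y.
Proof. by have [_ fE _] := cf; rewrite -fE; split=> [/asboolP|/asboolP]. Qed.

Lemma chart_surj v : exists x, v = f x.
Proof. by have [[g _ gK] _ _] := cf; exists (g v); rewrite gK. Qed.

Lemma mono_clique_chart c (x : 'I_4 -> G) : mono_clique c x ->
  exists i (u : 'I_4 -> bool * bool), bijective u /\ forall a, x a = f (c, i, u a).
Proof.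
move=> [xI xc xx _]; have [bf fE fK] := cf.
have /choice[p pP] : forall a, exists p, x a = f p by move=> a; exact: chart_surj.
have kd (a : 'I_4) : (p a).1.1 = c.
  rewrite -fK /kindb -pP; have := xc a.
  by case: (c); case: asboolP.
pose i := (p ord0).1.2.
have pE a : p a = (c, i, (p a).2).
  have [<-|a0] := eqVneq ord0 a; first by rewrite -(kd ord0) /i; case: (p ord0) => -[].
  have := xx _ _ (elimN eqP a0); rewrite !pP => /chart_adj.
  rewrite -(kd a) /i; have := kd a; have := kd ord0.
  case: (p a) (p ord0) => [[c1 j1] v1] [[c2 j2] v2] /= -> ->.
  by rewrite eqxx => /andP[/eqP-> _].
exists i, (fun a => (p a).2); split; last by move=> a; rewrite pP {1}pE.
apply: inj_card_bij; last by rewrite card_ord card_prod card_bool.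
by move=> a b ab; apply: xI; rewrite !pP (pE a) (pE b) ab.
Qed.

(** Twisting complements the adjacencies between a short and a long clique, that
    is, the constant term of their equation. *)
Lemma twist_chart (d : twist_data G) :
  exists sg', charted (twist d) sg' /\ parity sg' = ~~ parity sg.
Proof.
have [bf fE fK] := cf; have fI := bij_inj bf.
have [i [u [[u1 _ u1K] xE]]] := mono_clique_chart (tw_short d).
have [j [v [[v1 _ v1K] yE]]] := mono_clique_chart (tw_long d).
pose sg' k l := sg k l (+) ((k == i) && (l == j)).
pose isp (x y : f4point) := (x.1 == (true, i)) && (y.1 == (false, j)) ||
  (x.1 == (false, j)) && (y.1 == (true, i)).
have pairP x y : (exists a b, xy_pair d a b (f x) (f y)) <-> isp x y.
  split.
    by move=> [a [b [[]|[]]]]; rewrite xE yE => /fI-> /fI->; rewrite /isp !eqxx ?orbT.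
  case: x y => [x1 x2] [y1 y2] /orP[] /andP[/eqP/= -> /eqP/= ->].
    by exists (u1 x2), (v1 y2); left; rewrite xE yE u1K v1K.
  by exists (u1 y2), (v1 x2); right; rewrite xE yE u1K v1K.
have pair_adj x y a b : xy_pair d a b (f x) (f y) ->
    adj (f x) (f y) <-> (a < 2)%N = (b < 2)%N.
  by case=> -[-> ->]; rewrite -(tw_adj d) //; split; exact: adj_sym.
have sgE x y : f4adj sg' x y = f4adj sg x y (+) isp x y.
  case: x y => [[c k] w] [[c' l] w']; rewrite /f4adj /isp /sg' /= !xpair_eqE.
  have [<-|cc] := eqVneq c c'; first by case: (c); rewrite /= ?andbF ?addbF.
  case: c c' cc => -[] //= _; rewrite ?orbF ?(andbC (k == j)).
    by move: (_ && _) (lform _ _) (lform _ _) (sg _ _) => [] [] [] [].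
  by move: (_ && _) (lform _ _) (lform _ _) (sg _ _) => [] [] [] [].
exists sg'; split.
  exists f; split=> // x y; rewrite sgE; apply/asboolP/idP => [[]|].
  - move=> [a [b [ab nab]]]; have -> : isp x y by apply/pairP; exists a, b.
    rewrite addbT; apply/negP => /chart_adj; rewrite (pair_adj _ _ _ _ ab).
    by move/nab.
  - move=> [/chart_adj-> npair]; have -> : isp x y = false by apply/negP => /pairP.
    by [].
  have [/pairP[a [b ab]]|nxy] := boolP (isp x y).
    rewrite addbT => /negP nE; left; exists a, b; split=> // abE.
    by apply/nE/chart_adj/(pair_adj _ _ _ _ ab).
  rewrite addbF => /chart_adj xy; right; split=> // /pairP.
  exact/negP.
rewrite [LHS](parity_addb sg (fun k l => (k == i) && (l == j))).
by elim/ord3_ind: (i); elim/ord3_ind: (j); rewrite addbT.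
Qed.

Lemma twist_data_chart : inhabited (twist_data G).
Proof.
have [bf fE fK] := cf; have fI := bij_inj bf.
pose pt c (a : 'I_4) (t : bool) : f4point := (c, i0, ((2 <= a) (+) t, odd a)).
have ptI c t : injective (pt c ^~ t).
  move=> a b [] /addIb h1 h2; apply: val_inj => /=.
  by move: (ltn_ord a) (ltn_ord b) h1 h2; lia.
have ptS c t w : exists a, (c, i0, w) = pt c a t.
  have a_lt : (w.1 (+) t).*2 + w.2 < 4 by case: w t => [] [] [] [].
  by exists (Ordinal a_lt); rewrite /pt /=; congr (_, _); case: w t {a_lt} => [] [] [] [].
have clique c t : mono_clique c (fun a => f (pt c a t) : G).
  split.
  - by move=> a b /fI/ptI.
  - by move=> a; have := fK (pt c a t); rewrite /kindb /=; case: c; case: asboolP.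
  - move=> a b /eqP ab; apply/chart_adj; rewrite /f4adj /= !eqxx /=.
    apply: contra ab => /eqP h; apply/eqP/(ptI c t); congr (_, _); exact: h.
  - move=> a v; have [[[c' k] w] ->] := chart_surj v; move=> vc.
    have cc : c' = c by rewrite -[c']/((c', k, w).1.1) -fK; move: vc; rewrite /kindb;
      case: (c); case: asboolP.
    move=> /chart_adj; rewrite cc /= eqxx => /andP[/eqP<- _].
    by have [b ->] := ptS c t w; exists b.
have adjP a b : adj (f (pt true a false)) (f (pt false b (sg i0 i0))) <->
    (a < 2)%N = (b < 2)%N.
  rewrite chart_adj /= /lform /= (ltnNge a) (ltnNge b) addbF.
  by case: (2 <= a)%N; case: (2 <= b)%N; case: (sg i0 i0); split.
have strong : strongly_connected (fun a => f (pt true a false) : G)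
    (fun b => f (pt false b (sg i0 i0)) : G).
  by split=> a; exists a; apply/adjP.
exact: inhabits (TwistData (clique true false) (clique false (sg i0 i0)) strong adjP).
Qed.

End Twist.

(** ** The chart of the Weyl graph of type F4 *)

(** The constant terms that belong to the labelling [weylF4_index] below. *)
Definition weylF4_sg (i j : 'I_3) : bool := ~~ ((i == i2) && (j == i2)).

(** The positions in [rootlF4] of the points of the three short and then the
    three long cliques, each in the order 00, 01, 10, 11 of the plane. *)
Definition weylF4_index (x : f4point) : nat :=
  let: (c, i, u) := x in
  nth 0 [:: 0; 1; 2; 3; 16; 19; 21; 22; 17; 18; 20; 23;
            4; 5; 14; 15; 6; 7; 12; 13; 8; 9; 10; 11]
    (~~ c * 12 + i * 4 + u.1 * 2 + u.2).

Definition f4points : seq f4point :=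
  [seq (ci, u) | ci <- [seq (c, i) | c <- [:: true; false], i <- [:: i0; i1; i2]],
                 u <- [seq (a, b) | a <- [:: true; false], b <- [:: true; false]]].

Lemma mem_f4points x : x \in f4points.
Proof.
case: x => -[c i] [a b]; apply/allpairsP; exists ((c, i), (a, b)); split=> //.
  by apply/allpairsP; exists (c, i); split=> //; [case: (c) | elim/ord3_ind: (i)].
by apply/allpairsP; exists (a, b); split=> //; [case: (a) | case: (b)].
Qed.

Definition weylF4_ok (x y : f4point) : bool :=
  let n := weylF4_index in
  [&& n x < 24, (n x == n y) == (x == y),
      adjl rootlF4 (n x) (n y) == f4adj weylF4_sg x y
    & (dotl (nth [::] rootlF4 (n x)) (nth [::] rootlF4 (n x)) == 4%R) == x.1.1].

Lemma weylF4_table : forall x y, weylF4_ok x y.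
Proof.
have /allP ok : all (fun x => all (weylF4_ok x) f4points) f4points by vm_compute.
by move=> x y; have /allP := ok x (mem_f4points x); apply; exact: mem_f4points.
Qed.

Section WeylF4.

Local Open Scope ring_scope.

Lemma rootsF4_norm a : rootsF4 a -> dot a a = 2 \/ dot a a = 1 /\
  exists2 s, s \in rootlF4 & dotl s s = 4 /\ refl a = refl (vecl 4 s).
Proof.
have half (w : bitseq) : size w = 3 -> code_half (false :: w) \in rootlF4 /\
    dotl (code_half (false :: w)) (code_half (false :: w)) = 4.
  move=> sw; split; first by rewrite mem_rootlF4 (map_f (fun v => code_half (false :: v))) ?orbT // mem_words sw.
  by case: w sw => [|[] [|[] [|[] []]]].
have axis k : (k < 4)%N -> dotl (codeB 4 k) (codeB 4 k) = 4.
  by case: k => [|[|[|[|]]]].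
case=> [[[i [j [s [t [/eqP ij ->]]]]]|[i [s ->]]]|[S ->]]; [left|right|right].
- rewrite !dotDl !dotDr !dotZl !dotZr !dot_e !eqxx (eq_sym j) (negbTE ij).
  by case: s; case: t.
- split; first by rewrite dotZl dotZr dot_e eqxx; case: s.
  exists (codeB 4 i); last by rewrite axis // vecl_codeB reflZ ?signr_eq0.
  by rewrite mem_rootlF4 (map_f (codeB 4)) // mem_iota ltn_ord.
- split; last first.
    have [w sw [c c0 [-> _]]] := half_vec_word S; have [wF w4] := half w sw.
    by exists (code_half (false :: w)); rewrite // reflZ.
  rewrite /dot (eq_bigr (fun=> 4^-1)) => [|k _].
    by rewrite sumr_const card_ord -mulr_natl.
  by rewrite mxE; case: (k \in S).
Qed.

Lemma weylF4_charted : charted (weyl_bigraph F_4) weylF4_sg.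
Proof.
have [P1 P2] := rootlF4_represents.
have [E [Es [Ei [EE [h [bh hE hr]]]]]] :=
  @root_list_iso 4 rootsF4 rootlF4 23 ltac:(by vm_compute) ltac:(by vm_compute) P1 P2.
pose n x : 'I_24 := inord (weylF4_index x).
have nE x : val (n x) = weylF4_index x.
  by rewrite /n /= inordK //; have /and4P[] := weylF4_table x x.
have nI : injective n.
  move=> x y /(congr1 val); rewrite !nE => /eqP; have /and4P[_ /eqP-> _ _] := weylF4_table x y.
  by move/eqP.
have bn : bijective n.
  by apply: inj_card_bij => //; rewrite card_ord !card_prod card_bool card_ord.
have hI := bij_inj bh.
exists (h \o n); split.
- exact: bij_comp bh bn.
- move=> x y; have /and4P[_ _ /eqP <- _] := weylF4_table x y.
  by rewrite -!nE -EE; apply/asboolP/idP => [/(hE (n x) (n y))|]; last by move/(hE (n x) (n y)).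
- move=> x; have /and4P[_ _ _ /eqP <-] := weylF4_table x x; rewrite -nE.
  set t := n x; have tF : nth [::] rootlF4 t \in rootlF4 by apply: mem_nth; apply: ltn_ord.
  rewrite /kindb eqb_id; apply/asboolP/eqP => [[a [Ra [b Rb ab]]]|t4].
    move=> /= ha; have [a2|[_ [s /(nthP [::])[k kF <-] [s4 as']]]] := rootsF4_norm Ra.
      by move: ab; rewrite a2; have [->|[-> _]] := rootsF4_norm Rb.
    have tk : t = Ordinal (kF : k < 24)%N.
      by apply: hI; apply: sval_inj; rewrite ha as' hr.
    by rewrite tk.
  have sz : size (nth [::] rootlF4 t) = 4.
    by apply/eqP; apply: (allP (_ : all (fun s => size s == 4) rootlF4)).
  exists (vecl 4 (nth [::] rootlF4 t)); last by rewrite /= hr.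
  split; first exact: P1.
  exists (e ord0 + e (lift ord0 ord0)).
    left; left; exists ord0, (lift ord0 ord0), false, false.
    by rewrite !scale1r; split.
  rewrite dot_vecl // t4 !dotDl !dotDr !dot_e /=.
  by [].
Qed.

End WeylF4.

(** * Uniqueness of Weyl graphs among the graphs locally like them *)

Lemma F4_iso (d : twist_data (weyl_bigraph F_4)) (G : bigraph) :
  same_card G 'I_24 /\ bi_locally_like G (weyl_bigraph F_4) <->
  bigraph_iso G (weyl_bigraph F_4) \/ bigraph_iso G (twist d).
Proof.
have cW := weylF4_charted; have [f cf] := cW.
have [sg' [cT pT]] := twist_chart cf d.
split=> [[c24 loc]|].
  have [sg cG] := locally_like_charted c24 cW loc.
  have [pp|pp] := eqVneq (parity sg) (parity weylF4_sg).
    by left; exact: charted_parity cG cW pp.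
  right; apply: charted_parity cG cT _; rewrite pT.
  by move: pp; case: (parity sg); case: (parity weylF4_sg).
suff H sg : charted G sg -> same_card G 'I_24 /\ bi_locally_like G (weyl_bigraph F_4).
  by case=> iso; apply: H; [exact: charted_iso iso cW | exact: charted_iso iso cT].
by move=> cG; split; [exact: charted_card cG | exact: charted_locally_like cG cW].
Qed.

Theorem mainTheorem1 :
  (* (1) *)
  (forall (M : dynkin) (G : graph),
     (exists2 n : nat, 8 <= n & M = A_ n) \/
     (exists2 n : nat, 9 <= n & M = D_ n) \/
     M = E_7 ->
     connected G -> locally_like G (weyl_graph M) ->
     graph_iso G (weyl_graph M)) /\
  (forall (M : dynkin) (G : bigraph),
     (exists2 n : nat, n = 3 \/ 5 <= n & M = B_ n \/ M = C_ n) ->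
     connected G -> bi_locally_like G (weyl_bigraph M) ->
     bigraph_iso G (weyl_bigraph M)) /\
  (* (2) *)
  (forall (M : dynkin) (G : graph),
     M = A_ 6 \/ M = A_ 7 \/ M = D_ 7 \/ M = D_ 8 \/ M = E_6 \/ M = E_8 ->
     locally_like G (weyl_graph M) -> same_card G (weyl_graph M) ->
     graph_iso G (weyl_graph M)) /\
  (* (3) *)
  (inhabited (twist_data (weyl_bigraph F_4)) /\
   forall (d : twist_data (weyl_bigraph F_4)) (G : bigraph),
     same_card G 'I_24 /\ bi_locally_like G (weyl_bigraph F_4) <->
     bigraph_iso G (weyl_bigraph F_4) \/ bigraph_iso G (twist d)).
Proof.
split; [|split; [|split]].
- move=> M G hM conn /locally_like_local.
  case: hM => [[n n8 ->]|[[n n9 ->]|->]].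
  + exact: A_iso.
  + exact: D_iso.
  + exact: E7_iso.
- move=> M G [n n35 [->|->]] conn.
  + exact: (BC_iso (c := true)).
  + exact: (BC_iso (c := false)).
- move=> M G hM /locally_like_local.
  case: hM => [->|[->|[->|[->|[->|->]]]]].
  + exact: A6_iso.
  + exact: A7_iso.
  + by move=> loc card; apply: (D_iso_of_A (n := 5)) => // H lH _ cH; exact: A6_iso lH (cH card).
  + by move=> loc card; apply: (D_iso_of_A (n := 6)) => // H lH _ cH; exact: A7_iso lH (cH card).
  + exact: E6_iso.
  + exact: E8_iso.
- split; last exact: F4_iso.
  by have [f cf] := weylF4_charted; exact: twist_data_chart cf.
Qed.
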